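(* Let $n\ge 3$ and $s>0$, and let $E$ be the Einstein constant of the Einstein metric $g=g_{s,\,s\sqrt{n/(2(n-1))}}$ on $\mathrm{S}_{\mathbb C}(\mathbb R^{2(n+1)})$, i.e. $\operatorname{Rc}(g)=E g$. Then $$\lambda_1\big(\mathrm{S}_{\mathbb C}(\mathbb R^{2(n+1)}),\,g_{s,\,s\sqrt{n/(2(n-1))}}\big)<2E .$$
   Context: Let $n\ge3$ and $\mathrm{S}_{\mathbb C}(\mathbb R^{2(n+1)})=\mathrm{SO}(2n+2)/\mathrm{U}(n+1)$. Let $G=\left\{\begin{pmatrix}1&0\\0&A\end{pmatrix}:A\in \mathrm{SO}(2n+1)\right\}\subset \mathrm{SO}(2n+2)$, with Lie algebra $\mathfrak g\cong\mathfrak{so}(2n+1)$. Writing matrices in blocks of sizes $1,n,1,n$, let $K,H$ be the connected subgroups of $G$ with Lie algebras $$\mathfrak k=\left\{\begin{pmatrix}0&0&0&0\\0&X_1&0&X_2\\0&0&0&0\\0&X_3&0&X_4\end{pmatrix}: \begin{pmatrix}X_1&X_2\\ X_3&X_4\end{pmatrix}\in\mathfrak{so}(2n)\right\},$$ $$\mathfrak h=\left\{\begin{pmatrix}0&0&0&0\\0&X&0&-Y\\0&0&0&0\\0&Y&0&X\end{pmatrix}: X\in\mathfrak{so}(n),\ Y\in\mathfrak{gl}(n,\mathbb R),\ Y^t=Y\right\}\cong\mathfrak u(n),$$ so $H\subset K\subset G$. The group $G$ acts transitively on $\mathrm{S}_{\mathbb C}(\mathbb R^{2(n+1)})$ with isotropy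 subgroup $H$, so $\mathrm{S}_{\mathbb C}(\mathbb R^{2(n+1)})=G/H$. Let $\mathrm B_{\mathfrak g}(X,Y)=-(2n-1)\operatorname{Tr}(XY)$ (the negative of the Killing form of $\mathfrak g$), let $\mathfrak m$ be the $\mathrm B_{\mathfrak g}$-orthogonal complement of $\mathfrak k$ in $\mathfrak g$, and $\mathfrak q$ that of $\mathfrak h$ in $\mathfrak k$. For $s,t>0$, $g_{s,t}$ is the $G$-invariant Riemannian metric on $G/H$ induced by the $\mathrm{Ad}(H)$-invariant inner product $\frac1{s^2}\mathrm B_{\mathfrak g}|_{\mathfrak m}\oplus\frac1{t^2}\mathrm B_{\mathfrak g}|_{\mathfrak q}$ on $\mathfrak m\oplus\mathfrak q$. It is known (Wang–Ziller, Kerr) that the metrics $g_{s,t}$ with $t^2=\frac{n}{2(n-1)}s^2$ are Einstein, pairwise homothetic, and are exactly the non-symmetric Einstein metrics in the family $\{g_{s,t}\}$. $\lambda_1(M,g)$ denotes the smallest positive eigenvalue of the Laplace-Beltrami operator of $(M,g)$. *)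

(* Defs.v *)
From HB Require Import structures.
From mathcomp Require Import all_boot all_order all_algebra.
From mathcomp Require Import all_classical all_reals all_analysis.

Set Implicit Arguments.
Unset Strict Implicit.
Unset Printing Implicit Defensive.

Import Order.TTheory GRing.Theory Num.Theory.
Import numFieldNormedType.Exports.

Local Open Scope classical_set_scope.
Local Open Scope ring_scope.

(** * Riemannian geometry in local coordinates *)

Definition partial (R : realType) (d : nat) (W : normedModType R) (i : 'I_d)
    (f : 'rV[R]_d -> W) : 'rV[R]_d -> W :=
  fun x => 'D_(delta_mx 0 i) f x.

(* Meant for open U. *)
Fixpoint Ck_on (R : realType) (d : nat) (W : normedModType R) (k : nat)
    (U : set 'rV[R]_d) (f : 'rV[R]_d -> W) : Prop :=
  match k with
  | 0%N => forall x, U x -> {for x, continuous f}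
  | k'.+1 => forall i : 'I_d,
      (forall x, U x -> derivable f x (delta_mx 0 i)) /\
      Ck_on k' U (partial i f)
  end.

Definition smooth_on (R : realType) (d : nat) (W : normedModType R)
    (U : set 'rV[R]_d) (f : 'rV[R]_d -> W) : Prop :=
  forall k, Ck_on k U f.

(* In this block g x is the matrix (g_ij(x)) of a Riemannian metric in a
   coordinate chart. *)

(* christoffel g k i j = Gamma^k_ij *)
Definition christoffel (R : realType) (d : nat) (g : 'rV[R]_d -> 'M[R]_d)
    (k i j : 'I_d) (x : 'rV[R]_d) : R :=
  2^-1 * \sum_(l < d) invmx (g x) k l *
    (partial i (fun y => g y j l : R^o) x
     + partial j (fun y => g y i l : R^o) x
     - partial l (fun y => g y i j : R^o) x).

(* Ric_jk = R^i_kij, positive on round spheres. *)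
Definition ricci (R : realType) (d : nat) (g : 'rV[R]_d -> 'M[R]_d)
    (x : 'rV[R]_d) : 'M[R]_d :=
  \matrix_(j, k) \sum_(i < d)
    (partial i (christoffel g i j k : _ -> R^o) x
     - partial j (christoffel g i i k : _ -> R^o) x
     + \sum_(l < d) (christoffel g i i l x * christoffel g l j k x
                     - christoffel g i j l x * christoffel g l i k x)).

(* Minus the trace of the covariant Hessian, i.e. - div grad: the geometers'
   sign, so that the spectrum is nonnegative. *)
Definition laplace_beltrami (R : realType) (d : nat) (g : 'rV[R]_d -> 'M[R]_d)
    (u : 'rV[R]_d -> R^o) (x : 'rV[R]_d) : R :=
  - \sum_(i < d) \sum_(j < d) invmx (g x) i j *
      (partial i (partial j u) x
       - \sum_(k < d) christoffel g k i j x * partial k u x).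

(** * The groups and Lie algebras *)

Definition so (R : realType) (m : nat) : set 'M[R]_m := [set X | X^T = - X].

Definition SO (R : realType) (m : nat) : set 'M[R]_m :=
  [set A | A^T *m A = 1%:M /\ \det A = 1].

(* Matrices of size 2n+2 in blocks of sizes 1,n,1,n. The size (1+n)+(1+n) is
   convertible to 1+(n+(1+n)), which is used for the block splitting in G
   and g. *)
Notation amb R n := 'M[R]_((1 + n) + (1 + n)).

Definition G (R : realType) (n : nat) : set (amb R n) :=
  [set a | exists2 A : 'M[R]_(n + (1 + n)),
     SO A & a = (block_mx 1%:M 0 0 A : 'M[R]_(1 + (n + (1 + n))))].

Definition lie_g (R : realType) (n : nat) : set (amb R n) :=
  [set a | exists2 A : 'M[R]_(n + (1 + n)),
     so A & a = (block_mx 0 0 0 A : 'M[R]_(1 + (n + (1 + n))))].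

(* The matrix with rows (0,0,0,0), (0,X1,0,X2), (0,0,0,0), (0,X3,0,X4). *)
Definition blocks24 (R : realType) (n : nat) (X1 X2 X3 X4 : 'M[R]_n) :
    amb R n :=
  block_mx (block_mx 0 0 0 X1) (block_mx 0 0 0 X2)
           (block_mx 0 0 0 X3) (block_mx 0 0 0 X4).

Definition lie_k (R : realType) (n : nat) : set (amb R n) :=
  [set a | exists X1 X2 X3 X4 : 'M[R]_n,
     so (block_mx X1 X2 X3 X4) /\ a = blocks24 X1 X2 X3 X4].

Definition lie_h (R : realType) (n : nat) : set (amb R n) :=
  [set a | exists X Y : 'M[R]_n,
     [/\ so X, Y^T = Y & a = blocks24 X (- Y) Y X]].

(* The connected Lie subgroup with Lie algebra L: the leaf through 1 of the
   left-invariant distribution spanned by L, i.e. the endpoints of the C^1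
   paths from 1 whose velocity at c t lies in c t * L. *)
Definition connected_subgroup (R : realType) (m : nat) (L : set 'M[R]_m) :
    set 'M[R]_m :=
  [set a | exists c X : R^o -> 'M[R]_m,
     [/\ continuous X,
         forall t : R^o, L (X t),
         forall t : R^o, is_derive t (1 : R^o) c (c t *m X t),
         c 0 = 1%:M & c 1 = a]].

Definition H (R : realType) (n : nat) : set (amb R n) :=
  connected_subgroup (@lie_h R n).

(** * The metrics g_{s,t} *)

Definition Bg (R : realType) (n : nat) (X Y : amb R n) : R :=
  - (2 * n%:R - 1) * \tr (X *m Y).

Definition lie_m (R : realType) (n : nat) : set (amb R n) :=
  [set X | lie_g X /\ forall Y, lie_k Y -> Bg X Y = 0].

Definition lie_q (R : realType) (n : nat) : set (amb R n) :=
  [set X | lie_k X /\ forall Y, lie_h Y -> Bg X Y = 0].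

(* Components along m and q in g = m + k, k = q + h. *)
Definition pr_m (R : realType) (n : nat) (X : amb R n) : amb R n :=
  xget 0 [set Z | lie_m Z /\ lie_k (X - Z)].

Definition pr_q (R : realType) (n : nat) (X : amb R n) : amb R n :=
  xget 0 [set Z | lie_q Z /\ lie_h (X - pr_m X - Z)].

(* The inner product on m + q, pulled back to g along g -> g/h = m + q. *)
Definition ip (R : realType) (n : nat) (s t : R) (X Y : amb R n) : R :=
  (s ^+ 2)^-1 * Bg (pr_m X) (pr_m Y) + (t ^+ 2)^-1 * Bg (pr_q X) (pr_q Y).

(** * The homogeneous space G/H *)

(* dim G/H = dim so(2n+1) - dim u(n) *)
Definition dimGH (n : nat) : nat := n * n.+1.

(* The coordinate vector sg^-1 d(sg)(v), an element of g. *)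
Definition log_derive (R : realType) (n d : nat) (sg : 'rV[R]_d -> amb R n)
    (v : 'rV[R]_d) (x : 'rV[R]_d) : amb R n :=
  invmx (sg x) *m 'D_v sg x.

(* Local coordinates on G/H, presented by a smooth lift sg : U -> G of the
   parametrization x |-> sg x H (every chart has such lifts locally). As the
   kernel of T_a G -> T_aH(G/H) is a * h, the last clause says that the
   parametrization is an immersion, hence a local diffeomorphism since
   dim U = dim G/H. Injectivity is not required: it can always be had by
   shrinking U, and all notions below are local. *)
Definition chart (R : realType) (n : nat) (U : set 'rV[R]_(dimGH n))
    (sg : 'rV[R]_(dimGH n) -> amb R n) : Prop :=
  [/\ open U, smooth_on U sg,
      forall x, U x -> G (sg x) &
      forall x v, U x -> lie_h (log_derive sg v x) -> v = 0].

(* The matrix of g_{s,t} in the chart sg. *)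
Definition metric (R : realType) (n : nat) (s t : R)
    (sg : 'rV[R]_(dimGH n) -> amb R n) (x : 'rV[R]_(dimGH n)) :
    'M[R]_(dimGH n) :=
  \matrix_(i, j) ip s t (log_derive sg (delta_mx 0 i) x)
                        (log_derive sg (delta_mx 0 j) x).

(* Rc(g_{s,t}) = E g_{s,t} *)
Definition einstein_constant (R : realType) (n : nat) (s t E : R) : Prop :=
  forall (U : set 'rV[R]_(dimGH n)) (sg : 'rV[R]_(dimGH n) -> amb R n),
    chart U sg -> forall x, U x ->
    ricci (metric s t sg) x = E *: metric s t sg x.

(* Functions on G/H are right H-invariant functions on G; their values outside
   G are irrelevant. *)
Definition smooth_on_GH (R : realType) (n : nat) (f : amb R n -> R^o) : Prop :=
  (forall a h, G a -> H h -> f (a *m h) = f a) /\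
  (forall (U : set 'rV[R]_(dimGH n)) (sg : 'rV[R]_(dimGH n) -> amb R n),
     chart U sg -> smooth_on U (f \o sg)).

Definition eigenvalue_GH (R : realType) (n : nat) (s t lam : R) : Prop :=
  exists f : amb R n -> R^o,
    [/\ smooth_on_GH f,
        exists2 a, G a & f a != 0 &
        forall (U : set 'rV[R]_(dimGH n)) (sg : 'rV[R]_(dimGH n) -> amb R n),
          chart U sg -> forall x, U x ->
          laplace_beltrami (metric s t sg) (f \o sg) x = lam * f (sg x)].

(* The smallest positive eigenvalue of the Laplace-Beltrami operator of
   (G/H, g_{s,t}), as an infimum (the spectrum is discrete, so it is attained);
   it would be +oo if there were no positive eigenvalue. *)
Definition lambda1 (R : realType) (n : nat) (s t : R) : \bar R :=
  ereal_inf [set lam%:E | lam in [set lam : R |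
    0 < lam /\ @eigenvalue_GH R n s t lam]].

(* Main.v *)
Require Import Defs.
From HB Require Import structures.
From mathcomp Require Import all_boot all_order all_algebra.
From mathcomp Require Import all_classical all_reals all_analysis.
From mathcomp Require Import ring lra.

(** Let [iz] be the index of the third block, of size one. K fixes the basis
vector [ez], so the matrix entry [a iz iz] is a function on G/H, pulled back
from the height function of the sphere G/K. It is an eigenfunction: the
Laplacian of an H-invariant function is minus the sum of its second derivatives
along an orthonormal basis of m + q; here q annihilates [ez], and each of the
[2 n] basis elements of m squares to [- c] on it, with
[c = s^2 / (2 (2 n - 1))]. The eigenvalue is thus [2 n c]. On the other hand, the
Ricci curvature of a unit vector of m is
[c (2 n - 1 - kap (n - 1))] with [kap = s^2 / (2 t^2)], and [kap = (n - 1) / n]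
for the Einstein metric. Hence [2 E] exceeds the eigenvalue by
[2 c (n - 1) / n], which is positive.

The two computations are carried out in coordinates by moving frames. A chart is
a lift [sg] to G; its Maurer-Cartan form [sg^-1 d(sg)], in coordinates along an
orthonormal basis of m + q, is a frame [M] with [g = M M^T]. For such a frame
and a skew torsion-free connection form [A], the Christoffel symbols are the
gauge transform of [A] by [M] ([christoffel_frame]), and the Ricci tensor and
the Laplacian follow ([ricci_frame], [laplace_frame]). On G/H, [A] is the
composite of the Maurer-Cartan form with an algebraic map [lc_form]; it is skew
by the invariance of the trace form, and torsion-free by the Maurer-Cartan
equation. So the Laplacian ([laplace_zz], valid in all charts) and the Ricci
tensor ([frame_curvatureE]) are purely algebraic. The latter is evaluated at one
point of one chart, given by the Cayley transform, for one direction of m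
([ricci_dirE]).

A function is smooth when all its iterated partial derivatives exist and are
continuous. The differential calculus that this requires, namely the symmetry of
second derivatives, directional derivatives as combinations of partial ones, and
the smoothness of products and matrix inverses, is established first. *)

Set Implicit Arguments.
Unset Strict Implicit.
Unset Printing Implicit Defensive.

Import Order.TTheory GRing.Theory Num.Theory.
Import numFieldNormedType.Exports.

Local Open Scope classical_set_scope.
Local Open Scope ring_scope.

(** * Calculus of smooth functions on open sets *)

Section DirectionalDerivatives.
Context {R : realType} {V : normedModType R}.
Implicit Types (f : V -> R^o) (x y v w : V).

Lemma is_derive_lineE f y v (t : R) (l : R) :
  is_derive (t : R) (1 : R) (fun r : R => f (y + r *: v) : R^o) l <->
  is_derive (y + t *: v) v f l.
Proof.
have E : (fun h : R => h^-1 *: (((fun r : R => f (y + r *: v)) \o shift t)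
             (h *: 1) - f (y + t *: v) : R^o)) =
         (fun h : R => h^-1 *: ((f \o shift (y + t *: v)) (h *: v)
             - f (y + t *: v))).
  apply/funext => h /=; congr (_ *: (f _ - _)).
  by rewrite [h *: 1]mulr1 scalerDl addrCA.
split=> -[].
  by rewrite /derivable /derive E => df dl; split.
by rewrite /derivable /derive -E => df dl; split.
Qed.

Lemma MVT_line f y v :
  (forall t : R, 0 <= t <= 1 -> derivable f (y + t *: v) v) ->
  exists2 t : R, 0 <= t <= 1 & f (y + v) - f y = 'D_v f (y + t *: v).
Proof.
move=> df; pose g (r : R) : R := f (y + r *: v).
pose dg (r : R) : R := 'D_v f (y + r *: v).
have dgE (t : R) : 0 <= t <= 1 -> is_derive t 1 (g : R -> R) (dg t).
  by move=> t01; apply/is_derive_lineE/derivableP/df.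
have cg : {within `[0, 1], continuous g}.
  apply: derivable_within_continuous => t; rewrite in_itv /= => t01.
  by have [] := dgE _ t01.
have [t t01 E] := @MVT R g dg 0 1 ltr01
  (fun (t : R) h => dgE t (subset_itv_oo_cc h)) cg.
exists t; first by move: t01; rewrite in_itv /= => /andP[/ltW -> /ltW ->].
by move: E; rewrite subr0 mulr1 /g scale1r scale0r addr0.
Qed.

Lemma is_deriveZv f x v (c : R) : derivable f x v ->
  is_derive x (c *: v) f (c * 'D_v f x).
Proof.
move=> /derivableP df.
have -> : x = x + (0 : R) *: (c *: v) by rewrite scale0r addr0.
apply/is_derive_lineE.
have df0 : is_derive (0 * c : R) (1 : R) (fun r : R => f (x + r *: v) : R)
    ('D_v f x).
  by apply/is_derive_lineE; rewrite mul0r scale0r addr0.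
have dc : is_derive (0 : R) (1 : R) (fun r : R => r * c : R) c.
  by apply: is_derive_eq; rewrite scaler0 add0r [_ *: _]mulr1.
have := @is_derive1_comp _ (fun r : R => f (x + r *: v) : R)
  (fun r : R => r * c : R) 0 _ _ df0 dc.
rewrite scale0r addr0 mulrC.
have -> : (fun r : R => f (x + r *: v)) \o (fun r => r * c) =
  (fun r : R => f (x + r *: (c *: v))) by apply/funext => r /=; rewrite scalerA.
by [].
Qed.

End DirectionalDerivatives.

Section Smooth.
Context {R : realType} {d : nat}.
Local Notation X := 'rV[R]_d.
Local Notation "''e_' i" := (delta_mx 0 i : X) (at level 8, i at level 2).
Implicit Types (f g : X -> R^o) (U : set X) (x v : X) (i j : 'I_d).

Lemma near_eq_on (W : Type) U (f g : X -> W) x : open U ->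
  (forall y, U y -> f y = g y) -> U x -> \forall y \near x, f y = g y.
Proof.
by move=> oU fg Ux; apply: (filterS fg); exact: open_nbhs_nbhs (conj oU Ux).
Qed.

Lemma partial_eq_on (W : normedModType R) U (f g : X -> W) i x : open U ->
  (forall y, U y -> f y = g y) -> U x -> partial i f x = partial i g x.
Proof.
by move=> oU fg Ux; have nfg := near_eq_on oU fg Ux; exact: near_eq_derive.
Qed.

Lemma derivable_eq_on (W : normedModType R) U (f g : X -> W) v x : open U ->
  (forall y, U y -> f y = g y) -> U x -> derivable f x v -> derivable g x v.
Proof.
by move=> oU fg Ux; have nfg := near_eq_on oU fg Ux; exact: near_eq_derivable.
Qed.

Lemma continuous_eq_on (W : normedModType R) U (f g : X -> W) x : open U ->
  (forall y, U y -> f y = g y) -> U x ->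
  {for x, continuous f} -> {for x, continuous g}.
Proof.
move=> oU fg Ux; rewrite /prop_for /continuous_at -(fg x Ux) => cf.
have nfg := near_eq_on oU fg Ux.
exact: (cvg_trans (near_eq_cvg nfg) cf).
Qed.

Lemma Ck_on_eq (W : normedModType R) k U (f g : X -> W) : open U ->
  (forall y, U y -> f y = g y) -> Ck_on k U f -> Ck_on k U g.
Proof.
move=> oU; elim: k f g => [|k IH] f g fg /=.
  by move=> cf x Ux; exact: (continuous_eq_on oU fg Ux (cf x Ux)).
move=> Cf i; have [df Ckf] := Cf i; split.
  by move=> x Ux; exact: (derivable_eq_on oU fg Ux (df x Ux)).
by apply: IH Ckf => y Uy; exact: (partial_eq_on _ oU fg Uy).
Qed.

Lemma smooth_on_eq (W : normedModType R) U (f g : X -> W) : open U ->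
  (forall y, U y -> f y = g y) -> smooth_on U f -> smooth_on U g.
Proof. by move=> oU fg sf k; exact: (Ck_on_eq oU fg (sf k)). Qed.

Lemma smooth_on_sub (W : normedModType R) U1 U2 (f : X -> W) :
  U1 `<=` U2 -> smooth_on U2 f -> smooth_on U1 f.
Proof.
move=> sU sf k; elim: k f {sf}(sf k) => [|k IH] f /= cf.
  by move=> x /sU; exact: cf.
move=> i; have [df Cf] := cf i; split; last exact: IH.
by move=> x /sU; exact: df.
Qed.

Section SmoothFacts.
Context (W : normedModType R) (U : set X) (f : X -> W) (sf : smooth_on U f).

Lemma smooth_continuous x : U x -> {for x, continuous f}.
Proof. exact: (sf 0%N). Qed.

Lemma smooth_derivable i x : U x -> derivable f x 'e_i.
Proof. by have [df _] := sf 1%N i; exact: df. Qed.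

Lemma smooth_partial i : smooth_on U (partial i f).
Proof. by move=> k; have [_] := sf k.+1 i. Qed.

End SmoothFacts.

Lemma smooth_cst (W : normedModType R) U (c : W) : smooth_on U (fun=> c).
Proof.
move=> k; elim: k c => [|k IH] c /=; first by move=> x _; exact: (@cst_continuous _ _ c x).
move=> i; split; first by move=> x _; exact: derivable_cst.
rewrite (_ : partial i _ = fun=> 0) //.
by apply/funext => x; rewrite /partial derive_cst.
Qed.

Lemma is_derive_coord i j x :
  is_derive x 'e_i (fun x : X => x 0 j : R^o) ((j == i)%:R).
Proof.
have D : derivable (fun y : X => y) x 'e_i by exact: derivable_id.
split; first by move: D => /derivable_mxP /(_ 0 j).
by have := derive_mx D; rewrite derive_id => /matrixP /(_ 0 j); rewrite !mxE.
Qed.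

Lemma smooth_coord U j : smooth_on U (fun x : X => x 0 j : R^o).
Proof.
case=> [|k] /=; first by move=> x _; exact: coord_continuous.
move=> i; split; first by move=> x _; have [] := is_derive_coord i j x.
have -> : partial i (fun x : X => x 0 j : R^o) = fun=> (j == i)%:R.
  by apply/funext => x; rewrite /partial; have [_] := is_derive_coord i j x.
exact: smooth_cst.
Qed.

(** The algebra generated by smooth functions, closed under inversion of
nowhere vanishing elements. It is stable under partial derivatives and made of
continuous functions, which gives all closure properties of smooth functions
in one coinduction. *)
Inductive smooth_gen U : (X -> R^o) -> Prop :=
| gen_smooth f : smooth_on U f -> smooth_gen U f
| gen_add f g : smooth_gen U f -> smooth_gen U g ->
    smooth_gen U (fun x => f x + g x)
| gen_mul f g : smooth_gen U f -> smooth_gen U g ->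
    smooth_gen U (fun x => f x * g x)
| gen_inv f : smooth_gen U f -> (forall x, U x -> f x != 0) ->
    smooth_gen U (fun x => (f x)^-1)
| gen_eq f g : smooth_gen U f -> (forall x, U x -> f x = g x) ->
    smooth_gen U g.

Lemma smooth_gen_step U f : open U -> smooth_gen U f ->
  (forall x, U x -> {for x, continuous f}) /\
  forall i, (forall x, U x -> derivable f x 'e_i) /\
            smooth_gen U (partial i f).
Proof.
move=> oU; elim=> {f} [f sf|f g Gf [cf df] Gg [cg dg]|f g Gf [cf df] Gg [cg dg]
  |f Gf [cf df] f0|f g Gf [cf df] fg].
- split=> [x|i]; first exact: smooth_continuous.
  split=> [x|]; first exact: smooth_derivable.
  by apply: gen_smooth; exact: smooth_partial.
- split=> [x Ux|i]; first exact: (continuousD (cf x Ux) (cg x Ux)).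
  have [dfi Gfi] := df i; have [dgi Ggi] := dg i.
  split=> [x Ux|]; first exact: (derivableD (dfi x Ux) (dgi x Ux)).
  apply: (gen_eq (gen_add Gfi Ggi)) => x Ux.
  by rewrite /partial (deriveD (dfi x Ux) (dgi x Ux)).
- split=> [x Ux|i]; first exact: (continuousM (cf x Ux) (cg x Ux)).
  have [dfi Gfi] := df i; have [dgi Ggi] := dg i.
  split=> [x Ux|]; first exact: (derivableM (dfi x Ux) (dgi x Ux)).
  apply: (gen_eq (gen_add (gen_mul Gf Ggi) (gen_mul Gg Gfi))) => x Ux.
  by rewrite /partial (deriveM (dfi x Ux) (dgi x Ux)).
- split=> [x Ux|i]; first exact: (continuousV (f0 x Ux) (cf x Ux)).
  have [dfi Gfi] := df i.
  split=> [x Ux|]; first exact: (derivableV (f0 x Ux) (dfi x Ux)).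
  apply: (gen_eq (gen_mul (gen_mul (gen_smooth (@smooth_cst R^o U (- 1)))
    (gen_mul (gen_inv Gf f0) (gen_inv Gf f0))) Gfi)) => x Ux.
  by rewrite /partial (deriveV (f0 x Ux) (dfi x Ux)) mulN1r -expr2 exprVn.
- split=> [x Ux|i]; first exact: (continuous_eq_on oU fg Ux (cf x Ux)).
  have [dfi Gfi] := df i.
  split=> [x Ux|]; first exact: (derivable_eq_on oU fg Ux (dfi x Ux)).
  by apply: (gen_eq Gfi) => x Ux; exact: (partial_eq_on _ oU fg Ux).
Qed.

Lemma smooth_gen_smooth U f : open U -> smooth_gen U f -> smooth_on U f.
Proof.
move=> oU Gf k; elim: k f Gf => [|k IH] f /(smooth_gen_step oU)[cf df] //= i.
by have [dfi Gfi] := df i; split=> //; exact: IH.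
Qed.

Section Closure.
Variables (U : set X) (oU : open U).

Lemma smoothD f g : smooth_on U f -> smooth_on U g ->
  smooth_on U (fun x => f x + g x : R^o).
Proof.
by move=> sf sg; apply: smooth_gen_smooth => //; apply: gen_add;
  exact: gen_smooth.
Qed.

Lemma smoothM f g : smooth_on U f -> smooth_on U g ->
  smooth_on U (fun x => f x * g x : R^o).
Proof.
by move=> sf sg; apply: smooth_gen_smooth => //; apply: gen_mul;
  exact: gen_smooth.
Qed.

Lemma smoothV f : smooth_on U f -> (forall x, U x -> f x != 0) ->
  smooth_on U (fun x => (f x)^-1 : R^o).
Proof.
by move=> sf f0; apply: smooth_gen_smooth => //; apply: gen_inv => //;
  exact: gen_smooth.
Qed.

Lemma smooth_sum (I : Type) (r : seq I) (P : pred I) (F : I -> X -> R^o) :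
  (forall k, smooth_on U (F k)) ->
  smooth_on U (fun x => \sum_(k <- r | P k) F k x : R^o).
Proof.
move=> sF; elim: r => [|k r IH].
  by apply: smooth_on_eq (smooth_cst U (0 : R^o)) => // x _; rewrite big_nil.
case Pk : (P k).
  by apply: smooth_on_eq (smoothD (sF k) IH) => // x _; rewrite big_cons Pk.
by apply: smooth_on_eq IH => // x _; rewrite big_cons Pk.
Qed.

Lemma smooth_prod (I : Type) (r : seq I) (F : I -> X -> R^o) :
  (forall k, smooth_on U (F k)) ->
  smooth_on U (fun x => \prod_(k <- r) F k x : R^o).
Proof.
move=> sF; elim: r => [|k r IH].
  by apply: smooth_on_eq (smooth_cst U (1 : R^o)) => // x _; rewrite big_nil.
by apply: smooth_on_eq (smoothM (sF k) IH) => // x _; rewrite big_cons.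
Qed.

End Closure.

(** One coordinate step of the chain rule: by the mean value theorem the
increment along [e_k], started at the moving point [x + h w], is [h c] times a
value of the [k]-th partial derivative near [x], so continuity of that partial
derivative suffices. *)
Lemma is_derive_add_coord U f x (w : X) (c : R) k : open U -> smooth_on U f ->
  U x -> derivable f x w ->
  is_derive x (w + c *: 'e_k) f ('D_w f x + c * partial k f x).
Proof.
move=> oU sf Ux dw.
suff cvq : (fun h : R => h^-1 *: ((f \o shift x) (h *: (w + c *: 'e_k)) - f x))
    @ 0^' --> ('D_w f x + c * partial k f x : R^o).
  by split; [apply/cvg_ex; eexists; exact: cvq | exact: cvg_lim cvq].
pose q1 (h : R) : R^o := h^-1 *: ((f \o shift x) (h *: w) - f x).
pose q2 (h : R) : R^o :=
  h^-1 *: (f (x + h *: w + (h * c) *: 'e_k) - f (x + h *: w)).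
have -> : (fun h : R => h^-1 *: ((f \o shift x) (h *: (w + c *: 'e_k)) - f x))
    = q1 \+ q2 :> (R -> R^o).
  apply/funext => h; rewrite /q1 /q2 /= -scalerDr; congr (_ *: _).
  have -> : h *: (w + c *: 'e_k) + x = x + h *: w + (h * c) *: 'e_k.
    by rewrite scalerDr scalerA addrC addrA.
  by rewrite [h *: w + x]addrC [RHS]addrC subrKA.
apply: cvgD; first exact: dw.
have ck : {for x, continuous (partial k f)}.
  exact: smooth_continuous (smooth_partial sf k) _ Ux.
apply/cvgrPdist_le => e e0.
have e'0 : 0 < e / (`|c| + 1) by rewrite divr_gt0 // ltr_wpDl.
have : \forall y \near x, U y /\ `|partial k f x - partial k f y| <= e / (`|c| + 1).
  apply: filterI; first exact: open_nbhs_nbhs.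
  by move/cvgrPdist_le : ck => /(_ _ e'0).
move=> /nbhs_ballP[r /= r0 Hr].
pose K := `|w| + `|c| * `|'e_k| + 1.
have K0 : 0 < K by rewrite /K ltr_wpDl // addr_ge0 // mulr_ge0.
have inball (h t : R) : `|h| < r / K -> 0 <= t <= 1 ->
    ball x r (x + h *: w + t *: ((h * c) *: 'e_k)).
  move=> hr /andP[t0 t1].
  rewrite -ball_normE /= -addrA opprD addNKr normrN.
  apply: (le_lt_trans (ler_normD _ _)); rewrite !normrZ.
  rewrite (@le_lt_trans _ _ (`|h| * K)) //; last by rewrite -ltr_pdivlMr.
  rewrite /K mulrDr mulr1 mulrDr -addrA lerD2l ler_wpDr //.
  rewrite -!mulrA; apply: ler_piMl; last by rewrite ger0_norm.
  by rewrite !mulr_ge0.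
near=> h.
have h0 : h != 0 by near: h; exact: nbhs_dnbhs_neq.
have hr : `|h| < r / K.
  by near: h; apply: dnbhs0_lt; rewrite divr_gt0.
have dU (t : R) : 0 <= t <= 1 ->
    derivable f (x + h *: w + t *: ((h * c) *: 'e_k)) ((h * c) *: 'e_k).
  move=> t01; have [Uy _] := Hr _ (inball _ _ hr t01).
  by have [] := is_deriveZv (h * c) (smooth_derivable sf (i := k) Uy).
have [t t01 E] := MVT_line dU.
have [Uy By] := Hr _ (inball _ _ hr t01).
have [_ Ed] := is_deriveZv (h * c) (smooth_derivable sf (i := k) Uy).
rewrite /q2 E Ed -/(partial k f _).
rewrite [_ *: _]mulrA mulrA mulVf // mul1r -mulrBr normrM.
rewrite (le_trans (ler_wpM2l (normr_ge0 c) By)) //.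
by rewrite mulrCA ler_piMr ?(ltW e0) // ler_pdivrMr ?mul1r ?ltr_wpDl // lerDl.
Unshelve. all: by end_near. Qed.

(** Charts are immersions with respect to all directional derivatives, whereas
smoothness only controls the partial ones; this expresses the former by the
latter. The coordinates are added to the direction one at a time. *)
Lemma derive_coord U f x v : open U -> smooth_on U f -> U x ->
  is_derive x v f (\sum_k v 0 k * partial k f x).
Proof.
move=> oU sf Ux.
suff sub (r : seq 'I_d) : is_derive x (\sum_(k <- r) v 0 k *: 'e_k) f
    (\sum_(k <- r) v 0 k * partial k f x).
  by rewrite [v in is_derive x v](row_sum_delta v); exact: sub.
elim: r => [|k r [dr rE]]; first by rewrite !big_nil; exact: is_derive0.
rewrite !big_cons addrC [_ * _ + _]addrC -rE.
exact: is_derive_add_coord oU sf Ux dr.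
Qed.

Lemma is_derive_translate f (c x v : X) (l : R) : is_derive (x + c) v f l ->
  is_derive x v (fun y => f (y + c) : R^o) l.
Proof.
have E : (fun h : R => h^-1 *: (((fun y => f (y + c)) \o shift x) (h *: v)
             - f (x + c) : R^o)) =
         (fun h : R => h^-1 *: ((f \o shift (x + c)) (h *: v) - f (x + c))).
  by apply/funext => h /=; rewrite addrA.
by case=> df <-; split; rewrite /derivable /derive E.
Qed.

(** The second difference of [f] over a small square is, by two applications of
the mean value theorem, the square of its side times a value of a mixed
derivative inside the square. *)
Lemma second_difference U f x i j (a : R) : open U -> smooth_on U f ->
  (forall s t : R, 0 <= s <= 1 -> 0 <= t <= 1 ->
     U (x + s *: (a *: 'e_i) + t *: (a *: 'e_j))) ->
  exists s t : R, [/\ 0 <= s <= 1, 0 <= t <= 1 &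
    f (x + a *: 'e_i + a *: 'e_j) - f (x + a *: 'e_i)
      - (f (x + a *: 'e_j) - f x) =
    a ^+ 2 * partial j (partial i f) (x + s *: (a *: 'e_i) + t *: (a *: 'e_j))].
Proof.
move=> oU sf HU.
pose phi (y : X) : R^o := f (y + a *: 'e_j) - f y.
have dphi (s : R) : 0 <= s <= 1 ->
    is_derive (x + s *: (a *: 'e_i)) (a *: 'e_i) phi
      (a * partial i f (x + s *: (a *: 'e_i) + a *: 'e_j)
       - a * partial i f (x + s *: (a *: 'e_i))).
  move=> s01; apply: is_deriveB; last first.
    apply: is_deriveZv; apply: (smooth_derivable sf).
    by have := HU s 0 s01; rewrite lexx ler01 scale0r addr0; exact.
  apply: is_derive_translate; apply: is_deriveZv; apply: (smooth_derivable sf).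
  by have := HU s 1 s01; rewrite lexx ler01 scale1r; exact.
have [s s01] : exists2 s : R, 0 <= s <= 1 &
    phi (x + a *: 'e_i) - phi x = 'D_(a *: 'e_i) phi (x + s *: (a *: 'e_i)).
  by apply: MVT_line => s s01; have [] := dphi s s01.
have [_ ->] := dphi s s01; rewrite -mulrBr => Es.
have dpf (t : R) : 0 <= t <= 1 ->
    is_derive (x + s *: (a *: 'e_i) + t *: (a *: 'e_j)) (a *: 'e_j)
      (partial i f)
      (a * partial j (partial i f) (x + s *: (a *: 'e_i) + t *: (a *: 'e_j))).
  move=> t01; apply: is_deriveZv.
  exact: (smooth_derivable (smooth_partial sf i) (HU _ _ s01 t01)).
have [t t01] : exists2 t : R, 0 <= t <= 1 &
    partial i f (x + s *: (a *: 'e_i) + a *: 'e_j)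
      - partial i f (x + s *: (a *: 'e_i)) =
    'D_(a *: 'e_j) (partial i f) (x + s *: (a *: 'e_i) + t *: (a *: 'e_j)).
  by apply: MVT_line => t t01; have [] := dpf t t01.
have [_ ->] := dpf t t01 => Et.
by exists s, t; split=> //; rewrite [LHS]Es Et mulrA expr2.
Qed.

Lemma le_dist_halves (e p q u : R) :
  `|p - u| <= e / 2 -> `|q - u| <= e / 2 -> `|p - q| <= e.
Proof.
move=> pu qu; rewrite -(subrKA u) (le_trans (ler_normD _ _)) //.
by rewrite [leRHS](splitr e) lerD // distrC.
Qed.

(** Clairaut's theorem: by [second_difference], both mixed derivatives at [x]
are within any [e] of the same difference quotient. *)
Lemma partial_comm U f x i j : open U -> smooth_on U f -> U x ->
  partial i (partial j f) x = partial j (partial i f) x.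
Proof.
move=> oU sf Ux.
have cA : {for x, continuous (partial i (partial j f))}.
  exact: smooth_continuous (smooth_partial (smooth_partial sf j) i) _ Ux.
have cB : {for x, continuous (partial j (partial i f))}.
  exact: smooth_continuous (smooth_partial (smooth_partial sf i) j) _ Ux.
set A := partial i (partial j f) in cA *.
set B := partial j (partial i f) in cB *.
apply/eqP; rewrite -subr_eq0 -normr_le0; apply/ler_addgt0Pl => e e0.
rewrite addr0.
have e20 : 0 < e / 2 by rewrite divr_gt0.
have : \forall y \near x,
    [/\ U y, `|A x - A y| <= e / 2 & `|B x - B y| <= e / 2].
  have nU : \forall y \near x, U y by exact: open_nbhs_nbhs.
  have nA : \forall y \near x, `|A x - A y| <= e / 2.
    by move/cvgrPdist_le : cA => /(_ _ e20).
  have nB : \forall y \near x, `|B x - B y| <= e / 2.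
    by move/cvgrPdist_le : cB => /(_ _ e20).
  by apply: filterS3 nU nA nB => y; split.
move=> /nbhs_ballP[r /= r0 Hr].
pose K := `|'e_i| + `|'e_j| + 1.
have K0 : 0 < K by rewrite /K ltr_wpDl // addr_ge0.
have [a a0 aK] : exists2 a : R, 0 < a & a * K < r.
  exists (r / K / 2); first by rewrite !divr_gt0.
  by rewrite mulrAC divfK ?gt_eqF // ltr_pdivrMr // ltr_pMr // ltr1n.
have inball (k l : 'I_d) (s t : R) : `|'e_k| + `|'e_l| < K ->
    0 <= s <= 1 -> 0 <= t <= 1 ->
    ball x r (x + s *: (a *: 'e_k) + t *: (a *: 'e_l)).
  move=> kl /andP[s0 s1] /andP[t0 t1].
  rewrite -ball_normE /= -addrA opprD addNKr normrN.
  apply: (le_lt_trans (ler_normD _ _)); rewrite !normrZ.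
  apply: (@le_lt_trans _ _ (a * K)) => //.
  rewrite (ger0_norm (ltW a0)) (ger0_norm s0) (ger0_norm t0).
  apply: (@le_trans _ _ (a * (`|'e_k| + `|'e_l|))); last first.
    by rewrite ler_pM2l // ltW.
  by rewrite mulrDr lerD // ler_piMl // mulr_ge0 // ltW.
have ijK : `|'e_i| + `|'e_j| < K by rewrite ltrDl.
have jiK : `|'e_j| + `|'e_i| < K by rewrite addrC.
have [s [t [s01 t01 E1]]] := second_difference oU sf
  (fun s t s01 t01 => let: And3 u _ _ := Hr _ (inball i j s t ijK s01 t01) in u).
have [s' [t' [s'01 t'01 E2]]] := second_difference oU sf
  (fun s t s01 t01 => let: And3 u _ _ := Hr _ (inball j i s t jiK s01 t01) in u).
have [_ _ HB] := Hr _ (inball i j s t ijK s01 t01).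
have [_ HA _] := Hr _ (inball j i s' t' jiK s'01 t'01).
have EAB : B (x + s *: (a *: 'e_i) + t *: (a *: 'e_j)) =
           A (x + s' *: (a *: 'e_j) + t' *: (a *: 'e_i)).
  apply: (@mulfI _ (a ^+ 2)); first by rewrite expf_neq0 // gt_eqF.
  apply: (etrans (esym E1)); apply: (etrans _ E2).
  rewrite (addrAC x (a *: 'e_j)) !opprB !addrA [LHS]addrAC [RHS]addrAC.
  by congr (_ + _); rewrite [LHS]addrAC.
rewrite EAB in HB; exact: (le_dist_halves HA HB).
Qed.

End Smooth.

Section SmoothMatrices.
Context {R : realType} {d : nat}.
Local Notation X := 'rV[R]_d.
Local Notation "''e_' i" := (delta_mx 0 i : X) (at level 8, i at level 2).
Implicit Types (U : set X) (x : X) (i j : 'I_d).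

Lemma partial_mxE p q (F : X -> 'M[R]_(p, q)) i x a b :
  derivable F x 'e_i ->
  partial i F x a b = partial i (fun y => F y a b : R^o) x.
Proof. by move=> /derive_mx dF; rewrite /partial dF mxE. Qed.

Lemma smooth_mxP p q U (F : X -> 'M[R]_(p, q)) : open U ->
  smooth_on U F <-> forall a b, smooth_on U (fun x => F x a b : R^o).
Proof.
move=> oU; split=> [sF a b k | sF k].
  elim: k F sF => [|k IH] F sF /=.
    move=> x Ux; apply: (@continuous_comp _ _ _ F (fun A => A a b : R^o)).
      exact: smooth_continuous sF _ Ux.
    exact: coord_continuous.
  move=> i; split=> [x Ux|].
    by have /derivable_mxP := smooth_derivable sF (i := i) Ux; exact.
  apply: Ck_on_eq (IH _ (smooth_partial sF i)) => // x Ux.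
  by rewrite partial_mxE //; exact: (smooth_derivable sF Ux).
elim: k F sF => [|k IH] F sF /=.
  move=> x Ux; apply/(@cvgrPdist_le _ _ _ (nbhs x) (nbhs_filter x)) => e e0.
  have nF : \forall y \near x, forall a b, `|F x a b - F y a b| <= e.
    apply: (@filter_forall _ _ _ _ (nbhs_filter x)) => a.
    apply: (@filter_forall _ _ _ _ (nbhs_filter x)) => b.
    by have /cvgrPdist_le := smooth_continuous (sF a b) Ux; exact.
  apply: filterS nF => y Fy.
  rewrite /Num.Def.normr/= mx_normrE (bigmax_le _ (ltW e0))//= => -[a b] _.
  by rewrite !mxE.
have dF i x : U x -> derivable F x 'e_i.
  by move=> Ux; apply/derivable_mxP => a b; exact: (smooth_derivable (sF a b) Ux).
move=> i; split=> [x|]; first exact: dF.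
apply: IH => a b; apply: smooth_on_eq (smooth_partial (sF a b) i) => // x Ux.
by rewrite partial_mxE //; exact: dF.
Qed.

Section OpenSet.
Context (U : set X) (oU : open U).

Lemma smooth_entry p q (F : X -> 'M[R]_(p, q)) a b : smooth_on U F ->
  smooth_on U (fun x => F x a b : R^o).
Proof. by move=> /(smooth_mxP _ oU); exact. Qed.

Lemma partial_entry p q (F : X -> 'M[R]_(p, q)) i x a b : smooth_on U F ->
  U x -> partial i F x a b = partial i (fun y => F y a b : R^o) x.
Proof. by move=> sF Ux; apply/partial_mxE/(smooth_derivable sF). Qed.

Lemma partial_mx_comm p q (F : X -> 'M[R]_(p, q)) i j x : smooth_on U F ->
  U x -> partial i (partial j F) x = partial j (partial i F) x.
Proof.
move=> sF Ux; apply/matrixP => a b.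
have E k l : partial k (partial l F) x a b =
    partial k (partial l (fun y => F y a b : R^o)) x.
  apply: (etrans (partial_entry k a b (smooth_partial sF l) Ux)).
  apply: (partial_eq_on k oU _ Ux) => y Uy; exact: partial_entry.
apply: (etrans (E i j)); apply: (etrans _ (esym (E j i))).
exact: (partial_comm i j oU (smooth_entry a b sF) Ux).
Qed.

Lemma partialD (W : normedModType R) (F G : X -> W) i x :
  smooth_on U F -> smooth_on U G -> U x ->
  partial i (fun y => F y + G y) x = partial i F x + partial i G x.
Proof.
move=> sF sG Ux; rewrite /partial.
exact: deriveD (smooth_derivable sF Ux) (smooth_derivable sG Ux).
Qed.

Lemma partialB (W : normedModType R) (F G : X -> W) i x :
  smooth_on U F -> smooth_on U G -> U x ->
  partial i (fun y => F y - G y) x = partial i F x - partial i G x.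
Proof.
move=> sF sG Ux; rewrite /partial.
exact: deriveB (smooth_derivable sF Ux) (smooth_derivable sG Ux).
Qed.

Lemma partialM (f g : X -> R^o) i x : smooth_on U f -> smooth_on U g -> U x ->
  partial i (fun y => f y * g y : R^o) x = partial i f x * g x + f x * partial i g x.
Proof.
move=> sf sg Ux; rewrite /partial.
rewrite (@deriveM _ _ f g x 'e_i (smooth_derivable sf Ux) (smooth_derivable sg Ux)).
by rewrite [_ *: _]mulrC [X in _ + X]mulrC addrC mulrC [X in _ + X]mulrC.
Qed.

Lemma partial_sum (I : Type) (r : seq I) (F : I -> X -> R^o) i x :
  (forall k, smooth_on U (F k)) -> U x ->
  partial i (fun y => \sum_(k <- r) F k y : R^o) x = \sum_(k <- r) partial i (F k) x.
Proof.
move=> sF Ux; elim: r => [|k r IH].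
  rewrite big_nil (partial_eq_on i (g := fun=> 0) oU) ?/partial ?derive_cst //.
  by move=> y _; rewrite big_nil.
rewrite big_cons -IH -partialD //; last exact: smooth_sum.
by apply: partial_eq_on Ux => // y _; rewrite big_cons.
Qed.

Lemma smooth_mulmx p q r (F : X -> 'M[R]_(p, q)) (G : X -> 'M[R]_(q, r)) :
  smooth_on U F -> smooth_on U G -> smooth_on U (fun x => F x *m G x).
Proof.
move=> sF sG; apply/(smooth_mxP _ oU) => a b.
apply: (@smooth_on_eq _ _ _ U (fun x => \sum_k F x a k * G x k b : R^o)) => //.
  by move=> x _; rewrite mxE.
by apply: smooth_sum => // k; apply: smoothM => //; exact: smooth_entry.
Qed.

Lemma partial_mulmx p q r (F : X -> 'M[R]_(p, q)) (G : X -> 'M[R]_(q, r)) i x :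
  smooth_on U F -> smooth_on U G -> U x ->
  partial i (fun y => F y *m G y) x = partial i F x *m G x + F x *m partial i G x.
Proof.
move=> sF sG Ux; apply/matrixP => a b.
rewrite (partial_entry _ _ _ (smooth_mulmx sF sG)) //.
rewrite (partial_eq_on i (g := fun y => \sum_k F y a k * G y k b : R^o) oU) //;
  last by move=> y _; rewrite mxE.
rewrite partial_sum //; last first.
  by move=> k; apply: smoothM => //; exact: smooth_entry.
rewrite !mxE -big_split; apply: eq_bigr => k _.
by rewrite partialM ?(partial_entry _ _ _ sF) ?(partial_entry _ _ _ sG) //;
  exact: smooth_entry.
Qed.

Lemma functional_coord p q (phi : 'M[R]_(p, q) -> R^o) (A : 'M[R]_(p, q)) :
  linear phi -> phi A = \sum_a \sum_b A a b * phi (delta_mx a b).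
Proof.
move=> lphi; pose L := GRing.isLinear.Build _ _ _ _ phi lphi.
pose f : {linear 'M[R]_(p, q) -> R^o} := HB.pack phi L.
rewrite -[phi in LHS]/(f : _ -> _) [in LHS](matrix_sum_delta A) linear_sum.
by apply: eq_bigr => a _; rewrite linear_sum; apply: eq_bigr => b _; rewrite linearZ.
Qed.

Lemma smooth_functional p q (phi : 'M[R]_(p, q) -> R^o) (F : X -> 'M[R]_(p, q)) :
  linear phi -> smooth_on U F -> smooth_on U (fun x => phi (F x)).
Proof.
move=> lphi sF.
apply: (@smooth_on_eq _ _ _ U
  (fun x => \sum_a \sum_b F x a b * phi (delta_mx a b) : R^o)) => //.
  by move=> x _; rewrite -functional_coord.
apply: smooth_sum => // a; apply: smooth_sum => // b.
apply: smoothM => //; first exact: smooth_entry.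
exact: smooth_cst.
Qed.

Lemma partial_functional p q (phi : 'M[R]_(p, q) -> R^o)
    (F : X -> 'M[R]_(p, q)) i x : linear phi ->
  smooth_on U F -> U x -> partial i (fun y => phi (F y)) x = phi (partial i F x).
Proof.
move=> lphi sF Ux.
have sab a b : smooth_on U (fun x => F x a b * phi (delta_mx a b) : R^o).
  by apply: smoothM => //; [exact: smooth_entry | exact: smooth_cst].
rewrite (partial_eq_on i (g := fun y => \sum_a \sum_b F y a b * phi (delta_mx a b)
  : R^o) oU) //; last by move=> y _; exact: functional_coord.
rewrite (functional_coord (partial i F x) lphi).
rewrite partial_sum //; last by move=> a; exact: smooth_sum.
apply: eq_bigr => a _; rewrite partial_sum //; apply: eq_bigr => b _.
rewrite partialM //; [|exact: smooth_entry|exact: smooth_cst].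
by rewrite (partial_entry _ _ _ sF) // [X in _ + _ * X]derive_cst mulr0 addr0.
Qed.

Lemma derive_mx_coord p q (F : X -> 'M[R]_(p, q)) (v x : X) :
  smooth_on U F -> U x -> 'D_v F x = \sum_i v 0 i *: partial i F x.
Proof.
move=> sF Ux.
have dF a b := derive_coord v oU (smooth_entry a b sF) Ux.
rewrite derive_mx; last by apply/derivable_mxP => a b; have [] := dF a b.
apply/matrixP => a b; rewrite mxE summxE; have [_ ->] := dF a b.
by apply: eq_bigr => i _; rewrite mxE (partial_entry _ _ _ sF).
Qed.

Lemma smooth_trmx p q (F : X -> 'M[R]_(p, q)) :
  smooth_on U F -> smooth_on U (fun x => (F x)^T).
Proof.
move=> sF; apply/(smooth_mxP _ oU) => a b.
by apply: smooth_on_eq (smooth_entry b a sF) => // x _; rewrite mxE.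
Qed.

Lemma partial_trmx p q (F : X -> 'M[R]_(p, q)) i x :
  smooth_on U F -> U x -> partial i (fun y => (F y)^T) x = (partial i F x)^T.
Proof.
move=> sF Ux; apply/matrixP => a b.
rewrite mxE (partial_entry _ _ _ (smooth_trmx sF)) // (partial_entry _ _ _ sF) //.
by apply: partial_eq_on Ux => // y _; rewrite mxE.
Qed.

Lemma smooth_det m (F : X -> 'M[R]_m) :
  smooth_on U F -> smooth_on U (fun x => \det (F x) : R^o).
Proof.
move=> sF; apply: smooth_sum => // s; apply: smoothM => //.
  exact: smooth_cst.
by apply: smooth_prod => // a; exact: smooth_entry.
Qed.

Lemma smooth_invmx m (F : X -> 'M[R]_m) : smooth_on U F ->
  (forall x, U x -> F x \in unitmx) -> smooth_on U (fun x => invmx (F x)).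
Proof.
move=> sF uF; apply/(smooth_mxP _ oU) => a b.
apply: (@smooth_on_eq _ _ _ U
  (fun x => (\det (F x))^-1 * ((-1) ^+ (b + a) * \det (row' b (col' a (F x)))) : R^o))
  => //.
  by move=> x Ux; rewrite /invmx uF // !mxE.
apply: smoothM => //.
  apply: smoothV => //; first exact: smooth_det.
  by move=> x /uF; rewrite unitmxE unitfE.
apply: smoothM => //; first exact: smooth_cst.
apply: smooth_det; apply/(smooth_mxP _ oU) => a' b'.
apply: (@smooth_on_eq _ _ _ U (fun x => F x (lift b a') (lift a b') : R^o)) => //.
  by move=> x _; rewrite !mxE.
exact: smooth_entry.
Qed.

End OpenSet.
End SmoothMatrices.

(** * Moving frames *)

Lemma addmxE (V : nmodType) m n (A B : 'M[V]_(m, n)) i j :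
  (A + B) i j = A i j + B i j.
Proof. exact: mxE. Qed.

Lemma oppmxE (V : zmodType) m n (A : 'M[V]_(m, n)) i j : (- A) i j = - A i j.
Proof. exact: mxE. Qed.

Lemma scalemxE (S : pzRingType) m n c (A : 'M[S]_(m, n)) i j :
  (c *: A) i j = c * A i j.
Proof. exact: mxE. Qed.

Lemma mulmx_trE (S : comPzRingType) m n p (A : 'M[S]_(m, n)) (B : 'M[S]_(p, n)) i j :
  (A *m B^T) i j = \sum_c A i c * B j c.
Proof. by rewrite mxE; apply: eq_bigr => c _; rewrite mxE. Qed.

(** Gauge covariance of curvature, with derivatives replaced by independent
symbols: [G] stands for the Christoffel matrices, [a] and [b] for the first
derivatives of the frame [m] and [dd] for its second derivative, whose symmetry
is what makes it cancel. *)
Lemma gauge_curvature (S : comPzRingType) d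
    (m a b dd Ai Aj Gi Gj dAi dAj dGi dGj : 'M[S]_d) :
  Gi *m m = a + m *m Ai -> Gj *m m = b + m *m Aj ->
  dGj *m m = dd + a *m Aj + m *m dAj - Gj *m a ->
  dGi *m m = dd + b *m Ai + m *m dAi - Gi *m b ->
  (dGj - dGi + Gj *m Gi - Gi *m Gj) *m m =
  m *m (dAj - dAi + Aj *m Ai - Ai *m Aj).
Proof.
move=> EGi EGj EdGj EdGi.
rewrite mulmxBl mulmxDl mulmxBl -!mulmxA EGi EGj EdGj EdGi.
rewrite !mulmxDr [Gj *m (m *m Ai)]mulmxA [Gi *m (m *m Aj)]mulmxA EGi EGj.
rewrite !mulmxDl !(mulmxN, mulmxDr) !mulmxA.
by apply/matrixP => k l; rewrite !(addmxE, oppmxE); ring.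
Qed.

(** Row [i] of [M x] holds the components of the [i]-th coordinate vector in an
orthonormal frame, which is why [g = M M^T]; [A i] is the connection form of
that frame along the [i]-th coordinate. Frames need not come from coordinates,
and on a homogeneous space they can be chosen so that [A] is given by the Lie
algebra alone. *)
Section MovingFrame.
Context {R : realType} {d : nat}.
Local Notation X := 'rV[R]_d.
Variables (U : set X) (g M : X -> 'M[R]_d) (A : 'I_d -> X -> 'M[R]_d).
Hypothesis oU : open U.
Hypothesis sM : smooth_on U M.
Hypothesis sA : forall i, smooth_on U (A i).
Hypothesis uM : forall x, U x -> M x \in unitmx.
Hypothesis gE : forall x, U x -> g x = M x *m (M x)^T.
Hypothesis skewA : forall i x, U x -> (A i x)^T = - A i x.

(** Row [j] holds the frame components of the covariant derivative of the
[j]-th coordinate field along the [i]-th one. *)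
Definition frame_connection i x := partial i M x + M x *m A i x.
Local Notation N := frame_connection.

Hypothesis torsion_free : forall x, U x -> forall i j c, N i x j c = N j x i c.

Lemma smooth_frame_connection i : smooth_on U (N i).
Proof.
apply/(smooth_mxP _ oU) => a b.
apply: (@smooth_on_eq _ _ _ _ (fun x => partial i M x a b + (M x *m A i x) a b : R^o)).
- exact: oU.
- by move=> x _; rewrite [RHS]mxE.
- apply: smoothD => //; first exact: (smooth_entry oU a b (smooth_partial sM i)).
  exact: (smooth_entry oU a b (smooth_mulmx oU sM (sA i))).
Qed.

Lemma partial_metric_frame i j l x : U x ->
  partial i (fun y => g y j l : R^o) x =
  (N i x *m (M x)^T) j l + (M x *m (N i x)^T) j l.
Proof.
move=> Ux; have sMT := smooth_trmx oU sM; have sMM := smooth_mulmx oU sM sMT.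
have -> : partial i (fun y => g y j l : R^o) x =
          partial i (fun y => (M y *m (M y)^T) j l : R^o) x.
  by apply: (partial_eq_on i oU _ Ux) => y Uy; rewrite gE.
rewrite -(partial_entry i j l sMM Ux) (partial_mulmx oU i sM sMT Ux).
rewrite (partial_trmx oU i sM Ux).
have -> : N i x *m (M x)^T = partial i M x *m (M x)^T + M x *m A i x *m (M x)^T.
  by rewrite mulmxDl.
have -> : M x *m (N i x)^T = M x *m (partial i M x)^T - M x *m A i x *m (M x)^T.
  rewrite /N (raddfD (@trmx R d d)) /= trmx_mul (skewA _ Ux) mulmxDr mulNmx mulmxN.
  by rewrite mulmxA.
by rewrite !addmxE oppmxE addrACA subrr addr0.
Qed.

(** The Levi-Civita connection is the only metric torsion-free one. Skewness of
[A] makes [frame_connection] metric, which gives [partial_metric_frame]; in the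
Koszul combination of three such derivatives, torsion-freeness leaves twice the
same term. *)
Lemma christoffel_frame i j k x : U x ->
  christoffel g k i j x = (N i x *m invmx (M x)) j k.
Proof.
move=> Ux; have uMx := uM Ux.
have uMT : (M x)^T \in unitmx by rewrite unitmx_tr.
have E l : partial i (fun y => g y j l : R^o) x + partial j (fun y => g y i l : R^o) x
    - partial l (fun y => g y i j : R^o) x = 2 * (N i x *m (M x)^T) j l.
  rewrite !partial_metric_frame //.
  have -> : (M x *m (N i x)^T) j l = (N l x *m (M x)^T) i j.
    rewrite !mulmx_trE; apply: eq_bigr => c _.
    by rewrite mulrC (torsion_free Ux i l).
  have -> : (M x *m (N j x)^T) i l = (M x *m (N l x)^T) i j.
    by rewrite !mulmx_trE; apply: eq_bigr => c _; rewrite (torsion_free Ux j l).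
  have -> : (N j x *m (M x)^T) i l = (N i x *m (M x)^T) j l.
    by rewrite !mulmx_trE; apply: eq_bigr => c _; rewrite (torsion_free Ux j i).
  ring.
rewrite /christoffel.
under eq_bigr do rewrite E mulrCA.
rewrite -mulr_sumr mulrA mulVf ?pnatr_eq0 // mul1r.
have gVT : (invmx (g x))^T = invmx (g x).
  by rewrite trmx_inv gE // trmx_mul trmxK.
have -> : N i x *m invmx (M x) = N i x *m (M x)^T *m (invmx (g x)).
  rewrite -mulmxA; congr (_ *m _); rewrite gE //.
  have uMM : M x *m (M x)^T \in unitmx by rewrite unitmx_mul uMx uMT.
  by rewrite -[LHS]mulmx1 -(mulmxV uMM) -(mulmxA (M x)) (mulKmx uMx).
rewrite [RHS]mxE; apply: eq_bigr => l _; rewrite mulrC; congr (_ * _).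
by rewrite -{1}gVT mxE.
Qed.

(** The curvature of the connection form. Vectors are rows, on which matrices
act from the right, so the product of operators appears in reversed order. *)
Definition frame_curvature i j x :=
  partial i (A j) x - partial j (A i) x + A j x *m A i x - A i x *m A j x.
Local Notation F := frame_curvature.

(** The Christoffel matrices [Ga i] and the forms [A i] differ by the gauge
transformation [M], under which curvature is merely conjugated; the Ricci
tensor is its trace over the first index. *)
Lemma ricci_frame j k x : U x ->
  ricci g x j k = \sum_i (M x *m F i j x *m invmx (M x)) k i.
Proof.
move=> Ux; have uMx := uM Ux.
pose Ga i y := N i y *m invmx (M y).
have sV : smooth_on U (fun y => invmx (M y)) by exact: smooth_invmx.
have sGa i : smooth_on U (Ga i).
  exact: (smooth_mulmx oU (smooth_frame_connection i) sV).
have dGa i a b c : partial i (christoffel g a b c : _ -> R^o) x =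
    partial i (Ga b) x c a.
  rewrite (partial_entry i c a (sGa b) Ux).
  by apply: (partial_eq_on i oU _ Ux) => y Uy; exact: christoffel_frame.
have GaM i y : U y -> Ga i y *m M y = N i y.
  by move=> Uy; rewrite /Ga mulmxKV // uM.
have dGaM i i' : partial i (Ga i') x *m M x =
    partial i (partial i' M) x + partial i M x *m A i' x + M x *m partial i (A i') x
    - Ga i' x *m partial i M x.
  apply/eqP; rewrite eq_sym subr_eq eq_sym -(partial_mulmx oU i (sGa i') sM Ux).
  apply/eqP; rewrite (partial_eq_on i oU (GaM i') Ux).
  rewrite /N (partialD i (smooth_partial sM i') (smooth_mulmx oU sM (sA i')) Ux).
  by rewrite (partial_mulmx oU i sM (sA i') Ux) addrA.
have curv i : (partial i (Ga j) x - partial j (Ga i) x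
    + Ga j x *m Ga i x - Ga i x *m Ga j x) = M x *m F i j x *m invmx (M x).
  have Edd : partial j (partial i M) x = partial i (partial j M) x.
    exact: (partial_mx_comm oU j i sM Ux).
  have E := gauge_curvature (GaM i x Ux) (GaM j x Ux) (dGaM i j)
    (etrans (dGaM j i) (congr1 (fun D => D + _ + _ - _) Edd)).
  by rewrite -E (mulmxK uMx).
rewrite mxE; apply: eq_bigr => i _; rewrite -curv !dGa.
rewrite !(addmxE, oppmxE) -addrA; congr (_ + _).
rewrite !mxE -sumrB; apply: eq_bigr => l _.
by rewrite !(christoffel_frame _ _ _ Ux) mulrC [X in _ - X]mulrC.
Qed.

(** The entries of [W] are the derivatives of [u] along the frame vectors. The
derivatives of [M] occur both in the second partial derivatives of [u] and in
the Christoffel symbols, and cancel. *)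
Lemma laplace_frame (u : X -> R^o) (W : X -> 'cV[R]_d) x : U x ->
  smooth_on U W -> (forall y j, U y -> partial j u y = (M y *m W y) j 0) ->
  laplace_beltrami g u x =
  - \sum_i \sum_b invmx (M x) b i * (partial i W x - A i x *m W x) b 0.
Proof.
move=> Ux sW duE; have uMx := uM Ux; congr (- _).
have gV i j : invmx (g x) i j = \sum_b invmx (M x) b i * invmx (M x) b j.
  have uMT : (M x)^T \in unitmx by rewrite unitmx_tr.
  have uMM : M x *m (M x)^T \in unitmx by rewrite unitmx_mul uMx uMT.
  have -> : invmx (g x) = (invmx (M x))^T *m invmx (M x).
    have E : (invmx (M x))^T *m invmx (M x) *m (M x *m (M x)^T) = 1%:M.
      by rewrite mulmxA (mulmxKV uMx) -trmx_mul (mulmxV uMx) trmx1.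
    by rewrite (gE Ux) -[RHS](mulmxK uMM) E mul1mx.
  by rewrite mxE; apply: eq_bigr => b _; rewrite mxE.
have Hess i j : partial i (partial j u) x
     - \sum_(k < d) christoffel g k i j x * partial k u x =
     (M x *m (partial i W x - A i x *m W x)) j 0.
  have -> : partial i (partial j u) x = partial i (fun y => M y *m W y) x j 0.
    rewrite (partial_entry i j 0 (smooth_mulmx oU sM sW) Ux).
    by apply: (partial_eq_on i oU _ Ux) => y Uy; exact: duE.
  have -> : \sum_(k < d) christoffel g k i j x * partial k u x = (N i x *m W x) j 0.
    transitivity ((N i x *m invmx (M x) *m (M x *m W x)) j 0).
      rewrite [RHS]mxE; apply: eq_bigr => k _.
      by rewrite (christoffel_frame _ _ _ Ux) (duE _ _ Ux).
    by rewrite -!mulmxA (mulKmx uMx).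
  rewrite (partial_mulmx oU i sM sW Ux) -oppmxE -addmxE; congr (_ _ j 0).
  rewrite /N mulmxDl mulmxBr !mulmxA.
  by apply/matrixP => a b; rewrite !(addmxE, oppmxE); ring.
apply: eq_bigr => i _.
under eq_bigr do rewrite Hess gV mulr_suml.
rewrite exchange_big; apply: eq_bigr => b _ /=.
under eq_bigr do rewrite -mulrA.
rewrite -mulr_sumr; congr (_ * _).
transitivity ((invmx (M x) *m (M x *m (partial i W x - A i x *m W x))) b 0).
  by rewrite [RHS]mxE.
by rewrite (mulKmx uMx).
Qed.

End MovingFrame.

(** * The Lie algebras g, k, h and their complements *)

Section LieAlgebra.
Context {R : realType} {n : nat}.
Local Notation Mx := (amb R n).
Local Notation I := 'I_((1 + n) + (1 + n)).

(** The rows and columns of the four blocks: [io] and [iz] index the blocks of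
size one, [ia] and [ib] those of size [n]. G fixes the vector [eo], and K fixes
[ez] as well. *)
Definition io : I := lshift (1 + n) (lshift n ord0).
Definition iz : I := rshift (1 + n) (lshift n ord0).
Definition ia (i : 'I_n) : I := lshift (1 + n) (rshift 1 i).
Definition ib (i : 'I_n) : I := rshift (1 + n) (rshift 1 i).

Variant index_spec : I -> Prop :=
| IndexO : index_spec io
| IndexZ : index_spec iz
| IndexA i : index_spec (ia i)
| IndexB i : index_spec (ib i).

Lemma indexP k : index_spec k.
Proof.
case: (split_ordP k) => k' ->; case: (split_ordP k') => k'' ->.
- by rewrite (ord1 k''); exact: IndexO.
- exact: IndexA.
- by rewrite (ord1 k''); exact: IndexZ.
- exact: IndexB.
Qed.

Lemma sum_index (V : nmodType) (f : I -> V) :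
  \sum_k f k = f io + \sum_i f (ia i) + (f iz + \sum_i f (ib i)).
Proof. by rewrite !big_split_ord /= !big_ord1. Qed.

Definition eo : 'cV[R]_((1 + n) + (1 + n)) := delta_mx io 0.
Definition ez : 'cV[R]_((1 + n) + (1 + n)) := delta_mx iz 0.
Definition Pz : Mx := delta_mx iz iz.
(** The complex structure of the blocks [ia] and [ib]; its centraliser in k is
h, the copy of u(n). *)
Definition J : Mx := blocks24 0 (- 1%:M) 1%:M 0.

Lemma mul_delta_col0P m (X : 'M[R]_m) (j : 'I_m) :
  X *m (delta_mx j 0 : 'cV_m) = 0 <-> forall k, X k j = 0.
Proof.
rewrite -colE; split=> [/matrixP E k|E]; first by have := E k 0; rewrite !mxE.
by apply/matrixP => k l; rewrite !mxE.
Qed.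

Lemma skew_entry m (X : 'M[R]_m) i j : X^T = - X -> X i j = - X j i.
Proof. by move/matrixP/(_ j i); rewrite !mxE. Qed.

Lemma skew_diag m (X : 'M[R]_m) i : X^T = - X -> X i i = 0.
Proof. by move/(skew_entry i i)/eqP; rewrite -addr_eq0 -mulr2n mulrn_eq0 => /eqP. Qed.

(** ** Block matrices *)

Lemma blocks24_tr (A B C D : 'M[R]_n) :
  (blocks24 A B C D)^T = blocks24 A^T C^T B^T D^T.
Proof. by rewrite /blocks24 !tr_block_mx !trmx0. Qed.

Lemma blocks24D (A B C D A' B' C' D' : 'M[R]_n) :
  blocks24 A B C D + blocks24 A' B' C' D' =
  blocks24 (A + A') (B + B') (C + C') (D + D').
Proof. by rewrite /blocks24 !add_block_mx !addr0. Qed.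

Lemma blocks24Z (c : R) (A B C D : 'M[R]_n) :
  c *: blocks24 A B C D = blocks24 (c *: A) (c *: B) (c *: C) (c *: D).
Proof. by rewrite /blocks24 !scale_block_mx !scaler0. Qed.

Lemma blocks24N (A B C D : 'M[R]_n) :
  - blocks24 A B C D = blocks24 (- A) (- B) (- C) (- D).
Proof. by rewrite /blocks24 !opp_block_mx !oppr0. Qed.

Lemma blocks24M (A B C D A' B' C' D' : 'M[R]_n) :
  blocks24 A B C D *m blocks24 A' B' C' D' =
  blocks24 (A *m A' + B *m C') (A *m B' + B *m D')
           (C *m A' + D *m C') (C *m B' + D *m D').
Proof.
rewrite /blocks24 !mulmx_block !(mul0mx, mulmx0, addr0, add0r).
by rewrite !add_block_mx !addr0.
Qed.

Lemma blocks24_inj (A B C D A' B' C' D' : 'M[R]_n) :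
  blocks24 A B C D = blocks24 A' B' C' D' -> [/\ A = A', B = B', C = C' & D = D'].
Proof.
by move=> /eq_block_mx[] /eq_block_mx[_ _ _ ->] /eq_block_mx[_ _ _ ->]
  /eq_block_mx[_ _ _ ->] /eq_block_mx[_ _ _ ->].
Qed.

Lemma blocks24_trace (A B C D : 'M[R]_n) :
  \tr (blocks24 A B C D) = \tr A + \tr D.
Proof. by rewrite /blocks24 !mxtrace_block !mxtrace0 !add0r. Qed.

Lemma blocks24_entries (A B C D : 'M[R]_n) :
  (forall i j, [/\ blocks24 A B C D (ia i) (ia j) = A i j,
                   blocks24 A B C D (ia i) (ib j) = B i j,
                   blocks24 A B C D (ib i) (ia j) = C i j &
                   blocks24 A B C D (ib i) (ib j) = D i j]) /\
  (forall k, [/\ blocks24 A B C D k io = 0, blocks24 A B C D k iz = 0,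
                 blocks24 A B C D io k = 0 & blocks24 A B C D iz k = 0]).
Proof.
have E := (block_mxEul, block_mxEur, block_mxEdl, block_mxEdr).
split=> [i j|k]; first by rewrite /blocks24 /ia /ib !E.
by case: (indexP k) => [||i|i];
  rewrite /blocks24 /ia /ib /io /iz !E; split; rewrite mxE.
Qed.

Lemma blocks24_eta (X : Mx) :
  (forall k, [/\ X k io = 0, X k iz = 0, X io k = 0 & X iz k = 0]) ->
  X = blocks24 (\matrix_(i, j) X (ia i) (ia j)) (\matrix_(i, j) X (ia i) (ib j))
               (\matrix_(i, j) X (ib i) (ia j)) (\matrix_(i, j) X (ib i) (ib j)).
Proof.
move=> X0.
pose A := \matrix_(i, j) X (ia i) (ia j); pose B := \matrix_(i, j) X (ia i) (ib j).
pose C := \matrix_(i, j) X (ib i) (ia j); pose D := \matrix_(i, j) X (ib i) (ib j).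
have [E1 E2] := blocks24_entries A B C D; rewrite -/A -/B -/C -/D.
apply/matrixP => k l.
have [Xko Xkz Xok Xzk] := X0 k; have [Xlo Xlz Xol Xzl] := X0 l.
have [Yko Ykz Yok Yzk] := E2 k; have [Ylo Ylz Yol Yzl] := E2 l.
case: (indexP k) Xko Xkz Yko Ykz => [||i|i] Xko Xkz Yko Ykz; [congruence..| |];
case: (indexP l) Xol Xzl Yol Yzl Xko Xkz Yko Ykz => [||j|j] *; try congruence;
by case: (E1 i j); rewrite !mxE.
Qed.

(** ** Membership *)

Lemma lie_gP (X : Mx) : lie_g X <-> X^T = - X /\ X *m eo = 0.
Proof.
have ioE (k : 'I_1) : lshift (n + (1 + n)) k = io :> 'I_(1 + (n + (1 + n))).
  by apply/val_inj; rewrite (ord1 k).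
rewrite mul_delta_col0P; split=> [[A sA ->]|[sX X0]].
  split.
    have E : (block_mx 0 0 0 A : 'M[R]_(1 + (n + (1 + n))))^T = - block_mx 0 0 0 A.
      by rewrite tr_block_mx opp_block_mx !trmx0 !oppr0 sA.
    exact: E.
  have E (k : 'I_(1 + (n + (1 + n)))) :
      (block_mx 0 0 0 A : 'M[R]_(1 + (n + (1 + n)))) k (lshift _ ord0) = 0.
    by case: (split_ordP k) => k' ->; rewrite (block_mxEul, block_mxEdl) mxE.
  by move=> k; rewrite -(ioE ord0); exact: E.
pose X' : 'M[R]_(1 + (n + (1 + n))) := X.
have sX' : X'^T = - X' by exact: sX.
exists (drsubmx X').
  by apply/matrixP => i j; rewrite !mxE (skew_entry _ _ sX').
rewrite -[LHS]/X' -[X' in LHS]submxK; congr block_mx; apply/matrixP => i j.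
- by rewrite !mxE (ioE j) X0.
- by rewrite !mxE (skew_entry _ _ sX) (ioE i) X0 oppr0.
- by rewrite !mxE (ioE j) X0.
Qed.

Lemma lie_kP (X : Mx) : lie_k X <-> lie_g X /\ X *m ez = 0.
Proof.
rewrite lie_gP !mul_delta_col0P; split=> [[A [B [C [D [sX ->]]]]]|[[sX X0] Xz]].
  have [_ E0] := blocks24_entries A B C D; split; last by move=> k; case: (E0 k).
  split; last by move=> k; case: (E0 k).
  move: sX; rewrite /so /= tr_block_mx opp_block_mx => /eq_block_mx[EA EC EB ED].
  by rewrite blocks24_tr blocks24N EA EB EC ED.
have E0 k : [/\ X k io = 0, X k iz = 0, X io k = 0 & X iz k = 0].
  by rewrite !X0 !Xz (skew_entry io k sX) (skew_entry iz k sX) X0 Xz oppr0.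
have [A [B [C [D XE]]]] : exists A B C D, X = blocks24 A B C D.
  by do 4!eexists; exact: blocks24_eta.
exists A, B, C, D; split=> //; move: sX.
rewrite XE blocks24_tr blocks24N => /blocks24_inj[EA EC EB ED].
by rewrite /so /= tr_block_mx opp_block_mx EA EB EC ED.
Qed.

Lemma lie_k_blocks (X : Mx) : lie_k X ->
  exists A B C D, [/\ X = blocks24 A B C D, A^T = - A, B^T = - C & D^T = - D].
Proof.
move=> [A [B [C [D [sX ->]]]]]; exists A, B, C, D; split=> //;
by move: sX; rewrite /so /= tr_block_mx opp_block_mx => /eq_block_mx[EA EC EB ED].
Qed.

Lemma J_sqr (X : Mx) : lie_k X -> J *m J *m X = - X /\ X *m J *m J = - X.
Proof.
move=> /lie_k_blocks[A [B [C [D [-> _ _ _]]]]]; rewrite /J !blocks24M blocks24N.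
by rewrite !(mul0mx, mulmx0, add0r, addr0, mulmxN, mulNmx, mul1mx, mulmx1).
Qed.

Lemma lie_hP (X : Mx) : lie_h X <-> lie_k X /\ X *m J = J *m X.
Proof.
split=> [[A [B [sA sB ->]]]|[kX XJ]].
  split; last first.
    rewrite /J !blocks24M.
    by rewrite !(mul0mx, mulmx0, add0r, addr0, mulmxN, mulNmx, mul1mx, mulmx1, opprK).
  exists A, (- B), B, A; split=> //.
  by rewrite /so /= tr_block_mx opp_block_mx opprK sA sB (raddfN (@trmx R n n)) /= sB.
have [A [B [C [D [EX sA sB sD]]]]] := lie_k_blocks kX.
move: XJ; rewrite EX /J !blocks24M.
rewrite !(mul0mx, mulmx0, add0r, addr0, mulmxN, mulNmx, mul1mx, mulmx1).
move=> /blocks24_inj[EB EA _ _]; exists A, C.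
have {}EA : A = D by apply: oppr_inj.
have CE : C^T = C by apply: oppr_inj; rewrite -sB EB (raddfN (@trmx R n n)).
by split=> //; rewrite EA EB.
Qed.

End LieAlgebra.

(** * Brackets and projections *)

Section Projections.
Context {R : realType} {n : nat}.
Local Notation Mx := (amb R n).
Local Notation J := (@J R n).
Local Notation Pz := (@Pz R n).
Local Notation ez := (@ez R n).
Local Notation eo := (@eo R n).

Definition brk (X Y : Mx) : Mx := X *m Y - Y *m X.

Lemma Bg_sym (X Y : Mx) : Bg X Y = Bg Y X.
Proof. by rewrite /Bg mxtrace_mulC. Qed.

Lemma BgDl (X X' Y : Mx) : Bg (X + X') Y = Bg X Y + Bg X' Y.
Proof. by rewrite /Bg mulmxDl mxtraceD mulrDr. Qed.

Lemma BgZl c (X Y : Mx) : Bg (c *: X) Y = c * Bg X Y.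
Proof. by rewrite /Bg -scalemxAl mxtraceZ mulrCA. Qed.

Lemma BgNl (X Y : Mx) : Bg (- X) Y = - Bg X Y.
Proof. by rewrite -scaleN1r BgZl mulN1r. Qed.

Lemma BgDr (X Y Y' : Mx) : Bg X (Y + Y') = Bg X Y + Bg X Y'.
Proof. by rewrite Bg_sym BgDl !(Bg_sym X). Qed.

Lemma BgZr c (X Y : Mx) : Bg X (c *: Y) = c * Bg X Y.
Proof. by rewrite Bg_sym BgZl Bg_sym. Qed.

Lemma BgNr (X Y : Mx) : Bg X (- Y) = - Bg X Y.
Proof. by rewrite Bg_sym BgNl Bg_sym. Qed.

Lemma Bg_suml (T : Type) (r : seq T) (F : T -> Mx) (Y : Mx) :
  Bg (\sum_(k <- r) F k) Y = \sum_(k <- r) Bg (F k) Y.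
Proof.
elim: r => [|k r IH]; last by rewrite !big_cons BgDl IH.
by rewrite !big_nil /Bg mul0mx mxtrace0 mulr0.
Qed.

Lemma Bg_brk (X Y Z : Mx) : Bg (brk X Y) Z = Bg X (brk Y Z).
Proof.
have E : \tr (Y *m X *m Z) = \tr (X *m Z *m Y) by rewrite -mulmxA mxtrace_mulC.
by rewrite /Bg /brk mulmxBl mulmxBr !(raddfB (@mxtrace R _)) /= !mulmxA E.
Qed.

Lemma brkN (X Y : Mx) : brk X Y = - brk Y X.
Proof. by rewrite /brk opprB. Qed.

Lemma brkDl (X X' Y : Mx) : brk (X + X') Y = brk X Y + brk X' Y.
Proof. by rewrite /brk mulmxDl mulmxDr opprD addrACA. Qed.

Lemma brkDr (X Y Y' : Mx) : brk X (Y + Y') = brk X Y + brk X Y'.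
Proof. by rewrite /brk mulmxDl mulmxDr opprD addrACA. Qed.

Lemma brkZl c (X Y : Mx) : brk (c *: X) Y = c *: brk X Y.
Proof. by rewrite /brk -scalemxAl -scalemxAr scalerBr. Qed.

Lemma brkZr c (X Y : Mx) : brk X (c *: Y) = c *: brk X Y.
Proof. by rewrite /brk -scalemxAl -scalemxAr scalerBr. Qed.

Lemma trmx_brk (X Y : Mx) : X^T = - X -> Y^T = - Y -> (brk X Y)^T = - brk X Y.
Proof.
move=> sX sY; rewrite /brk (raddfB (@trmx R _ _)) /= !trmx_mul sX sY.
by rewrite !mulNmx !mulmxN !opprK opprB.
Qed.

Lemma PzE : Pz = ez *m ez^T. Proof. by rewrite /ez trmx_delta mul_delta_mx. Qed.
Lemma trPz : Pz^T = Pz. Proof. exact: trmx_delta. Qed.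
Lemma PzPz : Pz *m Pz = Pz. Proof. exact: mul_delta_mx. Qed.
Lemma Pz_ez : Pz *m ez = ez. Proof. exact: mul_delta_mx. Qed.
Lemma Pz_eo : Pz *m eo = 0. Proof. exact: mul_delta_mx_0. Qed.

Lemma J_ez : J *m ez = 0.
Proof.
apply/mul_delta_col0P => k.
by have [_ /(_ k)[]] := blocks24_entries (0 : 'M[R]_n) (- 1%:M) 1%:M 0.
Qed.

Lemma J_eo : J *m eo = 0.
Proof.
apply/mul_delta_col0P => k.
by have [_ /(_ k)[]] := blocks24_entries (0 : 'M[R]_n) (- 1%:M) 1%:M 0.
Qed.

Lemma trJ : J^T = - J.
Proof.
by rewrite /J blocks24_tr blocks24N (raddfN (@trmx R n n)) /= !trmx1 !trmx0
  !oppr0 opprK.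
Qed.

Lemma mul_ezP (X : Mx) : X *m ez = 0 <-> X *m Pz = 0.
Proof.
split=> [E|E]; first by rewrite PzE mulmxA E mul0mx.
by rewrite -Pz_ez mulmxA E mul0mx.
Qed.

Lemma skew_PzXPz (X : Mx) : X^T = - X -> Pz *m X *m Pz = 0.
Proof.
move=> sX.
have -> : Pz *m X *m Pz = ez *m (ez^T *m X *m ez) *m ez^T by rewrite PzE !mulmxA.
suff -> : ez^T *m X *m ez = 0 by rewrite mulmx0 mul0mx.
rewrite /ez trmx_delta -mulmxA -colE -rowE.
by apply/matrixP => i j; rewrite !ord1 !mxE (skew_diag _ sX).
Qed.

Lemma lie_k_Pz (X : Mx) : lie_k X -> X *m Pz = 0 /\ Pz *m X = 0.
Proof.
move=> /lie_kP[/lie_gP[sX _] /mul_ezP XP]; split=> //.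
by apply: trmx_inj; rewrite trmx_mul trPz sX mulNmx XP oppr0 trmx0.
Qed.

Lemma lie_g_skew (X : Mx) : lie_g X -> X^T = - X.
Proof. by move=> /lie_gP[]. Qed.

Lemma lie_k_g (X : Mx) : lie_k X -> lie_g X.
Proof. by move=> /lie_kP[]. Qed.

Lemma lie_h_k (X : Mx) : lie_h X -> lie_k X.
Proof. by move=> /lie_hP[]. Qed.

Lemma lie_g_linear c (X Y : Mx) : lie_g X -> lie_g Y -> lie_g (c *: X + Y).
Proof.
move=> /lie_gP[sX Xo] /lie_gP[sY Yo]; apply/lie_gP; split.
  by rewrite linearD linearZ /= sX sY scalerN opprD.
by rewrite mulmxDl -scalemxAl Xo Yo scaler0 addr0.
Qed.

Lemma lie_k_linear c (X Y : Mx) : lie_k X -> lie_k Y -> lie_k (c *: X + Y).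
Proof.
move=> /lie_kP[gX Xz] /lie_kP[gY Yz]; apply/lie_kP.
split; first exact: lie_g_linear.
by rewrite mulmxDl -scalemxAl Xz Yz scaler0 addr0.
Qed.

Lemma lie_h_linear c (X Y : Mx) : lie_h X -> lie_h Y -> lie_h (c *: X + Y).
Proof.
move=> /lie_hP[kX XJ] /lie_hP[kY YJ]; apply/lie_hP.
split; first exact: lie_k_linear.
by rewrite mulmxDl mulmxDr -scalemxAl -scalemxAr XJ YJ.
Qed.

Lemma lie_g0 : lie_g (0 : Mx).
Proof. by apply/lie_gP; rewrite trmx0 oppr0 mul0mx. Qed.

Lemma lie_k0 : lie_k (0 : Mx).
Proof. by apply/lie_kP; rewrite mul0mx; split=> //; exact: lie_g0. Qed.

Lemma lie_h0 : lie_h (0 : Mx).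
Proof. by apply/lie_hP; rewrite mul0mx mulmx0; split=> //; exact: lie_k0. Qed.

Lemma lie_gD (X Y : Mx) : lie_g X -> lie_g Y -> lie_g (X + Y).
Proof. by move=> gX gY; rewrite -(scale1r X); exact: lie_g_linear. Qed.
Lemma lie_kD (X Y : Mx) : lie_k X -> lie_k Y -> lie_k (X + Y).
Proof. by move=> gX gY; rewrite -(scale1r X); exact: lie_k_linear. Qed.
Lemma lie_hD (X Y : Mx) : lie_h X -> lie_h Y -> lie_h (X + Y).
Proof. by move=> gX gY; rewrite -(scale1r X); exact: lie_h_linear. Qed.
Lemma lie_gZ c (X : Mx) : lie_g X -> lie_g (c *: X).
Proof. by move=> gX; rewrite -[_ *: _]addr0; apply: lie_g_linear => //; exact: lie_g0. Qed.
Lemma lie_kZ c (X : Mx) : lie_k X -> lie_k (c *: X).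
Proof. by move=> gX; rewrite -[_ *: _]addr0; apply: lie_k_linear => //; exact: lie_k0. Qed.
Lemma lie_hZ c (X : Mx) : lie_h X -> lie_h (c *: X).
Proof. by move=> gX; rewrite -[_ *: _]addr0; apply: lie_h_linear => //; exact: lie_h0. Qed.
Lemma lie_gB (X Y : Mx) : lie_g X -> lie_g Y -> lie_g (X - Y).
Proof. by move=> gX gY; rewrite -(scaleN1r Y) addrC; exact: (lie_g_linear _ gY gX). Qed.
Lemma lie_kB (X Y : Mx) : lie_k X -> lie_k Y -> lie_k (X - Y).
Proof. by move=> gX gY; rewrite -(scaleN1r Y) addrC; exact: (lie_k_linear _ gY gX). Qed.
Lemma lie_hB (X Y : Mx) : lie_h X -> lie_h Y -> lie_h (X - Y).
Proof. by move=> gX gY; rewrite -(scaleN1r Y) addrC; exact: (lie_h_linear _ gY gX). Qed.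

Lemma lie_g_brk (X Y : Mx) : lie_g X -> lie_g Y -> lie_g (brk X Y).
Proof.
move=> /lie_gP[sX Xo] /lie_gP[sY Yo]; apply/lie_gP; split; first exact: trmx_brk.
by rewrite /brk mulmxBl -!mulmxA Xo Yo !mulmx0 subr0.
Qed.

Lemma lie_k_brk (X Y : Mx) : lie_k X -> lie_k Y -> lie_k (brk X Y).
Proof.
move=> /lie_kP[gX Xo] /lie_kP[gY Yo]; apply/lie_kP; split; first exact: lie_g_brk.
by rewrite /brk mulmxBl -!mulmxA Xo Yo !mulmx0 subr0.
Qed.

Lemma lie_h_brk (X Y : Mx) : lie_h X -> lie_h Y -> lie_h (brk X Y).
Proof.
move=> /lie_hP[kX XJ] /lie_hP[kY YJ]; apply/lie_hP; split; first exact: lie_k_brk.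
by rewrite /brk mulmxBl mulmxBr !mulmxA -XJ -YJ -!mulmxA -XJ -YJ.
Qed.

(** ** The projections of g onto m, q and h *)

(** A skew matrix has no [(iz, iz)] entry, so [pm] keeps its [iz]-th row and
column, and [pk] removes them. On k, [X |-> - J X J] is an involution, of which
[ph] and [pq] project onto the eigenspaces [1] and [-1]. *)
Definition pm (X : Mx) : Mx := X *m Pz + Pz *m X.
Definition pk (X : Mx) : Mx := X - pm X.
Definition pq (X : Mx) : Mx := 2^-1 *: (pk X + J *m pk X *m J).
Definition ph (X : Mx) : Mx := 2^-1 *: (pk X - J *m pk X *m J).

(** m and q by equations, instead of orthogonality as in [lie_m] and [lie_q];
[pr_mE] and [pr_qE] match the two descriptions. *)
Definition in_m (X : Mx) := lie_g X /\ pm X = X.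
Definition in_q (X : Mx) := lie_k X /\ X *m J = - (J *m X).

Lemma in_m_g (X : Mx) : in_m X -> lie_g X. Proof. by case. Qed.
Lemma in_q_k (X : Mx) : in_q X -> lie_k X. Proof. by case. Qed.
Lemma in_q_g (X : Mx) : in_q X -> lie_g X. Proof. by move=> /in_q_k /lie_k_g. Qed.

Lemma pm_in (X : Mx) : lie_g X -> in_m (pm X).
Proof.
move=> /lie_gP[sX Xo]; split.
  apply/lie_gP; split.
    by rewrite /pm linearD /= !trmx_mul trPz sX mulNmx mulmxN opprD addrC.
  by rewrite /pm mulmxDl -!mulmxA Xo Pz_eo !mulmx0 addr0.
rewrite /pm mulmxDl mulmxDr !mulmxA PzPz -[X *m Pz *m Pz]mulmxA PzPz.
by rewrite (skew_PzXPz sX) addr0 add0r.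
Qed.

Lemma pk_in (X : Mx) : lie_g X -> lie_k (pk X).
Proof.
move=> gX; have [gmX _] := pm_in gX; have sX := lie_g_skew gX.
apply/lie_kP; split; first exact: lie_gB.
apply/mul_ezP; rewrite /pk /pm mulmxBl mulmxDl (skew_PzXPz sX) addr0 -mulmxA PzPz.
by rewrite subrr.
Qed.

Lemma lie_k_JXJ (X : Mx) : lie_k X -> lie_k (J *m X *m J).
Proof.
move=> /lie_kP[/lie_gP[sX _] _]; apply/lie_kP; split; last first.
  by rewrite -mulmxA J_ez mulmx0.
apply/lie_gP; split; last by rewrite -mulmxA J_eo mulmx0.
by rewrite !trmx_mul trJ sX !mulNmx !mulmxN !opprK mulmxA.
Qed.

Lemma J_JXJ (X : Mx) : lie_k X ->
  J *m (J *m X *m J) = - (X *m J) /\ J *m X *m J *m J = - (J *m X).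
Proof.
move=> kX; have [JJX XJJ] := J_sqr kX.
split; first by rewrite !mulmxA JJX mulNmx.
have -> : J *m X *m J *m J = J *m (X *m J *m J) by rewrite !mulmxA.
by rewrite XJJ mulmxN.
Qed.

Lemma pq_in (X : Mx) : lie_g X -> in_q (pq X).
Proof.
move=> gX; have kX := pk_in gX; have [E1 E2] := J_JXJ kX; split.
  by apply: lie_kZ; apply: lie_kD => //; exact: lie_k_JXJ.
rewrite /pq; move: (pk X) kX E1 E2 => K _ E1 E2.
rewrite -scalemxAl -scalemxAr -scalerN mulmxDl mulmxDr E1 E2.
by rewrite opprD opprK addrC.
Qed.

Lemma ph_in (X : Mx) : lie_g X -> lie_h (ph X).
Proof.
move=> gX; have kX := pk_in gX; have [E1 E2] := J_JXJ kX; apply/lie_hP; split.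
  by apply: lie_kZ; apply: lie_kB => //; exact: lie_k_JXJ.
rewrite /ph; move: (pk X) kX E1 E2 => K _ E1 E2.
by rewrite -scalemxAl -scalemxAr mulmxBl mulmxBr E1 E2 !opprK addrC.
Qed.

Lemma pqh_sum (X : Mx) : pq X + ph X = pk X.
Proof.
rewrite /pq /ph; move: (pk X) => K.
rewrite -scalerDr addrACA subrr addr0 -mulr2n -[K *+ 2]scaler_nat scalerA.
by rewrite mulVf ?pnatr_eq0 // scale1r.
Qed.

Lemma pmqh_sum (X : Mx) : X = pm X + pq X + ph X.
Proof. by rewrite -addrA pqh_sum /pk addrC subrK. Qed.

(** ** Orthogonality *)

Lemma Bg_mk (X Y : Mx) : in_m X -> lie_k Y -> Bg X Y = 0.
Proof.
move=> [_ <-] /lie_k_Pz[YP PY]; rewrite /Bg /pm mulmxDl -mulmxA PY mulmx0 add0r.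
by rewrite -mulmxA mxtrace_mulC -mulmxA YP mulmx0 mxtrace0 mulr0.
Qed.

Lemma Bg_mq (X Y : Mx) : in_m X -> in_q Y -> Bg X Y = 0.
Proof. by move=> mX /in_q_k kY; exact: Bg_mk. Qed.

Lemma Bg_qm (X Y : Mx) : in_q X -> in_m Y -> Bg X Y = 0.
Proof. by move=> qX mY; rewrite Bg_sym; exact: Bg_mq. Qed.

Lemma Bg_mh (X Y : Mx) : in_m X -> lie_h Y -> Bg X Y = 0.
Proof. by move=> mX /lie_h_k kY; exact: Bg_mk. Qed.

(** The trace form is invariant under conjugation by [J], which has opposite
signs on q and h. *)
Lemma Bg_qh (X Y : Mx) : in_q X -> lie_h Y -> Bg X Y = 0.
Proof.
move=> [kX XJ] /lie_hP[kY YJ]; have [_ YJJ] := J_sqr kY.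
have E : \tr (X *m Y *m J *m J) = - \tr (X *m Y *m J *m J).
  rewrite {1}mxtrace_mulC !mulmxA.
  have -> : J *m X = - (X *m J) by rewrite XJ opprK.
  rewrite !mulNmx -[X *m J *m Y]mulmxA -YJ mulmxA.
  exact: (raddfN (@mxtrace R _)).
have E0 : \tr (X *m Y *m J *m J) = 0.
  by move/eqP: E; rewrite -addr_eq0 -mulr2n mulrn_eq0 => /eqP.
rewrite /Bg -[Y]opprK -YJJ mulmxN !mulmxA (raddfN (@mxtrace R _)) /= E0.
by rewrite oppr0 mulr0.
Qed.

Lemma trace_skew_sqr m (X : 'M[R]_m) : X^T = - X -> \tr (X *m X) = 0 -> X = 0.
Proof.
move=> sX trX; apply/matrixP => i j; rewrite mxE.
have : \sum_i \sum_j X i j ^+ 2 = 0.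
  apply: (@etrans _ _ (- \tr (X *m X))); last by rewrite trX oppr0.
  rewrite /mxtrace -sumrN; apply: eq_bigr => k _.
  rewrite mxE -sumrN; apply: eq_bigr => l _.
  by rewrite (skew_entry l k sX) mulrN opprK expr2.
move/eqP; rewrite psumr_eq0; last by move=> k _; apply: sumr_ge0 => l _; exact: sqr_ge0.
move=> /allP /(_ i (mem_index_enum _)) /=.
rewrite psumr_eq0; last by move=> l _; exact: sqr_ge0.
by move=> /allP /(_ j (mem_index_enum _)) /=; rewrite sqrf_eq0 => /eqP.
Qed.

End Projections.

(** * The Levi-Civita form *)

Section LeviCivitaForm.
Context {R : realType} {n : nat}.
Local Notation Mx := (amb R n).
Local Notation J := (@J R n).
Local Notation Pz := (@Pz R n).
Local Notation ez := (@ez R n).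

Lemma in_m_mulPz (X : Mx) : in_m X -> X *m Pz = X - Pz *m X.
Proof. by move=> [_ E]; rewrite -[X in X - _]E /pm addrK. Qed.

(** The pairs (g, k) and (k, h) are symmetric: conjugation by [1 - 2 Pz] fixes k
and negates m, conjugation by [J] fixes h and negates q. The five bracket
relations below express this. *)
Lemma lie_k_brk_mm (X Y : Mx) : in_m X -> in_m Y -> lie_k (brk X Y).
Proof.
move=> mX mY; have gXY := lie_g_brk (in_m_g mX) (in_m_g mY).
apply/lie_kP; split=> //; apply/mul_ezP.
have E (A B : Mx) : in_m A -> in_m B -> A *m B *m Pz = Pz *m (A *m B).
  move=> mA mB; rewrite -mulmxA (in_m_mulPz mB) mulmxBr [A *m (Pz *m B)]mulmxA.
  by rewrite (in_m_mulPz mA) mulmxBl opprB addrC subrK mulmxA.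
have C : brk X Y *m Pz = Pz *m brk X Y.
  by rewrite /brk mulmxBl mulmxBr !E.
by rewrite -PzPz mulmxA C (skew_PzXPz (lie_g_skew gXY)).
Qed.

Lemma in_m_brk_km (W X : Mx) : lie_k W -> in_m X -> in_m (brk W X).
Proof.
move=> kW mX; split; first exact: lie_g_brk (lie_k_g kW) (in_m_g mX).
have [WP PW] := lie_k_Pz kW; have XP := in_m_mulPz mX.
have PX : Pz *m X = X - X *m Pz by rewrite XP opprB addrC subrK.
rewrite /pm /brk mulmxBl mulmxBr -!mulmxA WP mulmx0 subr0 XP mulmxBr !mulmxA WP PW.
by rewrite mul0mx subr0 sub0r PX mulmxBl -mulmxA PW mulmx0 subr0.
Qed.

Lemma in_m_brk_mk (W X : Mx) : lie_k W -> in_m X -> in_m (brk X W).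
Proof.
move=> kW mX; have [gWX E] := in_m_brk_km kW mX; rewrite brkN -scaleN1r.
split; first exact: lie_gZ.
by rewrite /pm -scalemxAl -scalemxAr -scalerDr -/(pm _) E.
Qed.

Lemma lie_h_brk_qq (X Y : Mx) : in_q X -> in_q Y -> lie_h (brk X Y).
Proof.
move=> [kX XJ] [kY YJ]; apply/lie_hP; split; first exact: lie_k_brk.
rewrite /brk mulmxBl mulmxBr -!mulmxA XJ YJ !mulmxN !mulmxA XJ YJ.
by rewrite !mulNmx !opprK.
Qed.

Lemma in_q_brk_hq (W X : Mx) : lie_h W -> in_q X -> in_q (brk W X).
Proof.
move=> /lie_hP[kW WJ] [kX XJ]; split; first exact: lie_k_brk.
rewrite /brk mulmxBl mulmxBr -!mulmxA XJ WJ !mulmxN !mulmxA XJ WJ.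
by rewrite !mulNmx opprK opprB addrC.
Qed.

Lemma pm_k (X : Mx) : lie_k X -> pm X = 0.
Proof. by move=> /lie_k_Pz[E1 E2]; rewrite /pm E1 E2 addr0. Qed.

Lemma pk_m (X : Mx) : in_m X -> pk X = 0.
Proof. by move=> [_ E]; rewrite /pk E subrr. Qed.

Lemma pk_k (X : Mx) : lie_k X -> pk X = X.
Proof. by move=> kX; rewrite /pk pm_k // subr0. Qed.

Lemma pq_m (X : Mx) : in_m X -> pq X = 0.
Proof. by move=> mX; rewrite /pq pk_m // mulmx0 mul0mx addr0 scaler0. Qed.

Lemma ph_m (X : Mx) : in_m X -> ph X = 0.
Proof. by move=> mX; rewrite /ph pk_m // mulmx0 mul0mx subr0 scaler0. Qed.

Lemma scale_half_double (X : Mx) : 2^-1 *: (X + X) = X.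
Proof.
by rewrite -mulr2n -[X *+ 2]scaler_nat scalerA mulVf ?pnatr_eq0 // scale1r.
Qed.

Lemma pq_q (X : Mx) : in_q X -> pq X = X.
Proof.
move=> [kX XJ]; have [JJX _] := J_sqr kX.
by rewrite /pq pk_k // -mulmxA XJ mulmxN mulmxA JJX opprK scale_half_double.
Qed.

Lemma ph_q (X : Mx) : in_q X -> ph X = 0.
Proof.
move=> [kX XJ]; have [JJX _] := J_sqr kX.
by rewrite /ph pk_k // -mulmxA XJ mulmxN mulmxA JJX opprK subrr scaler0.
Qed.

Lemma pq_h (X : Mx) : lie_h X -> pq X = 0.
Proof.
move=> /lie_hP[kX XJ]; have [JJX _] := J_sqr kX.
by rewrite /pq pk_k // -mulmxA XJ mulmxA JJX subrr scaler0.
Qed.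

Lemma ph_h (X : Mx) : lie_h X -> ph X = X.
Proof.
move=> /lie_hP[kX XJ]; have [JJX _] := J_sqr kX.
by rewrite /ph pk_k // -mulmxA XJ mulmxA JJX opprK scale_half_double.
Qed.

Lemma pm_linear c (X Y : Mx) : pm (c *: X + Y) = c *: pm X + pm Y.
Proof.
by rewrite /pm mulmxDl mulmxDr -scalemxAl -scalemxAr scalerDr addrACA.
Qed.

Lemma pk_linear c (X Y : Mx) : pk (c *: X + Y) = c *: pk X + pk Y.
Proof. by rewrite /pk pm_linear scalerBr opprD addrACA. Qed.

Lemma JXJ_linear c (X Y : Mx) :
  J *m (c *: X + Y) *m J = c *: (J *m X *m J) + J *m Y *m J.
Proof. by rewrite mulmxDr mulmxDl -scalemxAr -scalemxAl. Qed.

Lemma pq_linear c (X Y : Mx) : pq (c *: X + Y) = c *: pq X + pq Y.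
Proof.
rewrite /pq pk_linear; move: (pk X) (pk Y) => A B.
rewrite JXJ_linear; move: (J *m A *m J) (J *m B *m J) => A' B'.
by apply/matrixP => i j; rewrite !mxE; ring.
Qed.

Lemma ph_linear c (X Y : Mx) : ph (c *: X + Y) = c *: ph X + ph Y.
Proof.
rewrite /ph pk_linear; move: (pk X) (pk Y) => A B.
rewrite JXJ_linear; move: (J *m A *m J) (J *m B *m J) => A' B'.
by apply/matrixP => i j; rewrite !mxE; ring.
Qed.

(** ** The defining projections of the metric *)

Section Metric.
Hypothesis n_gt0 : (0 < n)%N.

Let dim_neq0 : (2 * n%:R - 1 : R) != 0.
Proof.
have : 1 <= n%:R :> R by rewrite ler1n.
by move=> ?; apply: lt0r_neq0; lra.
Qed.

Lemma Bg_definite (X : Mx) : lie_g X -> Bg X X = 0 -> X = 0.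
Proof.
move=> gX /eqP; rewrite /Bg mulf_eq0 oppr_eq0 (negbTE dim_neq0) /= => /eqP.
exact: trace_skew_sqr (lie_g_skew gX).
Qed.

(** [pr_m] and [pr_q] choose a decomposition; it is unique because [Bg] is
definite on g, the difference of two choices being orthogonal to itself. *)
Lemma pr_mE (X : Mx) : lie_g X -> pr_m X = pm X.
Proof.
move=> gX; have mX := pm_in gX; apply: xget_unique => [|Z [[gZ Zk] kXZ]].
  split; last exact: pk_in.
  by split; [exact: in_m_g | move=> Y kY; exact: Bg_mk].
have kD : lie_k (pm X - Z).
  by rewrite -[pm X - Z](_ : (X - Z) - pk X = _);
    [apply: lie_kB => //; exact: pk_in | rewrite /pk opprB addrC addrA subrK].
apply/esym/eqP; rewrite -subr_eq0; apply/eqP; apply: Bg_definite (lie_k_g kD) _.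
by rewrite {1}BgDl BgNl (Bg_mk mX kD) (Zk _ kD) subr0.
Qed.

Lemma pr_qE (X : Mx) : lie_g X -> pr_q X = pq X.
Proof.
move=> gX; have qX := pq_in gX; rewrite /pr_q pr_mE //.
apply: xget_unique => [|Z [[kZ Zh] hXZ]].
  split; last by rewrite -/(pk X) -pqh_sum addrC addKr; exact: ph_in.
  by split; [exact: in_q_k | move=> Y hY; exact: Bg_qh].
have hD : lie_h (pq X - Z).
  rewrite -[pq X - Z](_ : (X - pm X - Z) - ph X = _).
    by apply: lie_hB => //; exact: ph_in.
  by rewrite -/(pk X) -pqh_sum addrAC addrK.
apply/esym/eqP; rewrite -subr_eq0; apply/eqP.
apply: Bg_definite (lie_k_g (lie_h_k hD)) _.
by rewrite {1}BgDl BgNl (Bg_qh qX hD) (Zh _ hD) subr0.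
Qed.

Lemma ipE (s t : R) (X Y : Mx) : lie_g X -> lie_g Y ->
  ip s t X Y = (s ^+ 2)^-1 * Bg (pm X) (pm Y) + (t ^+ 2)^-1 * Bg (pq X) (pq Y).
Proof. by move=> gX gY; rewrite /ip !pr_mE // !pr_qE. Qed.

End Metric.

Lemma Bg_pm (X Y : Mx) : lie_g X -> in_m Y -> Bg X Y = Bg (pm X) Y.
Proof.
move=> gX mY; rewrite {1}(pmqh_sum X) (BgDl (pm X + pq X)) (BgDl (pm X)) (Bg_qm (pq_in gX) mY).
by rewrite (Bg_sym (ph X)) (Bg_mh mY (ph_in gX)) !addr0.
Qed.

Lemma Bg_pq (X Y : Mx) : lie_g X -> in_q Y -> Bg X Y = Bg (pq X) Y.
Proof.
move=> gX qY; rewrite {1}(pmqh_sum X) (BgDl (pm X + pq X)) (BgDl (pm X)) (Bg_mq (pm_in gX) qY).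
by rewrite (Bg_sym (ph X)) (Bg_qh qY (ph_in gX)) addr0 add0r.
Qed.

(** ** The connection form *)

Section Form.
Variable kap : R.

(** The Levi-Civita connection of the invariant metric in a left-invariant
frame. A vector of h acts by the isotropy representation. On m + q the Koszul
formula gives half the bracket, plus a correction that vanishes for [s = t] and
only affects the bracket of m with q, where it turns [1/2] into [kap] and
[1 - kap] with [kap = s^2 / (2 t^2)]. Values are taken modulo h, as they will
only be paired with m + q. *)
Definition lc_form (X Y : Mx) : Mx :=
  2^-1 *: brk (pm X) (pm Y) + kap *: brk (pm X) (pq Y)
  + (1 - kap) *: brk (pq X) (pm Y) + brk (ph X) (pm Y + pq Y).

Lemma lc_form_linear c (X X' Y : Mx) :
  lc_form (c *: X + X') Y = c *: lc_form X Y + lc_form X' Y.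
Proof.
rewrite /lc_form pm_linear pq_linear ph_linear.
move: (pm X) (pm X') (pq X) (pq X') (ph X) (ph X') (pm Y) (pq Y) => A A' B B' C C' D D'.
rewrite !(brkDl, brkZl).
by apply/matrixP => i j; rewrite !(addmxE, scalemxE); ring.
Qed.

Lemma lc_form_linearr c (X Y Y' : Mx) :
  lc_form X (c *: Y + Y') = c *: lc_form X Y + lc_form X Y'.
Proof.
rewrite /lc_form pm_linear pq_linear.
move: (pm X) (pq X) (ph X) (pm Y) (pq Y) (pm Y') (pq Y') => A B C D E D' E'.
rewrite !(brkDr, brkZr).
by apply/matrixP => i j; rewrite !(addmxE, scalemxE); ring.
Qed.

Lemma lie_g_lc_form (X Y : Mx) : lie_g X -> lie_g Y -> lie_g (lc_form X Y).
Proof.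
move=> gX gY; have gm := in_m_g (pm_in gX); have gm' := in_m_g (pm_in gY).
have gq := in_q_g (pq_in gX); have gq' := in_q_g (pq_in gY).
have gh := lie_k_g (lie_h_k (ph_in gX)).
have gmq := lie_gD gm' gq'.
have G := (lie_g_brk gm gm', lie_g_brk gm gq', lie_g_brk gq gm', lie_g_brk gh gmq).
exact: (lie_gD (lie_gD (lie_gD (lie_gZ _ G.1.1.1) (lie_gZ _ G.1.1.2))
  (lie_gZ _ G.1.2)) G.2).
Qed.

(** Torsion-freeness modulo h: what is missing from the bracket is
[[q, q] + [h, h]], a part of h. *)
Lemma lc_form_torsion (X Y : Mx) : lie_g X -> lie_g Y ->
  lie_h (lc_form X Y - lc_form Y X - brk X Y).
Proof.
move=> gX gY.
have -> : lc_form X Y - lc_form Y X - brk X Y =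
    - (brk (pq X) (pq Y) + brk (ph X) (ph Y)).
  rewrite {3}(pmqh_sum X) {3}(pmqh_sum Y) /lc_form.
  move: (pm X) (pq X) (ph X) (pm Y) (pq Y) (ph Y) => A B C A' B' C'.
  rewrite !(brkDl, brkDr) [brk A' A]brkN [brk A' B]brkN [brk B' A]brkN
    [brk C' A]brkN [brk C' B]brkN.
  by apply/matrixP => i j; rewrite !(addmxE, oppmxE, scalemxE); field.
rewrite -scaleN1r; apply: lie_hZ; apply: lie_hD.
  exact: lie_h_brk_qq (pq_in gX) (pq_in gY).
exact: lie_h_brk (ph_in gX) (ph_in gY).
Qed.

Lemma lc_form_m (X Y : Mx) : in_m Y -> lc_form X Y =
  2^-1 *: brk (pm X) Y + (1 - kap) *: brk (pq X) Y + brk (ph X) Y.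
Proof.
move=> mY; rewrite /lc_form (pq_m mY) addr0 mY.2.
by rewrite [brk (pm X) 0]/brk mulmx0 mul0mx subr0 scaler0 addr0.
Qed.

Lemma lc_form_q (X Y : Mx) : in_q Y -> lc_form X Y =
  kap *: brk (pm X) Y + brk (ph X) Y.
Proof.
move=> qY; rewrite /lc_form (pq_q qY) (pm_k (in_q_k qY)) add0r.
by rewrite /brk !mulmx0 !mul0mx !subr0 !scaler0 add0r addr0.
Qed.

Lemma Bg_brk_skew (X Y Z : Mx) : Bg (brk X Y) Z = - Bg (brk X Z) Y.
Proof. by rewrite brkN BgNl Bg_brk Bg_sym. Qed.

Lemma Bg_comb2 a b (A B C : Mx) (Z : Mx) :
  Bg (a *: A + b *: B + C) Z = a * Bg A Z + b * Bg B Z + Bg C Z.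
Proof. by rewrite !BgDl !BgZl. Qed.

Lemma Bg_comb1 a (A B : Mx) (Z : Mx) : Bg (a *: A + B) Z = a * Bg A Z + Bg B Z.
Proof. by rewrite !BgDl !BgZl. Qed.

Lemma lc_form_skew_mm (X Y Z : Mx) : lie_g X -> in_m Y -> in_m Z ->
  Bg (lc_form X Y) Z = - Bg (lc_form X Z) Y.
Proof.
move=> gX mY mZ; have mX := pm_in gX.
have E (A B : Mx) : in_m A -> in_m B -> Bg (brk (pm X) A) B = 0.
  by move=> mA mB; rewrite Bg_sym; apply: Bg_mk => //; exact: lie_k_brk_mm.
rewrite (lc_form_m X mY) (lc_form_m X mZ) !Bg_comb2 (E _ _ mY mZ) (E _ _ mZ mY).
by rewrite (Bg_brk_skew (pq X) Y) (Bg_brk_skew (ph X) Y); ring.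
Qed.

Lemma lc_form_skew_qq (X Y Z : Mx) : lie_g X -> in_q Y -> in_q Z ->
  Bg (lc_form X Y) Z = - Bg (lc_form X Z) Y.
Proof.
move=> gX qY qZ; have mX := pm_in gX.
have E (A B : Mx) : in_q A -> in_q B -> Bg (brk (pm X) A) B = 0.
  by move=> /in_q_k kA qB; apply: Bg_mq => //; exact: in_m_brk_mk.
rewrite (lc_form_q X qY) (lc_form_q X qZ) !Bg_comb1 (E _ _ qY qZ) (E _ _ qZ qY).
by rewrite (Bg_brk_skew (ph X) Y) mulr0 !add0r.
Qed.

(** The mixed case of metricity is the one that determines [kap]: the factor
[2 kap] is the quotient of the weights [t^-2] and [s^-2] of q and m. *)
Lemma lc_form_skew_mq (X Y Z : Mx) : lie_g X -> in_m Y -> in_q Z ->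
  2 * kap * Bg (lc_form X Y) Z = - Bg (lc_form X Z) Y.
Proof.
move=> gX mY qZ; have mX := pm_in gX; have qX := pq_in gX; have hX := ph_in gX.
have E1 : Bg (brk (pq X) Y) Z = 0.
  by apply: Bg_mq => //; apply: in_m_brk_km => //; exact: in_q_k.
have E2 : Bg (brk (ph X) Y) Z = 0.
  by apply: Bg_mq => //; apply: in_m_brk_km => //; exact: lie_h_k.
have E3 : Bg (brk (ph X) Z) Y = 0 by apply: Bg_qm => //; exact: in_q_brk_hq.
rewrite (lc_form_m X mY) (lc_form_q X qZ) Bg_comb2 Bg_comb1 E1 E2 E3.
rewrite (Bg_brk_skew (pm X) Y).
by field.
Qed.

End Form.
End LeviCivitaForm.

(** * An orthonormal basis of m + q *)

Section Basis.
Context {R : realType} {n : nat}.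
Local Notation Mx := (amb R n).
Local Notation J := (@J R n).
Local Notation Pz := (@Pz R n).
Local Notation ez := (@ez R n).
Local Notation eo := (@eo R n).
Local Notation V := 'cV[R]_((1 + n) + (1 + n)).
Local Notation D := (2 * n%:R - 1 : R).

(** m consists of the infinitesimal rotations in the planes spanned by [ez] and a
vector [v]; the bracket with k acts on them through [v]. *)
Definition m_vec (v : V) : Mx := v *m ez^T - ez *m v^T.
Definition m_unit (k : 'I_((1 + n) + (1 + n))) : Mx := m_vec (delta_mx k 0).
Definition skew_unit (i j : 'I_n) : 'M[R]_n := delta_mx i j - delta_mx j i.
(** The skew matrices of k that anticommute with [J] are the sums of these two
families. *)
Definition q1 (S : 'M[R]_n) : Mx := blocks24 S 0 0 (- S).
Definition q2 (S : 'M[R]_n) : Mx := blocks24 0 S S 0.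

Lemma ez_ez : ez^T *m ez = 1%:M.
Proof. by rewrite /ez trmx_delta mul_delta_mx; apply/matrixP => i j; rewrite !ord1 !mxE. Qed.

Lemma ez_orth (v : V) : v iz 0 = 0 -> ez^T *m v = 0 /\ v^T *m ez = 0.
Proof.
move=> v0; have E : ez^T *m v = 0.
  by apply/matrixP => i j; rewrite !ord1 /ez trmx_delta -rowE !mxE.
by split=> //; apply: trmx_inj; rewrite trmx_mul trmxK E trmx0.
Qed.

Lemma in_m_vec (v : V) : v iz 0 = 0 -> v io 0 = 0 -> in_m (m_vec v).
Proof.
move=> vz vo; have [E1 E2] := ez_orth vz; split.
  apply/lie_gP; split.
    by rewrite /m_vec (raddfB (@trmx R _ _)) /= !trmx_mul !trmxK opprB.
  have ezo : ez^T *m eo = 0 by rewrite /ez trmx_delta mul_delta_mx_0.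
  have vo' : v^T *m eo = 0.
    by rewrite /eo -colE; apply/matrixP => i j; rewrite !ord1 !mxE.
  by rewrite /m_vec mulmxBl -!mulmxA ezo vo' !mulmx0 subr0.
have EA : m_vec v *m Pz = v *m ez^T.
  have -> : m_vec v *m Pz = v *m (ez^T *m ez) *m ez^T - ez *m (v^T *m ez) *m ez^T.
    by rewrite PzE /m_vec mulmxBl !mulmxA.
  by rewrite ez_ez E2 mulmx1 mulmx0 mul0mx subr0.
have EB : Pz *m m_vec v = - (ez *m v^T).
  have -> : Pz *m m_vec v = ez *m (ez^T *m v) *m ez^T - ez *m (ez^T *m ez) *m v^T.
    by rewrite PzE /m_vec mulmxBr !mulmxA.
  by rewrite ez_ez E1 mulmx1 mulmx0 mul0mx sub0r.
by rewrite /pm EA EB.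
Qed.

Lemma Bg_m_vec (X : Mx) (v : V) : X^T = - X ->
  Bg X (m_vec v) = 2 * D * \sum_k v k 0 * X k iz.
Proof.
move=> sX.
have E : \tr (X *m (ez *m v^T)) = \sum_k v k 0 * X k iz.
  rewrite mulmxA mxtrace_mulC /mxtrace big_ord1 /ez -colE mxE.
  by apply: eq_bigr => k _; rewrite !mxE.
have E' : \tr (X *m (v *m ez^T)) = - \sum_k v k 0 * X k iz.
  rewrite -E -[LHS]mxtrace_tr !trmx_mul trmxK sX mulmxN.
  by rewrite (raddfN (@mxtrace R _)) /= mxtrace_mulC.
rewrite /Bg /m_vec mulmxBr (raddfB (@mxtrace R _)) /= E E'; ring.
Qed.

Lemma in_q1 (S : 'M[R]_n) : S^T = - S -> in_q (q1 S).
Proof.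
move=> sS; split; last first.
  rewrite /q1 /J !blocks24M blocks24N.
  by rewrite !(mul0mx, mulmx0, add0r, addr0, mulmxN, mulNmx, mul1mx, mulmx1, opprK, oppr0).
exists S, 0, 0, (- S); split=> //.
by rewrite /so /= tr_block_mx opp_block_mx (raddfN (@trmx R n n)) /= sS !trmx0 oppr0.
Qed.

Lemma in_q2 (S : 'M[R]_n) : S^T = - S -> in_q (q2 S).
Proof.
move=> sS; split; last first.
  rewrite /q2 /J !blocks24M blocks24N.
  by rewrite !(mul0mx, mulmx0, add0r, addr0, mulmxN, mulNmx, mul1mx, mulmx1, opprK, oppr0).
exists 0, S, S, 0; split=> //.
by rewrite /so /= tr_block_mx opp_block_mx sS !trmx0 oppr0.
Qed.

Lemma in_q_blocks (X : Mx) : in_q X ->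
  exists A B : 'M[R]_n, [/\ X = q1 A + q2 B, A^T = - A & B^T = - B].
Proof.
move=> [kX]; have [A [B [C [E [-> sA sB sE]]]]] := lie_k_blocks kX.
rewrite /J !blocks24M blocks24N.
rewrite !(mul0mx, mulmx0, add0r, addr0, mulmxN, mulNmx, mul1mx, mulmx1, opprK).
move=> /blocks24_inj[EB EA _ _]; exists A, B.
split=> //; last by rewrite sB EB.
by rewrite /q1 /q2 blocks24D !addr0 !add0r EA EB.
Qed.

Lemma tr_skew_unit (i j : 'I_n) : (skew_unit i j)^T = - skew_unit i j.
Proof. by rewrite /skew_unit (raddfB (@trmx R n n)) /= !trmx_delta opprB. Qed.

Lemma trace_mul_delta m (X : 'M[R]_m) i j : \tr (X *m delta_mx i j) = X j i.
Proof.
rewrite -(mul_delta_mx (0 : 'I_1)) mulmxA mxtrace_mulC /mxtrace big_ord1.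
by rewrite -colE -rowE !mxE.
Qed.

Lemma Bg_q (A B S : 'M[R]_n) :
  Bg (q1 A + q2 B) (q1 S) = - (2 * D) * \tr (A *m S) /\
  Bg (q1 A + q2 B) (q2 S) = - (2 * D) * \tr (B *m S).
Proof.
rewrite /Bg /q1 /q2 blocks24D !blocks24M !blocks24_trace.
rewrite !(mulmx0, addr0, add0r, mulmxN, mulNmx, opprK); split; ring.
Qed.

Lemma trace_skew_unit (A : 'M[R]_n) i j : A^T = - A ->
  \tr (A *m skew_unit i j) = - 2 * A i j.
Proof.
move=> sA; rewrite /skew_unit mulmxBr (raddfB (@mxtrace R n)) /=.
rewrite !trace_mul_delta (skew_entry j i sA); ring.
Qed.

(** ** The index set *)

(** The pair [(i, None)] stands for a unit vector in the last block of m,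
[(i, Some i)] for one in the second block, and [(i, Some j)], [j != i], for an
element of one of the two families of skew matrices that make up q, according
to the sign of [j - i]; this indexes a basis of m + q by a type with
[n * n.+1] elements. *)
Local Notation idx := ('I_n * option 'I_n)%type.
Definition is_m (c : idx) : bool := if c.2 is Some j then c.1 == j else true.
Definition m_idx (c : idx) := if c.2 is Some j then ia c.1 else ib c.1.
Definition q_unit (i j : 'I_n) : Mx :=
  if (i < j)%N then q1 (skew_unit i j) else q2 (skew_unit i j).

Section Scaled.
Variables (s t : R).
Hypothesis (n_gt0 : (0 < n)%N) (s_gt0 : 0 < s) (t_gt0 : 0 < t).

(** [m_unit] has squared norm [2 D] and [q_unit] [4 D] for [Bg]; the factors [cm]
and [cq] make the basis orthonormal for the metric, which scales [Bg] by [s^-2]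
on m and by [t^-2] on q. *)
Definition cm : R := s / Num.sqrt (2 * D).
Definition cq : R := t / Num.sqrt (4 * D).

Lemma D_gt0 : 0 < D.
Proof.
have : 1 <= n%:R :> R by rewrite ler1n.
by move=> ?; lra.
Qed.

Lemma cm_sqr : cm ^+ 2 * (2 * D) = s ^+ 2.
Proof.
have D0 := D_gt0; have D2 : 0 < 2 * D by rewrite mulr_gt0.
by rewrite /cm expr_div_n sqr_sqrtr ?divfK // ?gt_eqF // ltW.
Qed.

Lemma cq_sqr : cq ^+ 2 * (4 * D) = t ^+ 2.
Proof.
have D0 := D_gt0; have D4 : 0 < 4 * D by rewrite mulr_gt0.
by rewrite /cq expr_div_n sqr_sqrtr ?divfK // ?gt_eqF // ltW.
Qed.

(* The last default is never met: [is_m] holds whenever [c.2] is [None]. *)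
Definition bas (c : idx) : Mx :=
  if is_m c then cm *: m_unit (m_idx c)
  else if c.2 is Some j then cq *: q_unit c.1 j else 0.
(** [eps c] is the inner product with [bas c], hence the coordinate along it on
m + q; it is defined on all matrices and vanishes on h. *)
Definition wt (c : idx) : R := if is_m c then (s ^+ 2)^-1 else (t ^+ 2)^-1.
Definition eps (c : idx) (X : Mx) : R := wt c * Bg X (bas c).

Lemma s2_neq0 : s ^+ 2 != 0. Proof. by rewrite expf_neq0 // gt_eqF. Qed.
Lemma t2_neq0 : t ^+ 2 != 0. Proof. by rewrite expf_neq0 // gt_eqF. Qed.
Lemma cm_neq0 : cm != 0.
Proof.
by apply/eqP => E; have := s2_neq0; rewrite -cm_sqr E expr0n mul0r eqxx.
Qed.
Lemma cq_neq0 : cq != 0.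
Proof.
by apply/eqP => E; have := t2_neq0; rewrite -cq_sqr E expr0n mul0r eqxx.
Qed.

Lemma m_idxP c : m_idx c != iz /\ m_idx c != io.
Proof. by case: c => i [j|]; split; rewrite /m_idx /ia /ib /iz /io ?eq_shift ?eqE. Qed.

Lemma in_m_unit k : k != iz -> k != io -> in_m (m_unit k).
Proof.
by move=> kz ko; apply: in_m_vec; rewrite mxE eq_sym (negbTE kz, negbTE ko).
Qed.

Lemma in_m_linear (c : R) (X Y : Mx) : in_m X -> in_m Y -> in_m (c *: X + Y).
Proof.
move=> [gX mX] [gY mY]; split; first exact: lie_g_linear.
by rewrite pm_linear mX mY.
Qed.

Lemma in_m0 : in_m (0 : Mx).
Proof. by split; [exact: lie_g0 | rewrite /pm mul0mx mulmx0 addr0]. Qed.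

Lemma in_mZ (c : R) (X : Mx) : in_m X -> in_m (c *: X).
Proof. by move=> mX; rewrite -[_ *: _]addr0; apply: in_m_linear => //; exact: in_m0. Qed.

Lemma in_qZ (c : R) (X : Mx) : in_q X -> in_q (c *: X).
Proof.
move=> [kX XJ]; split; first exact: lie_kZ.
by rewrite -scalemxAl -scalemxAr XJ scalerN.
Qed.

Lemma bas_m c : is_m c -> in_m (bas c).
Proof.
by move=> mc; rewrite /bas mc; apply: in_mZ; have [kz ko] := m_idxP c; exact: in_m_unit.
Qed.

Lemma bas_q c : ~~ is_m c -> in_q (bas c).
Proof.
move=> qc; rewrite /bas (negbTE qc); case: c qc => i [j|] //= _; apply: in_qZ.
rewrite /q_unit; case: ifP => _; [apply: in_q1 | apply: in_q2]; exact: tr_skew_unit.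
Qed.

Lemma bas_g c : lie_g (bas c).
Proof.
case: (boolP (is_m c)) => [/bas_m /in_m_g //|/bas_q /in_q_g //].
Qed.

Lemma eps_m c X : is_m c -> X^T = - X -> eps c X = X (m_idx c) iz / cm.
Proof.
move=> mc sX; rewrite /eps /wt /bas mc BgZr /m_unit Bg_m_vec //.
rewrite (bigD1 (m_idx c)) //= big1 => [|k kc]; last by rewrite mxE (negbTE kc) mul0r.
rewrite mxE !eqxx mul1r addr0 -cm_sqr.
by have D0 := D_gt0; have c0 := cm_neq0; field; rewrite c0 gt_eqF.
Qed.

Lemma eps_q i j (A B : 'M[R]_n) : i != j -> A^T = - A -> B^T = - B ->
  eps (i, Some j) (q1 A + q2 B) = (if (i < j)%N then A i j else B i j) / cq.
Proof.
move=> ij sA sB; rewrite /eps /wt /bas /is_m /= (negbTE ij) BgZr /q_unit.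
have [E1 E2] := Bg_q A B (skew_unit i j).
have D0 := D_gt0; have c0 := cq_neq0.
have [_|_] := ifP; rewrite ?E1 ?E2 trace_skew_unit // -cq_sqr;
by field; rewrite c0 gt_eqF.
Qed.

Lemma sum_idx (W : nmodType) (f : idx -> W) :
  \sum_c f c = \sum_i f (i, None) + \sum_i f (i, Some i)
              + \sum_i \sum_(j | j != i) f (i, Some j).
Proof.
rewrite (eq_bigr (fun c => f (c.1, c.2))); last by case.
rewrite -(pair_bigA _ (fun i o => f (i, o))) -!big_split /=.
apply: eq_bigr => i _; rewrite -addrA.
rewrite (bigD1 None) //=; congr (_ + _).
rewrite -(bigD1 i (P := xpredT)) //=.
rewrite (reindex_omap Some id) /=; last by case.
by apply: eq_bigl => j; rewrite eqxx.
Qed.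

End Scaled.
End Basis.

Section Orthonormality.
Context {R : realType} {n : nat}.
Local Notation Mx := (amb R n).
Local Notation Pz := (@Pz R n).
Local Notation ez := (@ez R n).
Local Notation V := 'cV[R]_((1 + n) + (1 + n)).
Local Notation D := (2 * n%:R - 1 : R).
Local Notation idx := ('I_n * option 'I_n)%type.
Variables (s t : R).
Hypothesis (n_gt0 : (0 < n)%N) (s_gt0 : 0 < s) (t_gt0 : 0 < t).
Local Notation bas := (@bas R n s t).
Local Notation eps := (@eps R n s t).
Local Notation cm := (@cm R n s).
Local Notation cq := (@cq R n t).

Lemma m_vec_ez (v : V) : v iz 0 = 0 -> m_vec v *m ez = v.
Proof.
move=> /ez_orth[_ E2].
by rewrite /m_vec mulmxBl -!mulmxA ez_ez E2 mulmx1 mulmx0 subr0.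
Qed.

Lemma m_unit_col k l : k != iz -> (m_unit k : Mx) l iz = (l == k)%:R.
Proof.
move=> kz; have E : m_unit k *m ez = delta_mx k 0.
  by apply: m_vec_ez; rewrite mxE eq_sym (negbTE kz).
by move/matrixP/(_ l 0): E; rewrite /ez -colE !mxE andbT.
Qed.

Lemma m_idx_inj (c c' : idx) : is_m c -> is_m c' -> (m_idx c == m_idx c') = (c == c').
Proof.
case: c => i [j|]; case: c' => i' [j'|];
  rewrite /is_m /m_idx /= /ia /ib ?eq_shift //.
- by move=> /eqP <- /eqP <-; apply/eqP/eqP => [->|[->]].
- by move=> _ _; rewrite xpair_eqE andbF.
- by move=> _ _; rewrite xpair_eqE andbF.
- by move=> _ _; rewrite xpair_eqE eqxx andbT.
Qed.

Lemma skew_unitE (i j k l : 'I_n) :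
  skew_unit i j k l = ((k == i) && (l == j))%:R - ((k == j) && (l == i))%:R :> R.
Proof. by rewrite /skew_unit !mxE. Qed.

Lemma q1_0 : q1 0 = 0 :> Mx.
Proof. by rewrite /q1 oppr0 /blocks24 !block_mx0. Qed.

Lemma q2_0 : q2 0 = 0 :> Mx.
Proof. by rewrite /q2 /blocks24 !block_mx0. Qed.

Lemma q1_linear c (S S' : 'M[R]_n) : q1 (c *: S + S') = c *: q1 S + q1 S'.
Proof. by rewrite /q1 blocks24Z blocks24D !scaler0 !addr0 scalerN opprD. Qed.

Lemma q2_linear c (S S' : 'M[R]_n) : q2 (c *: S + S') = c *: q2 S + q2 S'.
Proof. by rewrite /q2 blocks24Z blocks24D !scaler0 !addr0. Qed.

Lemma q1Z c (S : 'M[R]_n) : q1 (c *: S) = c *: q1 S.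
Proof. by rewrite -[in LHS](addr0 (c *: S)) q1_linear q1_0 addr0. Qed.

Lemma q2Z c (S : 'M[R]_n) : q2 (c *: S) = c *: q2 S.
Proof. by rewrite -[in LHS](addr0 (c *: S)) q2_linear q2_0 addr0. Qed.

Lemma bas_orthonormal (c c' : idx) : eps c (bas c') = (c == c')%:R.
Proof.
have cm0 := cm_neq0 n_gt0 s_gt0; have cq0 := cq_neq0 n_gt0 t_gt0.
case: (boolP (is_m c)) (boolP (is_m c')) => [mc|qc] [mc'|qc'].
- rewrite eps_m //; last exact: lie_g_skew (bas_g _ _ _).
  have [kz _] := m_idxP c'.
  by rewrite /bas mc' scalemxE (m_unit_col _ kz) m_idx_inj // mulrC mulKf.
- rewrite /eps Bg_qm ?mulr0; [|exact: bas_q|exact: bas_m].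
  by case: eqVneq qc' => // <-; rewrite mc.
- rewrite /eps Bg_mq ?mulr0; [|exact: bas_m|exact: bas_q].
  by case: eqVneq qc => // ->; rewrite mc'.
case: c qc => i [j|] // ij; case: c' qc' => i' [j'|] // ij'.
rewrite /is_m /= in ij ij'.
pose A := if (i' < j')%N then cq *: skew_unit i' j' else 0.
pose B := if (i' < j')%N then 0 else cq *: skew_unit i' j'.
have sS := tr_skew_unit i' j' : (skew_unit i' j' : 'M[R]_n)^T = _.
have sA : A^T = - A by rewrite /A; case: ifP; rewrite ?linearZ /= ?sS ?scalerN ?trmx0 ?oppr0.
have sB : B^T = - B by rewrite /B; case: ifP; rewrite ?linearZ /= ?sS ?scalerN ?trmx0 ?oppr0.
have -> : bas (i', Some j') = q1 A + q2 B.
  rewrite /bas /is_m /= (negbTE ij') /q_unit /A /B.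
  by case: ifP => _; rewrite ?q1_0 ?q2_0 ?addr0 ?add0r ?q1Z ?q2Z.
rewrite eps_q // xpair_eqE /A /B.
have -> : (Some j == Some j') = (j == j') by [].
have [lt_eq|lt_neq] := eqVneq (i < j)%N (i' < j')%N.
  have swap : (i == j') && (j == i') = false.
    apply/negP => /andP[/eqP E1 /eqP E2]; move: lt_eq ij.
    by rewrite E1 E2; case: ltngtP => // /val_inj -> _; rewrite eqxx.
  have -> : (if (i < j)%N then A i j else B i j) = cq * skew_unit i' j' i j.
    by rewrite lt_eq /A /B; case: (i' < j')%N; rewrite scalemxE.
  by rewrite skew_unitE swap subr0 mulrC mulKf.
have -> : (i == i') && (j == j') = false.
  by apply/negP => /andP[/eqP E1 /eqP E2]; move: lt_neq; rewrite E1 E2 eqxx.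
rewrite /A /B; case: (i < j)%N (i' < j')%N lt_neq => [] [] //= _; by rewrite mxE mul0r.
Qed.

(** ** Completeness *)

Lemma in_m_m_vec (X : Mx) : in_m X -> X = m_vec (X *m ez).
Proof.
move=> [gX EX]; have sX := lie_g_skew gX.
rewrite -{1}EX /pm /m_vec PzE mulmxA trmx_mul sX mulmxN mulmxN opprK.
by rewrite mulmxA.
Qed.

Lemma m_vec_linear c (v w : V) : m_vec (c *: v + w) = c *: m_vec v + m_vec w.
Proof.
rewrite /m_vec mulmxDl -scalemxAl linearD linearZ /= mulmxDr -scalemxAr.
by rewrite opprD addrACA scalerBr.
Qed.

Lemma m_vec0 : m_vec 0 = 0 :> Mx.
Proof. by rewrite /m_vec mul0mx trmx0 mulmx0 subr0. Qed.

Lemma m_vec_sum (T : Type) (r : seq T) (f : T -> R) (v : T -> V) :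
  m_vec (\sum_(k <- r) f k *: v k) = \sum_(k <- r) f k *: m_vec (v k).
Proof.
elim: r => [|k r IH]; first by rewrite !big_nil m_vec0.
by rewrite !big_cons m_vec_linear IH.
Qed.

Lemma bas_complete_m (X : Mx) : in_m X -> \sum_c eps c X *: bas c = X.
Proof.
move=> mX; have gX := in_m_g mX; have sX := lie_g_skew gX.
have cm0 := cm_neq0 n_gt0 s_gt0.
have [_ /mul_delta_col0P Xo] := (lie_gP X).1 gX.
have E0 c : is_m c -> eps c X *: bas c = X (m_idx c) iz *: m_unit (m_idx c).
  by move=> mc; rewrite eps_m // /bas mc scalerA divfK.
rewrite sum_idx [X in _ + X]big1 => [|i _]; last first.
  rewrite big1 // => j ij; rewrite /eps Bg_mq ?mulr0 ?scale0r //.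
  by apply: bas_q; rewrite /is_m /= eq_sym.
rewrite addr0 [in RHS](in_m_m_vec mX).
have -> : X *m ez = \sum_k X k iz *: delta_mx k 0.
  rewrite /ez -colE; apply/matrixP => k l; rewrite ord1 summxE mxE (bigD1 k) //=.
  rewrite big1 => [|k' kk']; last by rewrite !mxE eq_sym (negbTE kk') mulr0.
  by rewrite !mxE !eqxx mulr1 addr0.
rewrite m_vec_sum sum_index -!/(m_unit _).
rewrite (skew_entry io iz sX) Xo (skew_diag iz sX) oppr0 !scale0r !add0r addrC.
congr (_ + _); apply: eq_bigr => i _; rewrite E0 //=.
by rewrite /is_m /=.
Qed.

(** With [f] supported above or below the diagonal, this rebuilds a skew matrix
from half of its entries. *)
Lemma sum_skew_unit (f : 'I_n -> 'I_n -> R) :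
  \sum_i \sum_(j | j != i) f i j *: skew_unit i j =
  (\matrix_(i, j) f i j) - (\matrix_(i, j) f i j)^T.
Proof.
rewrite [X in X - _]matrix_sum_delta [X in X^T]matrix_sum_delta.
rewrite linear_sum -sumrB; apply: eq_bigr => i _.
rewrite linear_sum -sumrB [RHS](bigD1 i) //= linearZ /= trmx_delta subrr add0r.
apply: eq_bigr => j _; rewrite linearZ /= trmx_delta mxE.
by rewrite -scalerBr.
Qed.

Lemma q1_sum (T : Type) (r : seq T) (P : pred T) (S : T -> 'M[R]_n) :
  q1 (\sum_(k <- r | P k) S k) = \sum_(k <- r | P k) q1 (S k).
Proof.
by apply: (big_morph _ _ q1_0) => A B; rewrite -[A]scale1r q1_linear !scale1r.
Qed.

Lemma q2_sum (T : Type) (r : seq T) (P : pred T) (S : T -> 'M[R]_n) :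
  q2 (\sum_(k <- r | P k) S k) = \sum_(k <- r | P k) q2 (S k).
Proof.
by apply: (big_morph _ _ q2_0) => A B; rewrite -[A]scale1r q2_linear !scale1r.
Qed.

Lemma bas_complete_q (X : Mx) : in_q X -> \sum_c eps c X *: bas c = X.
Proof.
move=> qX; have cq0 := cq_neq0 n_gt0 t_gt0.
have E0 c : is_m c -> eps c X *: bas c = 0.
  by move=> mc; rewrite /eps (Bg_qm qX (bas_m _ _ mc)) mulr0 scale0r.
rewrite sum_idx [X in X + _ + _]big1 => [|i _]; last exact: E0.
rewrite [X in _ + X + _]big1 => [|i _]; last by apply: E0; rewrite /is_m /=.
rewrite !add0r.
have [A [B [-> sA sB]]] := in_q_blocks qX.
pose f (i j : 'I_n) := if (i < j)%N then A i j else 0.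
pose g (i j : 'I_n) := if (i < j)%N then 0 else B i j.
transitivity (\sum_i \sum_(j | j != i)
  (q1 (f i j *: skew_unit i j) + q2 (g i j *: skew_unit i j))).
  apply: eq_bigr => i _; apply: eq_bigr => j; rewrite eq_sym => ij.
  rewrite eps_q // /bas /is_m /= (negbTE ij) scalerA divfK // /q_unit /f /g.
  by case: ifP => _; rewrite scale0r ?q1_0 ?q2_0 ?addr0 ?add0r ?q1Z ?q2Z.
under eq_bigr do rewrite big_split -q1_sum -q2_sum.
rewrite big_split -q1_sum -q2_sum !sum_skew_unit; congr (q1 _ + q2 _).
  apply/matrixP => k l; rewrite !mxE /f; case: ltngtP => [_|_|/val_inj ->].
  - by rewrite subr0.
  - by rewrite sub0r [RHS](skew_entry _ _ sA).
  - by rewrite (skew_diag _ sA) subr0.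
apply/matrixP => k l; rewrite !mxE /g; case: ltngtP => [_|_|/val_inj ->].
- by rewrite sub0r [RHS](skew_entry _ _ sB).
- by rewrite subr0.
- by rewrite (skew_diag _ sB) subr0.
Qed.

Lemma epsD c (X Y : Mx) : eps c (X + Y) = eps c X + eps c Y.
Proof. by rewrite /eps BgDl mulrDr. Qed.

Lemma eps_h c (X : Mx) : lie_h X -> eps c X = 0.
Proof.
move=> hX; rewrite /eps Bg_sym; case: (boolP (is_m c)) => [mc|qc].
  by rewrite (Bg_mh (bas_m _ _ mc) hX) mulr0.
by rewrite (Bg_qh (bas_q _ _ qc) hX) mulr0.
Qed.

Lemma bas_complete (X : Mx) : lie_g X -> \sum_c eps c X *: bas c = pm X + pq X.
Proof.
move=> gX; rewrite -[in RHS](bas_complete_m (pm_in gX)).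
rewrite -[X in _ = _ + X](bas_complete_q (pq_in gX)) -big_split.
apply: eq_bigr => c _; rewrite {1}(pmqh_sum X) !epsD (eps_h c (ph_in gX)) addr0.
by rewrite scalerDl.
Qed.

Lemma ip_eps (X Y : Mx) : lie_g X -> lie_g Y ->
  ip s t X Y = \sum_c eps c X * eps c Y.
Proof.
move=> gX gY; rewrite (ipE n_gt0) //.
have Em c : is_m c -> eps c Y = (s ^+ 2)^-1 * Bg (bas c) (pm Y).
  by move=> mc; rewrite /eps /wt mc (Bg_pm gY (bas_m _ _ mc)) Bg_sym.
have Eq c : ~~ is_m c -> eps c Y = (t ^+ 2)^-1 * Bg (bas c) (pq Y).
  by move=> qc; rewrite /eps /wt (negbTE qc) (Bg_pq gY (bas_q _ _ qc)) Bg_sym.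
have mY := pm_in gY; have qY := pq_in gY.
have -> : Bg (pm X) (pm Y) = Bg (\sum_c eps c X *: bas c) (pm Y).
  by rewrite bas_complete // BgDl (Bg_qm (pq_in gX) mY) addr0.
have -> : Bg (pq X) (pq Y) = Bg (\sum_c eps c X *: bas c) (pq Y).
  by rewrite bas_complete // BgDl (Bg_mq (pm_in gX) qY) add0r.
rewrite !Bg_suml !mulr_sumr -big_split; apply: eq_bigr => c _ /=.
rewrite !BgZl mulrCA [X in _ + X]mulrCA -mulrDr; congr (_ * _).
case: (boolP (is_m c)) => [mc|qc].
  by rewrite (Em c mc) (Bg_mq (bas_m _ _ mc) qY) mulr0 addr0.
by rewrite (Eq c qc) (Bg_qm (bas_q _ _ qc) mY) mulr0 add0r.
Qed.

(** This is how the immersion condition on charts becomes the invertibility of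
their frame. *)
Lemma eps_inj (X : Mx) : lie_g X -> (forall c, eps c X = 0) -> lie_h X.
Proof.
move=> gX X0; have E := bas_complete gX.
rewrite big1 in E => [|c _]; last by rewrite X0 scale0r.
by rewrite (pmqh_sum X) -E add0r; exact: ph_in.
Qed.

End Orthonormality.

(** * The Casimir sum and the Ricci curvature of a direction in m *)

Section Sums.
Context {R : realType} {n : nat}.
Local Notation Mx := (amb R n).
Local Notation Pz := (@Pz R n).
Local Notation ez := (@ez R n).
Local Notation V := 'cV[R]_((1 + n) + (1 + n)).
Local Notation D := (2 * n%:R - 1 : R).
Local Notation idx := ('I_n * option 'I_n)%type.
Variables (s t : R).
Hypothesis (n_gt0 : (0 < n)%N) (s_gt0 : 0 < s) (t_gt0 : 0 < t).
Local Notation bas := (@bas R n s t).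
Local Notation eps := (@eps R n s t).
Local Notation cm := (@cm R n s).
Local Notation cq := (@cq R n t).

Lemma bas_q_ez (c : idx) : ~~ is_m c -> bas c *m ez = 0.
Proof. by move=> qc; have /in_q_k /lie_kP[] := bas_q s t qc. Qed.

Lemma bas_sqr_ez (c : idx) :
  bas c *m (bas c *m ez) = (if is_m c then - cm ^+ 2 else 0) *: ez.
Proof.
case: (boolP (is_m c)) => [mc|/bas_q_ez ->]; last by rewrite mulmx0 scale0r.
have [kz _] := m_idxP c; rewrite /bas mc; move: (m_idx c) kz => k kz.
have dz : (delta_mx k 0 : V) iz 0 = 0 by rewrite mxE eq_sym (negbTE kz).
have [E _] := ez_orth dz.
rewrite -!scalemxAl -scalemxAr scalerA -expr2 /m_unit (m_vec_ez dz) /m_vec.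
rewrite mulmxBl -!mulmxA E mulmx0 sub0r trmx_delta mul_delta_mx.
have -> : delta_mx 0 0 = 1%:M :> 'M[R]_1.
  by apply/matrixP => i j; rewrite !ord1 !mxE.
by rewrite mulmx1 scalerN scaleNr.
Qed.

(** Basis elements of q annihilate [ez], and each of the [2 n] elements of m in
the basis squares to [- cm^2] on it. *)
Lemma casimir_ez : \sum_c bas c *m (bas c *m ez) = - (2 * n%:R * cm ^+ 2) *: ez.
Proof.
rewrite (eq_bigr _ (fun c _ => bas_sqr_ez c)) -scaler_suml sum_idx.
congr (_ *: _); rewrite [X in _ + X]big1 => [|i _]; last first.
  by rewrite big1 // => j; rewrite eq_sym /is_m /= => /negbTE ->.
have -> : \sum_(i < n) (if is_m (i, Some i) then - cm ^+ 2 else 0) =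
          \sum_(i < n) (- cm ^+ 2).
  by apply: eq_bigr => i _; rewrite /is_m /= eqxx.
by rewrite /is_m /= !sumr_const card_ord -mulr_natr; ring.
Qed.

(** ** Brackets with a unit vector of m *)

Lemma brk_k_unit (W : Mx) k : lie_k W ->
  brk W (m_unit k) = m_vec (W *m (delta_mx k 0 : V)).
Proof.
move=> kW; have sW := lie_g_skew (lie_k_g kW).
have [_ Wz] := (lie_kP W).1 kW.
have zW : ez^T *m W = 0.
  by apply: trmx_inj; rewrite trmx_mul trmxK sW mulNmx Wz oppr0 trmx0.
rewrite /brk /m_unit /m_vec mulmxBr mulmxBl !mulmxA Wz mul0mx subr0.
rewrite -[_ *m ez^T *m W]mulmxA zW mulmx0 sub0r trmx_mul sW mulmxN opprK mulmxN.
by rewrite opprK mulmxA.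
Qed.

Lemma Bg_m_vec_sqr (v : V) : v iz 0 = 0 -> v io 0 = 0 ->
  Bg (m_vec v) (m_vec v) = 2 * D * \sum_k v k 0 ^+ 2.
Proof.
move=> vz vo; have mv := in_m_vec vz vo.
rewrite Bg_m_vec ?(lie_g_skew (in_m_g mv)) //; congr (_ * _).
apply: eq_bigr => k _; rewrite expr2; congr (_ * _).
by have /matrixP/(_ k 0) := m_vec_ez vz; rewrite /ez -colE mxE.
Qed.

(** k acts on m as on column vectors, so the bracket with [m_unit k] sees the
[k]-th column only. *)
Lemma Bg_brk_k_unit (W : Mx) k : lie_k W ->
  Bg (brk W (m_unit k)) (brk W (m_unit k)) = 2 * D * \sum_l W l k ^+ 2.
Proof.
move=> kW; have sW := lie_g_skew (lie_k_g kW).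
have [gW /mul_delta_col0P Wz] := (lie_kP W).1 kW.
have [_ /mul_delta_col0P Wo] := (lie_gP W).1 gW.
rewrite brk_k_unit // Bg_m_vec_sqr -?colE ?mxE ?(skew_entry _ k sW) ?Wz ?Wo ?oppr0 //.
by congr (_ * _); apply: eq_bigr => l _; rewrite mxE.
Qed.

Lemma Bg_brk_unit_unit k l : k != iz -> l != iz -> k != l ->
  Bg (brk (m_unit k) (m_unit l) : Mx) (brk (m_unit k) (m_unit l)) = 2 * D.
Proof.
move=> kz lz kl.
have E a b : a != iz -> b != iz -> a != b ->
    m_unit a *m m_unit b = - delta_mx a b :> Mx.
  move=> az bz ab; rewrite /m_unit /m_vec /ez !trmx_delta !mul_delta_mx.
  rewrite mulmxBl !mulmxBr !mul_delta_mx_cond eqxx (negbTE ab) (negbTE az).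
  by rewrite eq_sym (negbTE bz) !mulr0n !mulr1n !subr0 sub0r.
have lk : l != k by rewrite eq_sym.
rewrite /brk (E _ _ kz lz kl) (E _ _ lz kz lk) opprK addrC.
rewrite /Bg mulmxBl !mulmxBr !mul_delta_mx_cond !eqxx (negbTE kl) (negbTE lk).
rewrite !mulr0n !mulr1n !subr0 sub0r !(raddfB (@mxtrace R _)) /=.
have tr1 (a : 'I_((1 + n) + (1 + n))) : \tr (delta_mx a a : Mx) = 1.
  by rewrite -[delta_mx a a]mul1mx trace_mul_delta mxE eqxx.
by rewrite (raddfN (@mxtrace R _)) /= !tr1; ring.
Qed.

Lemma sum_skew_unit_col (i j i0 : 'I_n) : i != j ->
  \sum_l (skew_unit i j l i0 : R) ^+ 2 = (i0 == j)%:R + (i0 == i)%:R.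
Proof.
move=> ij.
have E (l : 'I_n) : (skew_unit i j l i0 : R) ^+ 2 =
    (l == i)%:R * (i0 == j)%:R + (l == j)%:R * (i0 == i)%:R.
  rewrite skew_unitE; have [li|li] := eqVneq l i; have [lj|lj] := eqVneq l j => /=.
  - by move: ij; rewrite -li lj eqxx.
  - by case: (i0 == j); rewrite ?mulr0n ?mulr1n; ring.
  - by case: (i0 == i); rewrite ?mulr0n ?mulr1n; ring.
  - by ring.
rewrite (eq_bigr _ (fun l _ => E l)) big_split -!mulr_suml /=.
have S1 (k : 'I_n) : \sum_(l < n) ((l == k)%:R : R) = 1.
  by rewrite (bigD1 k) //= eqxx big1 ?addr0 // => l /negbTE ->.
by rewrite !S1 !mul1r.
Qed.

Variable i0 : 'I_n.
Local Notation y := (bas (i0, Some i0)).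
Local Notation bracket_norm c := (Bg (brk (bas c) y) (brk (bas c) y)).

Lemma y_unit : y = cm *: m_unit (ia i0).
Proof. by rewrite /bas /is_m /= eqxx. Qed.

Lemma bracket_norm_m (c : idx) : is_m c ->
  bracket_norm c = (c != (i0, Some i0))%:R * (cm ^+ 4 * (2 * D)).
Proof.
move=> mc; have [->|cc0] := eqVneq.
  by rewrite /brk subrr /Bg mulmx0 mxtrace0 mulr0 mul0r.
have m0 : is_m (i0, Some i0) by rewrite /is_m /=.
have [kz _] := m_idxP c; have [lz _] := m_idxP (i0, Some i0).
have kl := m_idx_inj mc m0; rewrite (negbTE cc0) in kl.
rewrite y_unit /bas mc brkZl brkZr !BgZl !BgZr Bg_brk_unit_unit ?kl //.
by rewrite mulr1n mul1r; ring.
Qed.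

Lemma bracket_norm_q (i j : 'I_n) : i != j -> bracket_norm (i, Some j) =
  ((i0 == j)%:R + (i0 == i)%:R) * (cm ^+ 2 * cq ^+ 2 * (2 * D)).
Proof.
move=> ij; have qc : ~~ is_m (i, Some j) by [].
have kq : lie_k (q_unit i j : Mx).
  by rewrite /q_unit; case: ifP => _; apply: in_q_k;
    [apply: in_q1 | apply: in_q2]; exact: tr_skew_unit.
have -> : bas (i, Some j) = cq *: q_unit i j by rewrite /bas /is_m /= (negbTE ij).
rewrite y_unit brkZl brkZr !BgZl !BgZr Bg_brk_k_unit //.
suff -> : \sum_l (q_unit i j : Mx) l (ia i0) ^+ 2 = (i0 == j)%:R + (i0 == i)%:R by ring.
rewrite -(sum_skew_unit_col i0 ij) sum_index /q_unit.
have [_|_] := ifP.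
  have [E1 E2] := blocks24_entries (skew_unit i j : 'M[R]_n) 0 0 (- skew_unit i j).
  have [_ _ Eo Ez] := E2 (ia i0).
  rewrite /q1 Eo Ez expr0n add0r add0r [X in _ + X]big1 ?addr0.
    by apply: eq_bigr => k _; have [->] := E1 k i0.
  by move=> k _; have [_ _ -> _] := E1 k i0; rewrite mxE expr0n.
have [E1 E2] := blocks24_entries 0 (skew_unit i j : 'M[R]_n) (skew_unit i j) 0.
have [_ _ Eo Ez] := E2 (ia i0).
rewrite /q2 Eo Ez expr0n !add0r [X in X + _]big1 ?add0r.
  by apply: eq_bigr => k _; have [_ _ -> _] := E1 k i0.
by move=> k _; have [-> _ _ _] := E1 k i0; rewrite mxE expr0n.
Qed.

(** All [2 n] basis elements of m but [y] itself contribute equally. *)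
Lemma sum_bracket_norm_m :
  \sum_(c | is_m c) bracket_norm c = D * (cm ^+ 4 * (2 * D)).
Proof.
rewrite big_mkcond sum_idx /= [X in _ + X]big1 => [|i _]; last first.
  by rewrite big1 // => j; rewrite eq_sym /is_m /= => /negbTE ->.
have -> : \sum_(i < n) (if is_m (i, None) then bracket_norm (i, None) else 0) =
    \sum_(i < n) (cm ^+ 4 * (2 * D)).
  apply: eq_bigr => i _; rewrite /is_m /= bracket_norm_m // xpair_eqE andbF.
  by rewrite mul1r.
have -> : \sum_(i < n) (if is_m (i, Some i) then bracket_norm (i, Some i) else 0) =
    \sum_(i < n | i != i0) (cm ^+ 4 * (2 * D)).
  rewrite [RHS]big_mkcond; apply: eq_bigr => i _.
  have mi : is_m (i, Some i) by rewrite /is_m /=.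
  rewrite mi bracket_norm_m //.
  have -> : ((i, Some i) == (i0, Some i0)) = (i == i0).
    by rewrite xpair_eqE -[Some i == Some i0]/(i == i0) andbb.
  by case: (i == i0); rewrite ?mul1r ?mul0r.
have E : \sum_(i < n) (cm ^+ 4 * (2 * D)) = n%:R * (cm ^+ 4 * (2 * D)).
  by rewrite sumr_const card_ord [RHS]mulr_natl.
have E' : \sum_(i < n | i != i0) (cm ^+ 4 * (2 * D)) = (n%:R - 1) * (cm ^+ 4 * (2 * D)).
  apply: (addrI (cm ^+ 4 * (2 * D))).
  by rewrite -[LHS](bigD1 i0 (P := xpredT) (F := fun=> cm ^+ 4 * (2 * D))) //= E; ring.
by rewrite E E' addr0; ring.
Qed.

(** The elements of q in the basis that do not annihilate [ia i0] are those with
index [i0] in one of their two places: [n - 1] in each of the two families,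
counted once for either position of [i0]. *)
Lemma sum_bracket_norm_q : \sum_(c | ~~ is_m c) bracket_norm c =
  2 * (n%:R - 1) * (cm ^+ 2 * cq ^+ 2 * (2 * D)).
Proof.
rewrite big_mkcond sum_idx /= [X in X + _ + _]big1 ?add0r //.
rewrite [X in X + _]big1 ?add0r => [|i _]; last by rewrite /is_m /= eqxx.
transitivity (\sum_(i < n) \sum_(j < n | j != i)
  ((i0 == j)%:R + (i0 == i)%:R) * (cm ^+ 2 * cq ^+ 2 * (2 * D))).
  apply: eq_bigr => i _; apply: eq_bigr => j; rewrite eq_sym => ij.
  by rewrite /is_m /= ij bracket_norm_q.
under eq_bigr do rewrite -mulr_suml; rewrite -mulr_suml; congr (_ * _).
under eq_bigr do rewrite big_split /=; rewrite big_split /=.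
have card1 (k : 'I_n) : \sum_(j < n | j != k) (1 : R) = n%:R - 1.
  have : \sum_(j < n) (1 : R) = n%:R by rewrite sumr_const card_ord.
  by rewrite (bigD1 k) //= => <-; rewrite addrC addrK.
have -> : \sum_(i < n) \sum_(j < n | j != i) ((i0 == i)%:R : R) = n%:R - 1.
  rewrite (bigD1 i0) //= eqxx card1 big1 ?addr0 // => i ii0.
  by rewrite big1 // => j _; rewrite eq_sym (negbTE ii0).
have -> : \sum_(i < n) \sum_(j < n | j != i) ((i0 == j)%:R : R) = n%:R - 1.
  rewrite -(card1 i0) [RHS]big_mkcond; apply: eq_bigr => i _.
  have [->|ii0] := eqVneq i i0.
    by rewrite big1 // => j /negbTE; rewrite eq_sym => ->.
  rewrite (bigD1 i0) 1?eq_sym //= eqxx big1 ?addr0 // => j /andP[_].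
  by rewrite eq_sym => /negbTE ->.
ring.
Qed.

End Sums.

Section RicciDirection.
Context {R : realType} {n : nat}.
Local Notation Mx := (amb R n).
Local Notation D := (2 * n%:R - 1 : R).
Local Notation idx := ('I_n * option 'I_n)%type.
Variables (s t : R).
Hypothesis (n_gt0 : (0 < n)%N) (s_gt0 : 0 < s) (t_gt0 : 0 < t).
Local Notation bas := (@bas R n s t).
Local Notation eps := (@eps R n s t).
Local Notation cm := (@cm R n s).
Local Notation cq := (@cq R n t).
Local Notation kap := (s ^+ 2 / (2 * t ^+ 2)).
Local Notation Lam := (lc_form kap).

Lemma Bg0l (Y : Mx) : Bg 0 Y = 0.
Proof. by rewrite /Bg mul0mx mxtrace0 mulr0. Qed.

Lemma brk0l (Y : Mx) : brk 0 Y = 0.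
Proof. by rewrite /brk mul0mx mulmx0 subrr. Qed.

Lemma brk0r (X : Mx) : brk X 0 = 0.
Proof. by rewrite /brk mul0mx mulmx0 subrr. Qed.

Lemma brkxx (X : Mx) : brk X X = 0.
Proof. exact: subrr. Qed.

Lemma parseval (X : Mx) : in_m X \/ in_q X ->
  Bg X X = \sum_c wt s t c * Bg X (bas c) ^+ 2.
Proof.
move=> mqX; have {1}-> : X = \sum_c eps c X *: bas c.
  by case: mqX => [mX|qX]; [rewrite bas_complete_m | rewrite bas_complete_q].
rewrite Bg_suml; apply: eq_bigr => c _.
by rewrite BgZl /eps (Bg_sym (bas c)) expr2 mulrA.
Qed.

Lemma Bg_brk_norm (X Y : Mx) : Bg (brk Y (brk X Y)) X = Bg (brk X Y) (brk X Y).
Proof. by rewrite (brkN Y) BgNl Bg_brk (brkN Y) BgNr opprK. Qed.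

Variables (y : Mx).
Hypothesis my : in_m y.

Lemma lc_form_yy : Lam y y = 0.
Proof.
rewrite (lc_form_m _ _ my) (pq_m my) (ph_m my) my.2.
by rewrite brkxx brk0l !scaler0 !addr0.
Qed.

(** The two curvature lemmas evaluate the sectional terms of the Ricci sum at
[y], first for [e] in m, then for [e] in q. Invariance of [Bg] turns each term
into the squared norm of a component of [[e, y]]. *)
Lemma curvature_m (e : Mx) : in_m e ->
  - Bg (Lam (brk e y) y) e - Bg (Lam y (Lam e y)) e =
  Bg (brk e y) (brk e y) - 3 / 2 * kap * Bg (pq (brk e y)) (pq (brk e y)).
Proof.
move=> me; have kW := lie_k_brk_mm me my.
have [W defW] : exists W, brk e y = W by eexists.
rewrite defW in kW *.
have gW := lie_k_g kW; have qW := pq_in gW; have hW := ph_in gW.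
have WE : W = pq W + ph W by rewrite {1}(pmqh_sum W) (pm_k kW) add0r.
have E (A : Mx) : Bg (brk A y) e = - Bg A W by rewrite Bg_brk (brkN y) defW BgNr.
have Eq : Bg (pq W) W = Bg (pq W) (pq W).
  by rewrite {2}WE BgDr (Bg_qh qW hW) addr0.
have Eh : Bg (ph W) W = Bg W W - Bg (pq W) (pq W).
  have -> : Bg W W = Bg (pq W) W + Bg (ph W) W by rewrite {1}WE (BgDl (pq W) (ph W)).
  by rewrite Eq addrC addKr.
have E1 : Bg (Lam W y) e = - ((1 - kap) * Bg (pq W) (pq W) + Bg (ph W) W).
  rewrite (lc_form_m _ _ my) (pm_k kW) Bg_comb2 (E 0) (E (pq W)) (E (ph W)) Eq.
  by rewrite Bg0l oppr0 mulr0 add0r mulrN opprD.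
have E2 : Lam e y = 2^-1 *: W.
  rewrite (lc_form_m _ _ my) (pq_m me) (ph_m me) me.2 defW.
  by rewrite !brk0l scaler0 !addr0.
have E3 : Bg (Lam y (2^-1 *: W)) e = 2^-1 * kap * Bg (pq W) (pq W).
  have -> : Lam y (2^-1 *: W) = (2^-1 * kap) *: brk y (pq W).
    have E0 : Lam y W = kap *: brk y (pq W).
      rewrite /lc_form (pm_k kW) (pq_m my) (ph_m my) my.2 brk0r !brk0l.
      by rewrite !scaler0 !addr0 add0r.
    have E00 : Lam y 0 = 0.
      by rewrite /lc_form (pm_k lie_k0) (pq_h lie_h0) !addr0 !brk0r !scaler0 !addr0.
    by rewrite -[2^-1 *: W]addr0 lc_form_linearr E0 E00 addr0 scalerA.
  by rewrite BgZl (brkN y) BgNl E opprK Eq.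
apply: (etrans (congr2 (fun a b => - a - b) E1
  (etrans (congr1 (fun Z => Bg (Lam y Z) e) E2) E3))).
by rewrite Eh; field; rewrite gt_eqF.
Qed.

Lemma curvature_q (e : Mx) : in_q e ->
  - Bg (Lam (brk e y) y) e - Bg (Lam y (Lam e y)) e =
  2^-1 * kap * Bg (brk e y) (brk e y).
Proof.
move=> qe; have mW := in_m_brk_km (in_q_k qe) my.
have nW := Bg_brk_norm e y.
have [W defW] : exists W, brk e y = W by eexists.
rewrite defW in mW nW *.
have E1 : Lam W y = 2^-1 *: brk W y.
  rewrite (lc_form_m _ _ my) (pq_m mW) (ph_m mW) mW.2.
  by rewrite !brk0l scaler0 !addr0.
have E2 : Lam e y = (1 - kap) *: W.
  rewrite (lc_form_m _ _ my) (pq_q qe) (ph_q qe) (pm_k (in_q_k qe)) defW.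
  by rewrite !brk0l scaler0 addr0 add0r.
have E3 : Lam y ((1 - kap) *: W) = ((1 - kap) / 2) *: brk y W.
  rewrite (lc_form_m _ _ (in_mZ _ mW)) (pq_m my) (ph_m my) my.2 brkZr scalerA.
  by rewrite !brk0l scaler0 !addr0 mulrC.
apply: (etrans (congr2 (fun A B => - Bg A e - Bg B e) E1
  (etrans (congr1 (Lam y) E2) E3))).
rewrite !BgZl nW (brkN W) BgNl nW.
by field; rewrite gt_eqF.
Qed.

(** The trace of the curvature [R(e, y) y] of the connection form. *)
Definition ricci_dir : R := \sum_c (- eps c (Lam (brk (bas c) y) y)
  + eps c (Lam (bas c) (Lam y y)) - eps c (Lam y (Lam (bas c) y))).

Local Notation norm2 X := (Bg X X).

(** By Parseval and the invariance of [Bg], both sides are the sum of the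
squares of [Bg [e, y] f] over the basis elements [e] of m and [f] of q. *)
Lemma sum_pq_bracket :
  \sum_(c | is_m c) (s ^+ 2)^-1 * norm2 (pq (brk (bas c) y)) =
  (t ^+ 2)^-1 * \sum_(c | ~~ is_m c) norm2 (brk (bas c) y).
Proof.
transitivity (\sum_(c | is_m c) \sum_(c' | ~~ is_m c')
    (s ^+ 2)^-1 * (t ^+ 2)^-1 * Bg (brk (bas c) y) (bas c') ^+ 2).
  apply: eq_bigr => c mc; have gW := lie_g_brk (bas_g s t c) (in_m_g my).
  rewrite (parseval (or_intror (pq_in gW))) (bigID (@is_m n)) /= big1 ?add0r.
    rewrite mulr_sumr; apply: eq_bigr => c' qc'.
    by rewrite /wt (negbTE qc') mulrA (Bg_pq gW (bas_q s t qc')).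
  by move=> c' mc'; rewrite (Bg_qm (pq_in gW) (bas_m s t mc')) expr0n mulr0.
rewrite exchange_big mulr_sumr; apply: eq_bigr => c' qc' /=.
have mW := in_m_brk_km (in_q_k (bas_q s t qc')) my.
rewrite (parseval (or_introl mW)) [in RHS](bigID (@is_m n)) /= [X in _ + X]big1 ?addr0.
  rewrite mulr_sumr; apply: eq_bigr => c mc; rewrite /wt mc.
  have -> : Bg (brk (bas c) y) (bas c') = - Bg (brk (bas c') y) (bas c).
    by rewrite Bg_brk (brkN y) BgNr Bg_sym.
  by rewrite sqrrN [RHS]mulrCA mulrA.
by move=> c qc; rewrite (Bg_mq mW (bas_q s t qc)) expr0n mulr0.
Qed.

Lemma ricci_dirE : ricci_dir =
  (s ^+ 2)^-1 * (\sum_(c | is_m c) norm2 (brk (bas c) y))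
  - kap * (t ^+ 2)^-1 * \sum_(c | ~~ is_m c) norm2 (brk (bas c) y).
Proof.
transitivity (\sum_(c | is_m c) ((s ^+ 2)^-1 * norm2 (brk (bas c) y)
    - 3 / 2 * kap * ((s ^+ 2)^-1 * norm2 (pq (brk (bas c) y))))
  + \sum_(c | ~~ is_m c) 2^-1 * kap * (t ^+ 2)^-1 * norm2 (brk (bas c) y)).
  have E0 c : eps c (Lam (bas c) (Lam y y)) = 0.
    rewrite lc_form_yy /lc_form (pm_k lie_k0) (pq_h lie_h0) !addr0 !brk0r.
    by rewrite !scaler0 !addr0 /eps Bg0l mulr0.
  have E c : - eps c (Lam (brk (bas c) y) y) + eps c (Lam (bas c) (Lam y y))
      - eps c (Lam y (Lam (bas c) y)) =
      wt s t c * (- Bg (Lam (brk (bas c) y) y) (bas c)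
                  - Bg (Lam y (Lam (bas c) y)) (bas c)).
    apply: (etrans (congr1 (fun z => - eps c (Lam (brk (bas c) y) y) + z
                                     - eps c (Lam y (Lam (bas c) y))) (E0 c))).
    move: (Lam (brk (bas c) y) y) (Lam y (Lam (bas c) y)) => A B.
    by rewrite addr0 /eps mulrBr mulrN.
  apply: (etrans (eq_bigr _ (fun c _ => E c))); rewrite (bigID (@is_m n)) /=.
  congr (_ + _); apply: eq_bigr => c mc.
    rewrite (curvature_m (bas_m s t mc)) /wt mc mulrBr; congr (_ - _).
    by rewrite mulrCA.
  by rewrite (curvature_q (bas_q s t mc)) /wt (negbTE mc) mulrCA mulrA.
rewrite sumrB -[X in X - _]mulr_sumr.
have -> : \sum_(c | is_m c) 3 / 2 * kap * ((s ^+ 2)^-1 * norm2 (pq (brk (bas c) y))) =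
    3 / 2 * kap * \sum_(c | is_m c) (s ^+ 2)^-1 * norm2 (pq (brk (bas c) y)).
  by rewrite mulr_sumr.
rewrite -[X in _ - _ + X]mulr_sumr sum_pq_bracket.
by set S := \sum_(c | ~~ _) _; set S' := \sum_(c | is_m c) _; field;
  rewrite !gt_eqF.
Qed.

End RicciDirection.

(** * Charts of G/H *)

Section GroupG.
Context {R : realType} {n : nat}.
Local Notation Mx := (amb R n).
Local Notation eo := (@eo R n).

(** An orthogonal matrix that fixes [eo] also preserves its complement. *)
Lemma G_P (a : Mx) : G a <-> [/\ a^T *m a = 1%:M, \det a = 1 & a *m eo = eo].
Proof.
have oE : io = lshift (n + (1 + n)) ord0 :> 'I_(1 + (n + (1 + n))) by apply/val_inj.
split=> [[A [AA detA] ->]|[aa deta ao]].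
  have E1 : (block_mx 1%:M 0 0 A : 'M[R]_(1 + (n + (1 + n))))^T *m
      block_mx 1%:M 0 0 A = 1%:M.
    rewrite tr_block_mx mulmx_block !trmx0 trmx1 !mulmx0 !mul0mx !addr0 !add0r AA.
    by rewrite mulmx1 -scalar_mx_block.
  have E2 : \det (block_mx 1%:M 0 0 A : 'M[R]_(1 + (n + (1 + n)))) = 1.
    by rewrite det_ublock det1 mul1r detA.
  split; [exact: E1|exact: E2|].
  rewrite /eo -colE; apply/matrixP => i j; rewrite ord1 [LHS]mxE [RHS]mxE.
  have E3 (k : 'I_(1 + (n + (1 + n)))) :
      (block_mx 1%:M 0 0 A : 'M[R]_(1 + (n + (1 + n)))) k (io : 'I_(1 + (n + (1 + n)))) =
      (k == (io : 'I_(1 + (n + (1 + n)))))%:R.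
    rewrite oE; case: (split_ordP k) => k' ->; first by rewrite block_mxEul mxE (ord1 k').
    by rewrite block_mxEdl mxE eq_rlshift.
  by rewrite andbT; exact: E3.
pose b : 'M[R]_(1 + (n + (1 + n))) := a.
have bb : b^T *m b = 1%:M by exact: aa.
have bcol k : b k (lshift _ ord0) = (k == lshift _ ord0)%:R.
  have := ao; rewrite /eo -colE => /matrixP /(_ k 0); rewrite !mxE andbT.
  by rewrite -oE.
have brow k : b (lshift _ ord0) k = (k == lshift _ ord0)%:R.
  move/matrixP: bb => /(_ (lshift _ ord0) k); rewrite !mxE.
  rewrite (bigD1 (lshift _ ord0)) //= big1 => [|l l0]; last first.
    by rewrite mxE bcol (negbTE l0) mul0r.
  by rewrite mxE bcol eqxx mul1r addr0 eq_sym => ->; rewrite eq_sym.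
have bE : b = block_mx 1%:M 0 0 (drsubmx b).
  rewrite -[b in LHS]submxK; congr block_mx; apply/matrixP => i j;
    rewrite !mxE ?(ord1 i) ?(ord1 j) ?bcol ?brow ?eqxx //;
  by rewrite ?eq_rlshift.
exists (drsubmx b) => //; split.
  move: bb; rewrite bE tr_block_mx mulmx_block !trmx0 trmx1 !mulmx0 !mul0mx.
  rewrite !addr0 !add0r mulmx1 -[1%:M in RHS]submxK => /eq_block_mx[_ _ _ E].
  by rewrite block_mxKdr; apply: (etrans E); apply/matrixP => i j; rewrite !mxE eq_rshift.
have detb : \det b = 1 := deta.
have : \det b = \det (drsubmx b) by rewrite {1}bE det_ublock det1 mul1r.
by rewrite detb.
Qed.

Lemma G1 : G (1%:M : Mx).
Proof. by apply/G_P; rewrite trmx1 !mul1mx det1. Qed.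

Lemma G_inv (a : Mx) : G a -> invmx a = a^T.
Proof.
move=> /G_P[aa _ _]; have ua : a \in unitmx by case/mulmx1_unit: aa.
by rewrite -[invmx a]mul1mx -aa (mulmxK ua).
Qed.

End GroupG.

Section Index.
Context {n : nat}.
Local Notation idx := ('I_n * option 'I_n)%type.

Lemma card_idx : dimGH n = #|{: idx}|.
Proof. by rewrite card_prod card_option !card_ord. Qed.

Definition coord_idx (a : 'I_(dimGH n)) : idx := enum_val (cast_ord card_idx a).

Lemma coord_idx_bij : bijective coord_idx.
Proof.
apply: (@bij_comp _ _ _ enum_val (cast_ord card_idx)); first exact: enum_val_bij.
by exists (cast_ord (esym card_idx)); [exact: cast_ordK | exact: cast_ordKV].
Qed.

Lemma sum_coord_idx (W : nmodType) (f : idx -> W) :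
  \sum_c f c = \sum_a f (coord_idx a).
Proof. by rewrite (reindex coord_idx) //; exact: onW_bij coord_idx_bij. Qed.

End Index.

Section Chart.
Context {R : realType} {n : nat}.
Local Notation Mx := (amb R n).
Local Notation X := 'rV[R]_(dimGH n).
Local Notation eo := (@eo R n).
Local Notation tau := (@coord_idx n).
Variables (s t : R).
Hypothesis (n_gt0 : (0 < n)%N) (s_gt0 : 0 < s) (t_gt0 : 0 < t).
Local Notation bas := (@bas R n s t).
Local Notation eps := (@eps R n s t).
Local Notation kap := (s ^+ 2 / (2 * t ^+ 2)).
Local Notation Lam := (lc_form kap).
Variables (U : set X) (sg : X -> Mx).
Hypothesis chart_sg : chart U sg.

Let oU : open U. Proof. by case: chart_sg. Qed.
Let ssg : smooth_on U sg. Proof. by case: chart_sg. Qed.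

(** The Maurer-Cartan form of the lift [sg], evaluated on the [i]-th
coordinate vector. *)
Definition mc_form i (x : X) : Mx := log_derive sg (delta_mx 0 i) x.
Local Notation om := mc_form.

Lemma mc_formE i x : U x -> om i x = (sg x)^T *m partial i sg x.
Proof.
by move=> Ux; case: chart_sg => _ _ Gsg _; rewrite /om /log_derive G_inv //; exact: Gsg.
Qed.

Lemma sg_orth x : U x -> (sg x)^T *m sg x = 1%:M /\ sg x *m (sg x)^T = 1%:M.
Proof.
move=> Ux; case: chart_sg => _ _ /(_ x Ux) /G_P[E _ _] _; split=> //.
exact: mulmx1C.
Qed.

Lemma sg_mc_form i x : U x -> sg x *m om i x = partial i sg x.
Proof.
by move=> Ux; rewrite mc_formE // mulmxA; have [_ ->] := sg_orth Ux; rewrite mul1mx.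
Qed.

Lemma smooth_mc_form i : smooth_on U (om i).
Proof.
have S := smooth_mulmx oU (smooth_trmx oU ssg) (smooth_partial ssg i).
by apply: (smooth_on_eq oU _ S) => x Ux; rewrite mc_formE.
Qed.

Lemma partial_const (W : normedModType R) (F : X -> W) (c : W) i x :
  (forall y, U y -> F y = c) -> U x -> partial i F x = 0.
Proof.
move=> Fc Ux; rewrite (partial_eq_on (g := fun=> c) i oU Fc Ux).
exact: derive_cst.
Qed.

Lemma lie_g_mc_form i x : U x -> lie_g (om i x).
Proof.
move=> Ux; apply/lie_gP; split.
  have := partial_const i (fun y Uy => (sg_orth Uy).1) Ux.
  rewrite (partial_mulmx oU i (smooth_trmx oU ssg) ssg Ux) (partial_trmx oU i ssg Ux).
  rewrite -mc_formE // => /eqP; rewrite addr_eq0 => /eqP E.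
  by rewrite {1}mc_formE // trmx_mul trmxK E.
have sc : smooth_on U (fun=> eo : 'M[R]_(_, _)) by exact: smooth_cst.
have dc : partial i (fun=> eo : 'M[R]_(_, _)) x = 0 by exact: derive_cst.
have E : partial i sg x *m eo + sg x *m partial i (fun=> eo : 'M[R]_(_, _)) x = 0.
  apply: (etrans (esym (partial_mulmx oU i ssg sc Ux))).
  apply: (partial_const (c := eo)) => // y Uy.
  by case: chart_sg => _ _ /(_ y Uy) /G_P[].
have {}E : partial i sg x *m eo = 0.
  apply: (etrans _ E); apply: (etrans (esym (addr0 _))); congr (_ + _).
  exact: (esym (etrans (congr1 (mulmx (sg x)) dc) (mulmx0 _ _))).
by rewrite mc_formE // -mulmxA E mulmx0.
Qed.

(** The Maurer-Cartan equation. *)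
Lemma maurer_cartan i j x : U x ->
  partial i (om j) x - partial j (om i) x = - brk (om i x) (om j x).
Proof.
move=> Ux.
have E k l : partial k (om l) x =
    - (om k x *m om l x) + (sg x)^T *m partial k (partial l sg) x.
  rewrite (partial_eq_on k oU (fun y Uy => mc_formE l Uy) Ux).
  rewrite (partial_mulmx oU k (smooth_trmx oU ssg) (smooth_partial ssg l) Ux).
  rewrite (partial_trmx oU k ssg Ux) -!sg_mc_form // trmx_mul.
  rewrite (lie_g_skew (lie_g_mc_form k Ux)) -mulmxA [(sg x)^T *m (sg x *m _)]mulmxA.
  by have [-> _] := sg_orth Ux; rewrite mul1mx mulNmx.
have [Z Eij Eji] : exists2 Z, partial i (om j) x = - (om i x *m om j x) + Z &
    partial j (om i) x = - (om j x *m om i x) + Z.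
  exists ((sg x)^T *m partial i (partial j sg) x); first exact: E.
  apply: (etrans (E j i)).
  exact: (congr1 (fun A => - (om j x *m om i x) + (sg x)^T *m A)
    (partial_mx_comm oU j i ssg Ux)).
apply: (etrans (congr2 (fun A B => A - B) Eij Eji)).
by move: (om i x) (om j x) => A B; rewrite opprD addrACA subrr addr0 opprK /brk opprB addrC.
Qed.

(** The metric is built from the components of [om] along m + q. Its component
along h depends on the choice of the lift and enters [frame_form] through the
isotropy representation. *)
Definition frame (x : X) : 'M[R]_(dimGH n) := \matrix_(i, a) eps (tau a) (om i x).
Definition frame_form i (x : X) : 'M[R]_(dimGH n) :=
  \matrix_(a, c) eps (tau c) (Lam (om i x) (bas (tau a))).

Lemma eps_linear c : linear (eps c : Mx -> R^o).
Proof.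
move=> k A B; rewrite /eps BgDl BgZl mulrDr mulrCA; congr (_ + _).
Qed.

Lemma eps_lc_linear c Y : linear (fun A : Mx => eps c (Lam A Y) : R^o).
Proof. by move=> k A B; rewrite lc_form_linear eps_linear. Qed.

Lemma smooth_frame : smooth_on U frame.
Proof.
apply/(smooth_mxP _ oU) => i a.
have S := smooth_functional oU (eps_linear (tau a)) (smooth_mc_form i).
by apply: (smooth_on_eq oU _ S) => x _; rewrite mxE.
Qed.

Lemma smooth_frame_form i : smooth_on U (frame_form i).
Proof.
apply/(smooth_mxP _ oU) => a c.
have S := smooth_functional oU (eps_lc_linear (tau c) (bas (tau a))) (smooth_mc_form i).
by apply: (smooth_on_eq oU _ S) => x _; rewrite mxE.
Qed.

Lemma partial_frame i j a x : U x ->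
  partial i frame x j a = eps (tau a) (partial i (om j) x).
Proof.
move=> Ux; rewrite (partial_entry i j a smooth_frame Ux).
rewrite -(partial_functional oU i (eps_linear (tau a)) (smooth_mc_form j) Ux).
by apply: (partial_eq_on i oU _ Ux) => y _; rewrite mxE.
Qed.

Lemma metric_frame x : U x -> metric s t sg x = frame x *m (frame x)^T.
Proof.
move=> Ux; apply/matrixP => i j; rewrite mulmx_trE mxE.
rewrite (ip_eps n_gt0 s_gt0 t_gt0); try exact: lie_g_mc_form.
by rewrite sum_coord_idx; apply: eq_bigr => a _; rewrite !mxE.
Qed.

(** A vector killed by the frame has its logarithmic derivative in h, so it
vanishes by the immersion condition. *)
Lemma frame_unit x : U x -> frame x \in unitmx.
Proof.
move=> Ux; rewrite -row_free_unit -kermx_eq0; apply/eqP/row_matrixP => k.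
rewrite row0; set v := row k _.
have vM : v *m frame x = 0 by rewrite -row_mul mulmx_ker row0.
case: (chart_sg) => _ _ _; apply; first exact: Ux.
pose S : Mx := \sum_i v 0 i *: om i x.
have -> : log_derive sg v x = S.
  rewrite /log_derive (derive_mx_coord oU v ssg Ux) mulmx_sumr.
  by apply: eq_bigr => i _; rewrite -scalemxAr.
have gS : lie_g S.
  by apply: (big_ind (fun Y : Mx => lie_g Y)) => [||i _];
    [exact: lie_g0 | exact: lie_gD | apply: lie_gZ; exact: lie_g_mc_form].
apply: (eps_inj (t := t) n_gt0 s_gt0 t_gt0 gS) => c.
have [tau' _ tauK] := @coord_idx_bij n; rewrite -(tauK c).
move/matrixP/(_ 0 (tau' c)): vM; rewrite !mxE => <-.
rewrite /eps /S Bg_suml mulr_sumr; apply: eq_bigr => i _.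
by rewrite BgZl mulrCA mxE [frame x _ _]mxE.
Qed.

Lemma weight_swap (p q : R) : 2 * kap * p = - q ->
  (t ^+ 2)^-1 * p = - ((s ^+ 2)^-1 * q).
Proof.
by move=> E; rewrite -[q]opprK -E; field; rewrite !gt_eqF.
Qed.

(** The isotropy representation and the brackets of [lc_form] are all metric. *)
Lemma skew_frame_form i x : U x -> (frame_form i x)^T = - frame_form i x.
Proof.
move=> Ux; apply/matrixP => a c; rewrite !mxE.
have gX := lie_g_mc_form i Ux; move: (om i x) gX (tau a) (tau c) => Y gY {}a {}c.
rewrite /eps /wt; case: (boolP (is_m a)) (boolP (is_m c)) => [ma|qa] [mc|qc].
- exact: (etrans (congr1 ( *%R (s ^+ 2)^-1)
    (lc_form_skew_mm kap gY (bas_m s t mc) (bas_m s t ma))) (mulrN _ _)).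
- have E := weight_swap (lc_form_skew_mq kap gY (bas_m s t ma) (bas_q s t qc)).
  exact: (esym (etrans (congr1 -%R E) (opprK _))).
- exact: weight_swap (lc_form_skew_mq kap gY (bas_m s t mc) (bas_q s t qa)).
- exact: (etrans (congr1 ( *%R (t ^+ 2)^-1)
    (lc_form_skew_qq kap gY (bas_q s t qc) (bas_q s t qa))) (mulrN _ _)).
Qed.

Lemma lc_form_h (A Y : Mx) : lie_h Y -> Lam A Y = 0.
Proof.
move=> hY; rewrite /lc_form (pm_k (lie_h_k hY)) (pq_h hY) addr0 !brk0r.
by rewrite !scaler0 !addr0.
Qed.

Lemma lc_form_sumr (T : Type) (r : seq T) (f : T -> R) (Y : T -> Mx) (A : Mx) :
  Lam A (\sum_(k <- r) f k *: Y k) = \sum_(k <- r) f k *: Lam A (Y k).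
Proof.
elim: r => [|k r IH]; first by rewrite !big_nil lc_form_h //; exact: lie_h0.
by rewrite !big_cons lc_form_linearr IH.
Qed.

Lemma eps_sum (T : Type) (r : seq T) (f : T -> R) (Y : T -> Mx) c :
  eps c (\sum_(k <- r) f k *: Y k) = \sum_(k <- r) f k * eps c (Y k).
Proof.
rewrite /eps Bg_suml mulr_sumr; apply: eq_bigr => k _.
by rewrite BgZl mulrCA.
Qed.

(** Since the values of the connection form are only tested against m + q, it
may be evaluated on a vector of g through its coordinates in the basis. *)
Lemma eps_lc_form_coord c (A Y : Mx) : lie_g Y ->
  \sum_a eps (tau a) Y * eps c (Lam A (bas (tau a))) = eps c (Lam A Y).
Proof.
move=> gY.
have E := sum_coord_idx (fun c' => eps c' Y * eps c (Lam A (bas c'))).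
rewrite -{}E -eps_sum -lc_form_sumr (bas_complete n_gt0 s_gt0 t_gt0 gY).
have E2 : Lam A Y = Lam A (pm Y + pq Y).
  rewrite {1}(pmqh_sum Y); have hY := ph_in gY.
  move: (pm Y + pq Y) (ph Y) hY => B C hC.
  by rewrite -{1}[B]scale1r lc_form_linearr (lc_form_h _ hC) addr0 scale1r.
exact: (congr1 (eps c) (esym E2)).
Qed.

Lemma frame_connectionE i j c x : U x ->
  frame_connection frame frame_form i x j c =
  eps (tau c) (partial i (om j) x) + eps (tau c) (Lam (om i x) (om j x)).
Proof.
move=> Ux; apply: (etrans (addmxE _ _ _ _)).
apply: (congr2 +%R (partial_frame i j c Ux)).
apply: (etrans _ (eps_lc_form_coord (tau c) (om i x) (lie_g_mc_form j Ux))).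
by rewrite mxE; apply: eq_bigr => a _; rewrite [frame x j a]mxE [frame_form i x a c]mxE.
Qed.

(** The passage from the Maurer-Cartan equation, the first hypothesis, and
[lc_form_torsion], the second one, to the torsion of the frame. *)
Lemma eps_torsion c (A B C C' W : Mx) : A - B = - W -> eps c (C - C' - W) = 0 ->
  eps c A + eps c C = eps c B + eps c C'.
Proof.
move=> AB hT; apply/eqP; rewrite -subr_eq0 -hT; apply/eqP.
have -> : C - C' - W = A - B + (C - C') by rewrite AB addrC.
by rewrite /eps !BgDl !BgNl; ring.
Qed.

Lemma frame_torsion_free x : U x -> forall i j c,
  frame_connection frame frame_form i x j c =
  frame_connection frame frame_form j x i c.
Proof.
move=> Ux i j c; apply: (etrans (frame_connectionE i j c Ux)).
apply: (etrans _ (esym (frame_connectionE j i c Ux))).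
have gi := lie_g_mc_form i Ux; have gj := lie_g_mc_form j Ux.
exact: (eps_torsion (maurer_cartan i j Ux)
  (eps_h s t (tau c) (lc_form_torsion kap gi gj))).
Qed.

End Chart.

(** * The Ricci tensor and the Laplacian in a chart *)

Section ChartOperators.
Context {R : realType} {n : nat}.
Local Notation Mx := (amb R n).
Local Notation X := 'rV[R]_(dimGH n).
Local Notation ez := (@ez R n).
Local Notation tau := (@coord_idx n).
Variables (s t : R).
Hypothesis (n_gt0 : (0 < n)%N) (s_gt0 : 0 < s) (t_gt0 : 0 < t).
Local Notation bas := (@bas R n s t).
Local Notation eps := (@eps R n s t).
Local Notation cm := (@cm R n s).
Local Notation kap := (s ^+ 2 / (2 * t ^+ 2)).
Local Notation Lam := (lc_form kap).
Variables (U : set X) (sg : X -> Mx).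
Hypothesis chart_sg : chart U sg.
Local Notation om := (mc_form sg).
Local Notation M := (frame s t sg).
Local Notation A := (frame_form s t sg).

Let oU : open U. Proof. by case: chart_sg. Qed.
Let ssg : smooth_on U sg. Proof. by case: chart_sg. Qed.

(** The [(a, c)] entry of [[Lam Y, Lam Z] - Lam [Y, Z]]. *)
Definition curvature_entry (a c : 'I_n * option 'I_n) (Y Z : Mx) : R :=
  - eps c (Lam (brk Y Z) (bas a)) + eps c (Lam Y (Lam Z (bas a)))
  - eps c (Lam Z (Lam Y (bas a))).

Lemma partial_frame_form i j a c x : U x ->
  partial i (A j) x a c = eps (tau c) (Lam (partial i (om j) x) (bas (tau a))).
Proof.
move=> Ux; apply: (etrans (partial_entry i a c (smooth_frame_form s t chart_sg j) Ux)).
apply: (etrans _ (partial_functional oU i (eps_lc_linear s t (tau c) (bas (tau a)))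
  (smooth_mc_form chart_sg j) Ux)).
by apply: (partial_eq_on i oU _ Ux) => y _; rewrite mxE.
Qed.

Lemma frame_form_mul i j a c x : U x ->
  (A j x *m A i x) a c = eps (tau c) (Lam (om i x) (Lam (om j x) (bas (tau a)))).
Proof.
move=> Ux; have gY := lie_g_lc_form kap (lie_g_mc_form chart_sg j Ux) (bas_g s t (tau a)).
apply: (etrans _ (eps_lc_form_coord n_gt0 s_gt0 t_gt0 (tau c) (om i x) gY)).
rewrite [LHS]mxE; apply: eq_bigr => b _.
by apply: congr2; [rewrite [LHS]mxE | rewrite [LHS]mxE].
Qed.

(** The derivatives of the connection form are those of the Maurer-Cartan form,
so the curvature is algebraic in the latter. *)
Lemma frame_curvatureE i j a c x : U x ->
  frame_curvature A i j x a c = curvature_entry (tau a) (tau c) (om i x) (om j x).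
Proof.
move=> Ux; rewrite /frame_curvature /curvature_entry.
have E1 : (partial i (A j) x - partial j (A i) x) a c =
    - eps (tau c) (Lam (brk (om i x) (om j x)) (bas (tau a))).
  apply: (etrans (addmxE _ _ _ _)).
  apply: (etrans (congr2 +%R (partial_frame_form i j a c Ux)
    (etrans (oppmxE _ _ _) (congr1 -%R (partial_frame_form j i a c Ux))))).
  have := maurer_cartan chart_sg i j Ux.
  have L := eps_lc_linear s t (tau c) (bas (tau a)).
  move: (partial i (om j) x) (partial j (om i) x) (brk (om i x) (om j x)) => B C D BC.
  have -> : B = -1 *: D + C by rewrite scaleN1r -BC subrK.
  have aux (p q : R^o) : -1 *: p + q - q = - p by rewrite addrK scaleN1r.
  apply: (etrans (congr1 (fun z => z - eps (tau c) (Lam C (bas (tau a)))) (L (-1) D C))).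
  exact: aux.
apply: (etrans (addmxE _ _ _ _)).
apply: (congr2 +%R); last first.
  by apply: (etrans (oppmxE _ _ _)); congr (- _); exact: frame_form_mul.
apply: (etrans (addmxE _ _ _ _)); apply: (congr2 +%R E1).
exact: frame_form_mul.
Qed.

(** ** The Laplacian of a matrix entry *)

Definition zz_entry (Y : Mx) : R^o := Y iz iz.

Lemma zz_linear : linear zz_entry.
Proof. by move=> k B C; rewrite /zz_entry addmxE scalemxE. Qed.

Lemma zz_mul0 (B Y : Mx) : Y *m ez = 0 -> zz_entry (B *m Y) = 0.
Proof.
move=> Y0; have E : B *m Y *m ez = 0 by rewrite -mulmxA Y0 mulmx0.
exact: ((mul_delta_col0P _ _).1 E iz).
Qed.

Lemma zz_mulB (B C Y : Mx) :
  zz_entry (B *m C) - zz_entry (B *m Y) = zz_entry (B *m (C - Y)).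
Proof. by rewrite mulmxBr /zz_entry addmxE oppmxE. Qed.

Lemma linear_sum_eq (f : Mx -> R^o) (T : Type) (r : seq T) (k : T -> R) (Y : T -> Mx) :
  linear f -> f (\sum_(b <- r) k b *: Y b) = \sum_(b <- r) k b * f (Y b).
Proof.
move=> lf; have f0 : f 0 = 0.
  by have := lf (-1) 0 0; rewrite scaler0 addr0 scaleN1r addNr.
by elim: r => [|b r IH]; rewrite ?big_nil ?big_cons // lf IH.
Qed.

(** A linear form that vanishes on h is determined by its values on the basis. *)
Lemma linear_form_coord (f : Mx -> R^o) (Y : Mx) : linear f ->
  (forall Z, lie_h Z -> f Z = 0) -> lie_g Y ->
  f Y = \sum_a eps (tau a) Y * f (bas (tau a)).
Proof.
move=> lf fh gY; rewrite -(sum_coord_idx (fun c => eps c Y * f (bas c))).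
rewrite -linear_sum_eq // bas_complete // {1}(pmqh_sum Y).
by rewrite -{1}[pm Y + pq Y]scale1r lf (fh _ (ph_in gY)) addr0 scale1r.
Qed.

Lemma lc_form_bas_bas c : Lam (bas c) (bas c) = 0.
Proof.
case: (boolP (is_m c)) => [mc|qc]; first exact: lc_form_yy (bas_m s t mc).
have qb := bas_q s t qc.
rewrite (lc_form_q _ _ qb) (pm_k (in_q_k qb)) (ph_q qb) !brk0l.
by rewrite scaler0 addr0.
Qed.

Lemma mul_sub_lc_linear k (B C Y : Mx) : (k *: B + C) *m Y - Lam (k *: B + C) Y =
  k *: (B *m Y - Lam B Y) + (C *m Y - Lam C Y).
Proof.
rewrite lc_form_linear; move: (Lam B Y) (Lam C Y) => B' C'.
by rewrite mulmxDl -scalemxAl opprD addrACA scalerBr.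
Qed.

(** The Laplacian of an H-invariant function on G is minus the sum of its second
derivatives along the left-invariant fields of an orthonormal basis of m + q:
the connection form drops out because [lc_form_bas_bas] vanishes, and the
h-components of the lift because of invariance ([Phi_h] below). For a matrix
entry the second derivatives are right multiplications by [bas c *m bas c],
and [casimir_ez] sums them. *)
Lemma laplace_zz x : U x ->
  laplace_beltrami (metric s t sg) (zz_entry \o sg) x =
  2 * n%:R * cm ^+ 2 * zz_entry (sg x).
Proof.
move=> Ux.
pose W y : 'cV[R]_(dimGH n) := \col_c zz_entry (sg y *m bas (tau c)).
have W_E y c : zz_entry (sg y *m bas (tau c)) = W y c 0 by rewrite mxE.
pose rho c (Y : Mx) : R^o := zz_entry (Y *m bas (tau c)).
have rho_lin c : linear (rho c).
  by move=> k B C; rewrite /rho mulmxDl -scalemxAl zz_linear.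
have sW : smooth_on U W.
  apply/(smooth_mxP _ oU) => c j; rewrite ord1.
  apply: (smooth_on_eq oU _ (smooth_functional oU (rho_lin c) ssg)) => y _.
  exact: W_E.
have hz Z : lie_h Z -> forall B : Mx, zz_entry (B *m Z) = 0.
  by move=> /lie_h_k /lie_kP[_ Zz] B; exact: zz_mul0.
have lin_sg y : linear (fun Y => zz_entry (sg y *m Y)).
  by move=> k B C; rewrite mulmxDr -scalemxAr zz_linear.
have duE y j : U y -> partial j (zz_entry \o sg) y = (M y *m W y) j 0.
  move=> Uy; apply: (etrans (partial_functional oU j zz_linear ssg Uy)).
  rewrite -(sg_mc_form chart_sg j Uy).
  apply: (etrans (linear_form_coord (lin_sg y) (fun Z hZ => hz Z hZ _)
    (lie_g_mc_form chart_sg j Uy))).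
  by rewrite [RHS]mxE; apply: eq_bigr => a _; apply: congr2; rewrite [RHS]mxE.
have gE y : U y -> metric s t sg y = M y *m (M y)^T by exact: metric_frame.
have uM y : U y -> M y \in unitmx by exact: frame_unit.
have skA i y : U y -> (A i y)^T = - A i y by exact: skew_frame_form.
have tf y : U y -> forall i j c, frame_connection M A i y j c = frame_connection M A j y i c.
  by move=> Uy; exact: (frame_torsion_free n_gt0 s_gt0 t_gt0 chart_sg Uy).
apply: (etrans (laplace_frame oU (smooth_frame s t chart_sg)
  uM gE skA tf Ux sW duE)).
(* The covariant second derivative along [Y] and the b-th frame vector. *)
pose Phi b (Y : Mx) : R^o := zz_entry (sg x *m (Y *m bas (tau b) - Lam Y (bas (tau b)))).
have Phi_lin b : linear (Phi b).
  move=> k B C; apply: (etrans (congr1 (fun Y => zz_entry (sg x *m Y))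
    (mul_sub_lc_linear k B C (bas (tau b))))).
  exact: lin_sg.
have Phi_h b Z : lie_h Z -> Phi b Z = 0.
  move=> hZ; rewrite /Phi; have -> : Lam Z (bas (tau b)) = brk Z (bas (tau b)).
    have : pm (bas (tau b)) + pq (bas (tau b)) = bas (tau b).
      case: (boolP (is_m (tau b))) => [mb|qb].
        by have mb' := bas_m s t mb; rewrite (pq_m mb') addr0 mb'.2.
      have qb' := bas_q s t qb.
      by rewrite (pq_q qb') (pm_k (in_q_k qb')) add0r.
    rewrite /lc_form (pm_k (lie_h_k hZ)) (pq_h hZ) (ph_h hZ) => ->.
    by rewrite !brk0l !scaler0 !add0r.
  by rewrite /brk opprB addrC subrK mulmxA; exact: hz.
have termE i b : (partial i W x - A i x *m W x) b 0 =
    \sum_a M x i a * Phi b (bas (tau a)).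
  have dW : partial i W x b 0 = zz_entry (sg x *m om i x *m bas (tau b)).
    apply: (etrans (partial_entry i b 0 sW Ux)).
    apply: (@etrans _ _ (partial i (fun y => rho b (sg y)) x)).
      by apply: (partial_eq_on i oU _ Ux) => y _; rewrite mxE.
    apply: (etrans (partial_functional oU i (rho_lin b) ssg Ux)).
    by rewrite -(sg_mc_form chart_sg i Ux).
  have AW : (A i x *m W x) b 0 = zz_entry (sg x *m Lam (om i x) (bas (tau b))).
    apply: (etrans _ (esym (linear_form_coord (lin_sg x) (fun Z hZ => hz Z hZ _)
      (lie_g_lc_form kap (lie_g_mc_form chart_sg i Ux) (bas_g s t (tau b)))))).
    by rewrite [LHS]mxE; apply: eq_bigr => a _; apply: congr2; rewrite [LHS]mxE.
  apply: (etrans (addmxE _ _ _ _)); apply: (etrans (congr2 +%R dW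
    (etrans (oppmxE _ _ _) (congr1 -%R AW)))).
  have -> : zz_entry (sg x *m om i x *m bas (tau b))
      - zz_entry (sg x *m Lam (om i x) (bas (tau b))) = Phi b (om i x).
    by rewrite -mulmxA; exact: zz_mulB.
  apply: (etrans (linear_form_coord (Phi_lin b) (Phi_h b) (lie_g_mc_form chart_sg i Ux))).
  by apply: eq_bigr => a _; apply: congr2; rewrite // [RHS]mxE.
have -> : \sum_i \sum_b invmx (M x) b i * (partial i W x - A i x *m W x) b 0 =
    \sum_b Phi b (bas (tau b)).
  rewrite exchange_big; apply: eq_bigr => b _ /=.
  transitivity ((invmx (M x) *m (M x *m \col_a Phi b (bas (tau a)))) b 0).
    rewrite [RHS]mxE; apply: eq_bigr => i _; rewrite termE [in RHS]mxE.
    congr (_ * _); apply: eq_bigr => a _.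
    by apply: (congr1 ( *%R (M x i a))); rewrite [RHS]mxE.
  by rewrite (mulKmx (uM x Ux)) mxE.
have -> : \sum_b Phi b (bas (tau b)) = zz_entry (sg x *m \sum_c bas c *m bas c).
  rewrite (sum_coord_idx (fun c => bas c *m bas c)).
  have -> : \sum_b bas (tau b) *m bas (tau b) =
      \sum_b 1 *: (bas (tau b) *m bas (tau b)).
    by apply: eq_bigr => b _; rewrite scale1r.
  rewrite (linear_sum_eq _ _ _ (lin_sg x)); apply: eq_bigr => b _.
  by rewrite mul1r /Phi lc_form_bas_bas subr0.
have zzE Y : zz_entry Y = (Y *m ez) iz 0 by rewrite /ez -colE mxE.
rewrite !zzE -mulmxA mulmx_suml.
rewrite (eq_bigr _ (fun c _ => esym (mulmxA _ _ _))) casimir_ez //.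
by rewrite -scalemxAr scalemxE mulNr opprK.
Qed.

End ChartOperators.

(** * The eigenfunction *)

Section Eigenfunction.
Context {R : realType} {n : nat}.
Local Notation Mx := (amb R n).
Local Notation ez := (@ez R n).

(** Along the path [c] from the identity to [h], the derivative of [c *m ez] is
[c *m X *m ez = 0], as h annihilates [ez]. *)
Lemma H_fix_ez (h : Mx) : H h -> h *m ez = ez.
Proof.
move=> [c [X [_ hX dc c0 c1]]].
have dentry k (u : R) : is_derive (u : R) (1 : R) (fun v : R => c v k iz : R) 0.
  have [dcu cE] := dc u.
  split; first by move: dcu => /derivable_mxP /(_ k iz).
  have := derive_mx dcu; rewrite cE => /matrixP /(_ k iz); rewrite [RHS]mxE => <-.
  have /lie_h_k /lie_kP[_ Xz] := hX u.
  have E : c u *m X u *m ez = 0 by rewrite -mulmxA Xz mulmx0.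
  exact: ((mul_delta_col0P _ _).1 E k).
have hcol k : h k iz = (k == iz)%:R.
  rewrite -c1 (is_derive_0_is_cst 1 0 (dentry k)) c0 mxE.
  by [].
by rewrite /ez -colE; apply/matrixP => k l; rewrite (ord1 l) !mxE hcol andbT.
Qed.

Lemma smooth_zz_entry : smooth_on_GH (@zz_entry R n).
Proof.
split=> [a h _ hh|U sg ch].
  have zE (Y : Mx) : zz_entry Y = (Y *m ez) iz 0 by rewrite /ez -colE mxE.
  by rewrite !zE -mulmxA H_fix_ez.
have [oU ssg _ _] := ch.
exact: (smooth_functional oU zz_linear ssg).
Qed.

Lemma eigenvalue_zz (s t : R) : (0 < n)%N -> 0 < s -> 0 < t ->
  @eigenvalue_GH R n s t (2 * n%:R * @cm R n s ^+ 2).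
Proof.
move=> n0 s0 t0; exists (@zz_entry R n); split.
- exact: smooth_zz_entry.
- by exists 1%:M; [exact: G1 | rewrite /zz_entry mxE eqxx oner_neq0].
- by move=> U sg ch x Ux; exact: (laplace_zz n0 s0 t0 ch Ux).
Qed.

End Eigenfunction.

(** * A Cayley chart around the base point *)

Section Cayley.
Context {R : realType} {n : nat}.
Local Notation Mx := (amb R n).
Local Notation X := 'rV[R]_(dimGH n).
Local Notation eo := (@eo R n).
Local Notation tau := (@coord_idx n).
Variables (s t : R).
Hypothesis (n_gt0 : (0 < n)%N) (s_gt0 : 0 < s) (t_gt0 : 0 < t).
Local Notation bas := (@bas R n s t).
Local Notation eps := (@eps R n s t).

(** The Cayley transform stands in for the exponential map: it takes values in
G, agrees with the exponential to second order, and is rational, so its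
smoothness follows from that of matrix inversion. *)
Definition cayley_half (x : X) : Mx := \sum_a x 0 a *: (2^-1 *: bas (tau a)).
Definition cayley_den (x : X) : Mx := 1%:M - cayley_half x.

(** This is [(1 - Y)^-1 (1 + Y)] for [Y = cayley_half x], since
[1 + Y = 2 - (1 - Y)]. *)
Definition cayley (x : X) : Mx :=
  invmx (cayley_den x) + invmx (cayley_den x) - 1%:M.

Lemma lie_g_cayley_half x : lie_g (cayley_half x).
Proof.
by apply: (big_ind (fun Y : Mx => lie_g Y)) => [||a _];
  [exact: lie_g0 | exact: lie_gD | do 2!apply: lie_gZ; exact: bas_g].
Qed.

(** A left fixed vector [v] of a skew matrix [Y] satisfies
[v v^T = v Y v^T = 0]. *)
Lemma unit_one_sub_skew m (Y : 'M[R]_m) : Y^T = - Y -> 1%:M - Y \in unitmx.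
Proof.
move=> sY; rewrite -row_free_unit -kermx_eq0; apply/eqP/row_matrixP => k.
rewrite row0; set v := row k _.
have vY : v = v *m Y.
  apply/eqP; rewrite -subr_eq0 -{1}[v]mulmx1 -mulmxBr; apply/eqP.
  by rewrite /v -row_mul mulmx_ker row0.
have vYv : v *m Y *m v^T = 0.
  have E : (v *m Y *m v^T)^T = - (v *m Y *m v^T).
    by rewrite !trmx_mul trmxK sY mulNmx mulmxN mulmxA.
  by apply/matrixP => i j; rewrite !ord1 (skew_diag _ E) mxE.
have : (v *m v^T) 0 0 = 0 by rewrite {1}vY vYv mxE.
rewrite mulmx_trE => /eqP; rewrite psumr_eq0 => [/allP v0|j _]; last exact: sqr_ge0.
apply/rowP => j; rewrite [RHS]mxE.
by have := v0 j (mem_index_enum _); rewrite /= mulf_eq0 orbb => /eqP.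
Qed.

Lemma cayley_den_unit x : cayley_den x \in unitmx.
Proof.
by apply/unit_one_sub_skew/lie_g_skew/lie_g_cayley_half.
Qed.

Lemma cayley_G x : G (cayley x).
Proof.
have uS := cayley_den_unit x; have gY := lie_g_cayley_half x.
have ST : (cayley_den x)^T = 1%:M + 1%:M - cayley_den x.
  rewrite /cayley_den linearB /= trmx1 (lie_g_skew gY) opprK.
  by rewrite opprB addrACA subrr addr0 addrC.
have So : cayley_den x *m eo = eo.
  have [_ Yo] := (lie_gP _).1 gY.
  by rewrite /cayley_den mulmxBl mul1mx Yo subr0.
rewrite /cayley; move: (cayley_den x) uS ST So => S uS ST So.
have uST : S^T \in unitmx by rewrite unitmx_tr.
have VS : invmx S^T + invmx S = invmx S^T *m invmx S + invmx S^T *m invmx S.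
  have E : invmx S^T *m (S + S^T) *m invmx S = invmx S^T + invmx S.
    by rewrite mulmxDr mulmxDl (mulmxK uS) (mulVmx uST) mul1mx.
  by rewrite -E ST [S + _]addrC subrK mulmxDr mulmxDl mulmx1.
apply/G_P; split.
- rewrite (raddfB (@trmx R _ _)) (raddfD (@trmx R _ _)) /= trmx1 trmx_inv.
  rewrite !(mulmxBl, mulmxBr, mulmxDl, mulmxDr, mul1mx, mulmx1).
  move/matrixP: VS; move: (invmx S^T) (invmx S) => V' V VS.
  apply/matrixP => i j; have := VS i j; rewrite !(addmxE, oppmxE) => E.
  have -> : V' i j = (V' *m V) i j + (V' *m V) i j - V i j by rewrite -E addrK.
  ring.
- have -> : invmx S + invmx S - 1%:M = invmx S *m S^T.
    by rewrite ST mulmxBr mulmxDr mulmx1 (mulVmx uS).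
  by rewrite det_mulmx det_tr -det_mulmx (mulVmx uS) det1.
- have Vo : invmx S *m eo = eo by rewrite -{1}So (mulKmx uS).
  by rewrite mulmxBl mulmxDl mul1mx Vo addrK.
Qed.

Let oT : open (setT : set X). Proof. exact: openT. Qed.

Lemma smooth_cayley_half : smooth_on setT cayley_half.
Proof.
apply/(smooth_mxP _ oT) => k l.
apply: (@smooth_on_eq _ _ _ _ (fun x : X => \sum_a x 0 a * (2^-1 *: bas (tau a)) k l : R^o)).
- exact: oT.
- by move=> x _; rewrite summxE; apply: eq_bigr => a _; rewrite [RHS]scalemxE.
- apply: (smooth_sum oT) => a; apply: (smoothM oT); first exact: smooth_coord.
  exact: smooth_cst.
Qed.

Lemma partial_cayley_half i x : partial i cayley_half x = 2^-1 *: bas (tau i).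
Proof.
apply/matrixP => k l; rewrite (partial_entry i k l smooth_cayley_half I).
have s1 a : smooth_on setT (fun x : X => x 0 a * (2^-1 *: bas (tau a)) k l : R^o).
  by apply: (smoothM oT); [exact: smooth_coord | exact: smooth_cst].
transitivity (partial i (fun x : X => \sum_a x 0 a * (2^-1 *: bas (tau a)) k l : R^o) x).
  apply: (partial_eq_on i oT) => // y _.
  by rewrite summxE; apply: eq_bigr => a _; exact: scalemxE.
rewrite (partial_sum oT _ i s1 I).
have E a : partial i (fun x : X => x 0 a * (2^-1 *: bas (tau a)) k l : R^o) x =
    (a == i)%:R * (2^-1 *: bas (tau a)) k l.
  apply: (etrans (partialM i (smooth_coord setT a)
    (smooth_cst setT ((2^-1 *: bas (tau a)) k l : R^o)) I)).
  have [_ D1] := is_derive_coord i a x.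
  have D2 : partial i (fun=> (2^-1 *: bas (tau a)) k l : R^o) x = 0 by exact: derive_cst.
  apply: (etrans (congr2 (fun p q => p * _ + _ * q) D1 D2)).
  by rewrite mulr0 addr0.
rewrite (eq_bigr _ (fun a _ => E a)) (bigD1 i) //= eqxx mul1r big1 ?addr0 //.
by move=> a /negbTE ->; rewrite mul0r.
Qed.

Lemma smooth_cayley_den : smooth_on setT cayley_den.
Proof.
apply/(smooth_mxP _ oT) => k l.
apply: (@smooth_on_eq _ _ _ _ (fun x : X => (1%:M : Mx) k l + -1 * cayley_half x k l : R^o)).
- exact: oT.
- by move=> x _; rewrite /cayley_den addmxE oppmxE mulN1r.
- apply: (smoothD oT); first exact: smooth_cst.
  apply: (smoothM oT); first exact: smooth_cst.
  exact: (smooth_entry oT k l smooth_cayley_half).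
Qed.

Lemma smooth_cayley_inv : smooth_on setT (fun x => invmx (cayley_den x)).
Proof.
by apply: (smooth_invmx oT smooth_cayley_den) => x _; exact: cayley_den_unit.
Qed.

Lemma smooth_cayley : smooth_on setT cayley.
Proof.
apply/(smooth_mxP _ oT) => k l; have sV := smooth_entry oT k l smooth_cayley_inv.
apply: (@smooth_on_eq _ _ _ _ (fun x : X => invmx (cayley_den x) k l
  + invmx (cayley_den x) k l + - (1%:M : Mx) k l : R^o)).
- exact: oT.
- by move=> x _; rewrite /cayley !addmxE oppmxE.
- by apply: (smoothD oT); [exact: (smoothD oT) | exact: smooth_cst].
Qed.

Lemma cayley_half0 : cayley_half 0 = 0.
Proof. by rewrite /cayley_half big1 // => a _; rewrite mxE scale0r. Qed.

Lemma cayley_den0 : cayley_den 0 = 1%:M.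
Proof. by rewrite /cayley_den cayley_half0 subr0. Qed.

Lemma cayley0 : cayley 0 = 1%:M.
Proof. by rewrite /cayley cayley_den0 invmx1 addrK. Qed.

Lemma partial_cayley0 i : partial i cayley 0 = bas (tau i).
Proof.
have sD := smooth_cayley_den; have sV := smooth_cayley_inv.
have sC (c : Mx) : smooth_on (setT : set X) (fun=> c) by exact: smooth_cst.
have dC (c : Mx) : partial i (fun=> c : Mx) (0 : X) = 0 by exact: derive_cst.
have dD : partial i cayley_den 0 = - (2^-1 *: bas (tau i)).
  apply: (etrans (partialB i (sC 1%:M) smooth_cayley_half I)).
  apply: (etrans (congr2 (fun A B => A - B) (dC 1%:M) (partial_cayley_half i 0))).
  by rewrite sub0r.
have dV : partial i (fun x => invmx (cayley_den x)) 0 = 2^-1 *: bas (tau i).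
  have E : partial i cayley_den 0 *m invmx (cayley_den 0)
      + cayley_den 0 *m partial i (fun x => invmx (cayley_den x)) 0 = 0.
    apply: (etrans (esym (partial_mulmx oT i sD sV I))).
    apply: (etrans (partial_eq_on i (g := fun=> 1%:M) oT _ I) (dC 1%:M)) => y _.
    exact: mulmxV (cayley_den_unit y).
  have F : - (2^-1 *: bas (tau i))
      + partial i (fun x => invmx (cayley_den x)) 0 = 0.
    apply: (etrans _ E); apply: congr2.
      by rewrite cayley_den0 invmx1 mulmx1 dD.
    by rewrite cayley_den0 mul1mx.
  by apply/eqP; rewrite -subr_eq0 addrC; apply/eqP.
have sVV : smooth_on setT (fun x => invmx (cayley_den x) + invmx (cayley_den x)).
  apply/(smooth_mxP _ oT) => k l; have sVkl := smooth_entry oT k l sV.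
  by apply: (smooth_on_eq oT _ (smoothD oT sVkl sVkl)) => x _; rewrite addmxE.
apply: (etrans (partialB i sVV (sC 1%:M) I)).
apply: (etrans (congr2 (fun A B => A - B) (partialD i sV sV I) (dC 1%:M))).
by rewrite subr0 dV -scalerDr scale_half_double.
Qed.

Local Notation om := (mc_form cayley).
Local Notation M := (frame s t cayley).

Lemma mc_form_cayley0 i : om i 0 = bas (tau i).
Proof.
by rewrite /mc_form /log_derive cayley0 invmx1 mul1mx; exact: partial_cayley0.
Qed.

Lemma frame_cayley0 : M 0 = 1%:M.
Proof.
apply/matrixP => i a; rewrite mxE mc_form_cayley0 (bas_orthonormal n_gt0 s_gt0 t_gt0).
have [tau' tauK _] := @coord_idx_bij n.
by rewrite (can_eq tauK) mxE eq_sym.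
Qed.

(** Where the Cayley map is an immersion modulo H; this contains the origin, at
which the frame is the identity. *)
Definition cayley_dom : set X := [set x | \det (M x) != 0].

Lemma smooth_det_frame_cayley : smooth_on setT (fun x => \det (M x) : R^o).
Proof.
apply: (smooth_det oT); apply/(smooth_mxP _ oT) => i a.
have som : smooth_on setT (om i).
  have uC x : setT x -> cayley x \in unitmx.
    by move=> _; have /G_P[E _ _] := cayley_G x; case/mulmx1_unit: E.
  have S := smooth_mulmx oT (smooth_invmx oT smooth_cayley uC)
    (smooth_partial smooth_cayley i).
  by apply: (smooth_on_eq oT _ S).
apply: (smooth_on_eq oT _ (smooth_functional oT (eps_linear s t (tau a)) som)) => x _.
by rewrite mxE.
Qed.

Lemma open_cayley_dom : open cayley_dom.
Proof.
apply: (@open_comp _ _ (fun x => \det (M x) : R^o) [set y | y != 0]).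
  by move=> x _; exact: (smooth_continuous smooth_det_frame_cayley).
exact: open_neq.
Qed.

Lemma chart_cayley : chart cayley_dom cayley.
Proof.
split.
- exact: open_cayley_dom.
- exact: smooth_on_sub smooth_cayley.
- by move=> x _; exact: cayley_G.
- move=> x v Mx0 hv.
  have uM : M x \in unitmx by rewrite unitmxE unitfE.
  suff vM : v *m M x = 0 by rewrite -[v](mulmxK uM) vM mul0mx.
  have E : log_derive cayley v x = \sum_i v 0 i *: om i x.
    rewrite /log_derive (derive_mx_coord oT v smooth_cayley I) mulmx_sumr.
    by apply: eq_bigr => i _; rewrite -scalemxAr.
  apply/rowP => a; rewrite [RHS]mxE -(eps_h s t (tau a) hv) E eps_sum mxE.
  by apply: eq_bigr => i _; rewrite [M x i a]mxE.
Qed.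

Lemma cayley_dom0 : cayley_dom 0.
Proof. by rewrite /cayley_dom /= frame_cayley0 det1 oner_neq0. Qed.

End Cayley.

(** * The Einstein constant and the eigenvalue *)

Section EinsteinConstant.
Context {R : realType} {n : nat}.
Local Notation Mx := (amb R n).
Local Notation tau := (@coord_idx n).
Local Notation D := (2 * n%:R - 1 : R).
Variables (s t : R).
Hypothesis (n_gt0 : (0 < n)%N) (s_gt0 : 0 < s) (t_gt0 : 0 < t).
Local Notation bas := (@bas R n s t).
Local Notation cm := (@cm R n s).
Local Notation cq := (@cq R n t).
Local Notation sg := (@cayley R n s t).

(** At the origin of the Cayley chart the Maurer-Cartan form is the basis
itself, so no frame has to be inverted. *)
Lemma ricci_cayley j : ricci (metric s t sg) 0 j j = ricci_dir s t (bas (tau j)).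
Proof.
have ch := @chart_cayley R n s t.
have U0 := cayley_dom0 n_gt0 s_gt0 t_gt0.
have [oU _ _ _] := ch.
have E1 := (ricci_frame oU (smooth_frame s t ch) (smooth_frame_form s t ch)
  (fun x Ux => frame_unit n_gt0 s_gt0 t_gt0 ch Ux)
  (fun x Ux => metric_frame n_gt0 s_gt0 t_gt0 ch Ux)
  (fun i x Ux => skew_frame_form s_gt0 t_gt0 ch i Ux)
  (fun x Ux => frame_torsion_free n_gt0 s_gt0 t_gt0 ch Ux) j j U0).
rewrite E1.
rewrite (frame_cayley0 n_gt0 s_gt0 t_gt0) invmx1 /ricci_dir.
apply: (etrans _ (esym (sum_coord_idx (fun c => curvature_entry s t (tau j) c
  (bas c) (bas (tau j)))))).
apply: eq_bigr => i _; rewrite mul1mx mulmx1.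
apply: (etrans (frame_curvatureE n_gt0 s_gt0 t_gt0 ch i j j i U0)).
by rewrite !mc_form_cayley0.
Qed.

(** The Einstein equation at the origin of the Cayley chart, evaluated on a
basis vector of m, whose norm is 1; [ricci_dirE] computes the other side. *)
Lemma einstein_constantE (E : R) : einstein_constant n s t E ->
  E = cm ^+ 2 * (D - s ^+ 2 / (2 * t ^+ 2) * (n%:R - 1)).
Proof.
move=> hE.
pose i0 := Ordinal n_gt0; have [tau' _ tauK] := @coord_idx_bij n.
pose j := tau' (i0, Some i0); have tauj : tau j = (i0, Some i0) by exact: tauK.
have := hE _ _ (@chart_cayley R n s t) _ (cayley_dom0 n_gt0 s_gt0 t_gt0).
move/matrixP/(_ j j); rewrite scalemxE ricci_cayley.
rewrite (metric_frame n_gt0 s_gt0 t_gt0 (@chart_cayley R n s t)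
  (cayley_dom0 n_gt0 s_gt0 t_gt0)).
rewrite (frame_cayley0 n_gt0 s_gt0 t_gt0) trmx1 mulmx1 mxE eqxx mulr1 => <-.
have my : in_m (bas (tau j)) by rewrite tauj; apply: bas_m; rewrite /is_m /=.
rewrite (ricci_dirE n_gt0 s_gt0 t_gt0 my) tauj.
rewrite sum_bracket_norm_m // sum_bracket_norm_q //.
rewrite -(cm_sqr s n_gt0) -(cq_sqr t n_gt0).
have D0 := D_gt0 (R := R) n_gt0.
have c0 := cm_neq0 n_gt0 s_gt0; have c0' := cq_neq0 n_gt0 t_gt0.
by field; rewrite c0 c0' gt_eqF.
Qed.

End EinsteinConstant.

(** * The eigenvalue lies below twice the Einstein constant *)

Theorem theorem3p7 (R : realType) (n : nat) (s E : R)
    (hn : (3 <= n)%N) (hs : 0 < s)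
    (hE : einstein_constant n s
            (s * Num.sqrt (n%:R / (2 * (n%:R - 1)))) E) :
  (lambda1 n s (s * Num.sqrt (n%:R / (2 * (n%:R - 1)))) < (2 * E)%:E)%E.
Proof.
have n_gt0 : (0 < n)%N by exact: leq_trans hn.
have n3 : 3 <= n%:R :> R by rewrite (ler_nat R 3).
move: hE; set t := s * _ => hE.
have q0 : 0 < n%:R / (2 * (n%:R - 1)) :> R.
  by rewrite divr_gt0 // ?mulr_gt0 //; lra.
have t_gt0 : 0 < t by rewrite mulr_gt0 // sqrtr_gt0.
have tE : t ^+ 2 = s ^+ 2 * (n%:R / (2 * (n%:R - 1))).
  by rewrite /t exprMn sqr_sqrtr // ltW.
have cm2 : 0 < @cm R n s ^+ 2.
  by rewrite exprn_even_gt0 //= (cm_neq0 n_gt0 hs).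
have lam_gt0 : 0 < 2 * n%:R * @cm R n s ^+ 2.
  by rewrite mulr_gt0 // mulr_gt0 //; lra.
have EE := einstein_constantE n_gt0 hs t_gt0 hE.
(* This is where t^2 / s^2 = n / (2 (n - 1)) enters. *)
have gap : 2 * E - 2 * n%:R * @cm R n s ^+ 2 =
    2 * @cm R n s ^+ 2 * ((n%:R - 1) / n%:R).
  have s0 : s != 0 by rewrite gt_eqF.
  have n0 : n%:R != 0 :> R by rewrite pnatr_eq0 -lt0n.
  have n1 : n%:R - 1 != 0 :> R by apply: lt0r_neq0; lra.
  by rewrite EE tE; field; rewrite s0 n0 n1.
apply: (@le_lt_trans _ _ (2 * n%:R * @cm R n s ^+ 2)%:E).
  apply: ereal_inf_lbound; exists (2 * n%:R * @cm R n s ^+ 2) => //.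
  by split; [exact: lam_gt0 | exact: eigenvalue_zz].
have n0 : 0 < n%:R :> R by lra.
have n1 : 0 < n%:R - 1 :> R by lra.
by rewrite lte_fin -subr_gt0 gap mulr_gt0 // ?divr_gt0 // mulr_gt0.
Qed.
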